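(* In the setting described in the context (including all items (a)--(h)), let the regularization parameter $\alpha_*=\alpha(\delta,f^\delta)$ be chosen according to the discrepancy principle. \begin{itemize} \item (No explicit smoothness) If $u^\dagger\in\overline{\mathcal R(G)}$, then $\|u_{\alpha_*}^\delta-u^\dagger\|\to 0$ as $\delta\to 0$. \item (H\''older smoothness) If $u^\dagger\in\mathcal X_p$ for some $0<p\le 1$, then $\|u_{\alpha_*}^\delta-u^\dagger\|=\mathcal O(\delta^{p/(p+a)})$ as $\delta\to 0$. \item (Low order smoothness) If $u^\dagger\in\mathcal D(\log G)$, then $\|u_{\alpha_*}^\delta-u^\dagger\|=\mathcal O\big((\log\tfrac1\delta)^{-1}\big)$ as $\delta\to 0$. \end{itemize}
   Context: **Operator $G$ and scale.** $\mathcal X,\mathcal Y$ are infinite-dimensional Banach spaces with norms $\|\cdot\|$. $G:\mathcal X\to\mathcal X$ is a bounded linear injective operator with range $\mathcal R(G)$ and unbounded inverse $G^{-1}$, of non-negative type: for every $\beta>0$, $G+\beta I:\mathcal X\to\mathcal X$ is bijective and $\|(G+\beta I)^{-1}\|_{\mathcal L(\mathcal X)}\le\kappa_*/\beta$ with a finite constant $\kappa_*>0$. ($G$ need not have dense range.) Fractional powers: $G^0=I$; for $0<p<1$, $G^pu=\frac{\sin\pi p}{\pi}\int_0^\infty s^{p-1}(G+sI)^{-1}Gu\,ds$; for $p\ge1$, $G^p=G^{p-\lfloor p\rfloor}G^{\lfloor p\rfloor}$. These are bounded and injective, and $G^{-p}:=(G^p)^{-1}$ for $p>0$. Put $\mathcal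 X_\tau=\mathcal R(G^\tau)$ for $\tau>0$, $\mathcal X_\tau=\mathcal X$ for $\tau\le0$, and $\|u\|_\tau=\|G^{-\tau}u\|$ for $u\in\mathcal X_\tau$ (so $\|u\|_{-a}=\|G^au\|$ for $a>0$). The logarithm of $G$ is $(\log G)u=\lim_{p\downarrow0}\frac1p(G^pu-u)$ with domain $\mathcal D(\log G)=\{u\in\mathcal X:\lim_{p\downarrow0}\frac1p(G^pu-u)\text{ exists}\}$. **Problem.** $F:\mathcal X\supset\mathcal D(F)\to\mathcal Y$ is a nonlinear operator, $f^\dagger\in\mathcal Y$, and $u^\dagger\in\mathcal D(F)$ satisfies $F(u^\dagger)=f^\dagger$. The equation is locally ill-posed at $u^\dagger$ (for arbitrarily small $\rho>0$ there is a sequence in $\mathcal D(F)$ within distance $\rho$ of $u^\dagger$ whose images under $F$ converge to $F(u^\dagger)$ but which does not converge to $u^\dagger$). **Assumptions.** (a) $\mathcal X$ has a separable pre-dual $\mathcal Z$, $\mathcal Z^*=\mathcal X$; weak$^*$-convergence in $\mathcal X$ refers to it. (b) $F$ is weak$^*$-to-weak sequentially continuous: if $u_n,u_0\in\mathcal D(F)$ and $u_n\rightharpoonup^*u_0$ in $\mathcal X$, then $F(u_n)\rightharpoonup F(u_0)$ in $\mathcal Y$. (c) $\mathcal D(F)$ is sequentially weak$^*$-closed. (d) $\mathcal D:=\mathcal D(F)\cap\mathcal X_1\ne\varnothing$. (e) $u^\dagger$ is an interior point of $\mathcal D(F)$. (f) The data $f^\delta\in\mathcal Y$ satisfy $\|f^\delta-f^\dagger\|\le\delta$;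 the initial guess satisfies $\bar u\in\mathcal X_1\cap\mathcal D(F)$. (g) There are finite constants $a>0$, $0<c_a\le C_a$, $c_0,c_1>0$ such that $\|F(u)-f^\dagger\|\le C_a\|u-u^\dagger\|_{-a}$ for each $u\in\mathcal D$ with $\|u-u^\dagger\|_{-a}\le c_0$, and $c_a\|u-u^\dagger\|_{-a}\le\|F(u)-f^\dagger\|$ for each $u\in\mathcal D$ with $\|F(u)-f^\dagger\|\le c_1$. (h) $G$ has a pre-adjoint $\tilde G:\mathcal Z\to\mathcal Z$, $\tilde G^*=G$. **Regularized solutions.** Fix $r>0$. For $\alpha>0$, $u_\alpha^\delta\in\mathcal D$ denotes a minimizer over $u\in\mathcal D(F)$ of $T_\alpha^\delta(u)=\|F(u)-f^\delta\|^r+\alpha\|u-\bar u\|_1^r$, where $\|u-\bar u\|_1=+\infty$ for $u\notin\mathcal X_1$ (minimizers exist in this setting). **Discrepancy principle.** Let $e_r=1$ if $r\ge1$ and $e_r=2^{-1+1/r}$ otherwise. Fix finite constants $b>e_r$, $c>1$. If $\|F(\bar u)-f^\delta\|\le b\delta$, set $\alpha_*=\infty$ and $u_\infty^\delta:=\bar u$. Otherwise choose a finite $\alpha_*>0$ such that $\|F(u_{\alpha_*}^\delta)-f^\delta\|\le b\delta\le\|F(u_{\gamma_\delta}^\delta)-f^\delta\|$ for some $\alpha_*\le\gamma_\delta\le c\,\alpha_*$. Asymptotic statements as $\delta\to0$ are for families of data $f^\delta$, $\delta>0$, satisfying (f). *)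

(* Defs.v *)
From Stdlib Require Import Reals ZArith ClassicalEpsilon.
From Coquelicot Require Import Coquelicot.
Open Scope R_scope.

(* Real Banach spaces are [CompleteNormedModule R_AbsRing]; a bounded linear
   map is Coquelicot's [is_linear]. *)
Notation Banach := (CompleteNormedModule R_AbsRing).

Definition infinite_dimensional (V : Banach) : Prop :=
  forall (n : nat) (v : nat -> V),
    exists x : V, forall c : nat -> R,
      x <> sum_n (fun i => scal (c i) (v i)) n.

Definition separable (V : Banach) : Prop :=
  exists v : nat -> V, forall (x : V) (eps : R), 0 < eps ->
    exists n : nat, norm (minus x (v n)) < eps.

(* [Rpower 0 r] is [1]; real powers of norms need [0 ^ r = 0] for [r > 0]. *)
Definition rpow (x r : R) : R :=
  if Req_EM_T x 0 then 0 else Rpower x r.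

Definition bigO_at_0 (f g : R -> R) : Prop :=
  exists K : R, at_right 0 (fun d => Rabs (f d) <= K * Rabs (g d)).

Section Topologies.

Context {V Z : Banach}.

Definition weakly_converges (y : nat -> V) (l : V) : Prop :=
  forall phi : V -> R, is_linear (phi : V -> R_NormedModule) ->
    is_lim_seq (fun n => phi (y n)) (phi l).

(* [V] is the dual of [Z]: [x |-> J x] is a linear isometric bijection of [V]
   onto the bounded linear functionals on [Z] with the operator norm. *)
Definition is_dual_pairing (J : V -> Z -> R) : Prop :=
  (forall x, is_linear (J x : Z -> R_NormedModule)) /\
  (forall x y z, J (plus x y) z = J x z + J y z) /\
  (forall k x z, J (scal k x) z = k * J x z) /\
  (forall x, is_lub (fun t => exists z : Z, norm z <= 1 /\ t = Rabs (J x z))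
                    (norm x)) /\
  (forall phi : Z -> R, is_linear (phi : Z -> R_NormedModule) ->
     exists x, forall z, J x z = phi z).

Definition weak_star_converges (J : V -> Z -> R) (u : nat -> V) (l : V) : Prop :=
  forall z, is_lim_seq (fun n => J (u n) z) (J l z).

End Topologies.

Section Scale.

Context {X : Banach}.

(* Meaningful where the preimage exists and is unique (see [iota_correct]). *)
Definition inv_op (T : X -> X) (w : X) : X := iota (fun u => T u = w).

Definition shifted (G : X -> X) (s : R) (u : X) : X := plus (G u) (scal s u).

Definition nonneg_type (G : X -> X) : Prop :=
  exists kappa : R, 0 < kappa /\
    forall beta, 0 < beta ->
      (forall w, exists! u, shifted G beta u = w) /\
      (forall w, norm (inv_op (shifted G beta) w) <= kappa / beta * norm w).

Definition unbounded_inverse (G : X -> X) : Prop :=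
  ~ exists M : R, forall w, (exists u, G u = w) ->
      norm (inv_op G w) <= M * norm w.

(* [G ^ p] for [0 < p < 1]; the improper integral is a norm limit in [X]. *)
Definition frac_pow01 (G : X -> X) (p : R) (u : X) : X :=
  scal (sin (PI * p) / PI)
    (RInt_gen (fun s => scal (Rpower s (p - 1)) (inv_op (shifted G s) (G u)))
       (at_right 0) (Rbar_locally p_infty)).

(* [G ^ p] for [p >= 0]; [Int_part p] is the floor of [p]. *)
Definition frac_pow (G : X -> X) (p : R) (u : X) : X :=
  let v := Nat.iter (Z.to_nat (Int_part p)) G u in
  if Req_EM_T (frac_part p) 0 then v else frac_pow01 G (frac_part p) v.

Definition gpow (G : X -> X) (tau : R) : X -> X :=
  if Rle_dec 0 tau then frac_pow G tau else inv_op (frac_pow G (- tau)).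

Definition in_scale (G : X -> X) (tau : R) (u : X) : Prop :=
  0 < tau -> exists w, gpow G tau w = u.

(* Only meaningful when [in_scale G tau u]. *)
Definition scale_norm (G : X -> X) (tau : R) (u : X) : R :=
  norm (gpow G (- tau) u).

Definition in_dom_log (G : X -> X) (u : X) : Prop :=
  exists l : X,
    filterlim (fun p => scal (/ p) (minus (frac_pow G p u) u))
      (at_right 0) (locally l).

Definition in_range_closure (G : X -> X) (u : X) : Prop :=
  forall eps, 0 < eps -> exists w, norm (minus (G w) u) < eps.

End Scale.

Section Regularization.

(* A partial operator is a total function [F] together with its domain [DF];
   the values of [F] outside [DF] are never used. *)
Context {X Y : Banach} (G : X -> X) (DF : X -> Prop) (F : X -> Y).

Definition locally_ill_posed_at (udag : X) : Prop :=
  forall rho, 0 < rho -> exists u : nat -> X,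
    (forall n, DF (u n) /\ norm (minus (u n) udag) <= rho) /\
    filterlim (fun n => F (u n)) eventually (locally (F udag)) /\
    ~ filterlim u eventually (locally udag).

Definition in_D (u : X) : Prop := DF u /\ in_scale G 1 u.

Definition tikhonov (r : R) (ubar : X) (f : Y) (alpha : R) (u : X) : Rbar :=
  if excluded_middle_informative (in_scale G 1 u)
  then Finite (rpow (norm (minus (F u) f)) r
               + alpha * rpow (scale_norm G 1 (minus u ubar)) r)
  else p_infty.

Definition is_minimizer (r : R) (ubar : X) (f : Y) (alpha : R) (u : X) : Prop :=
  in_D u /\
  forall v, DF v -> Rbar_le (tikhonov r ubar f alpha u) (tikhonov r ubar f alpha v).

Definition e_const (r : R) : R :=
  if Rle_dec 1 r then 1 else Rpower 2 (-1 + 1 / r).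

(* [u alpha] is the regularized solution for finite [alpha]; at infinity it is
   the initial guess.  The value at [m_infty] is irrelevant. *)
Definition reg_solution (ubar : X) (u : R -> X) (alpha : Rbar) : X :=
  match alpha with Finite a => u a | _ => ubar end.

Definition discrepancy_principle (b c : R) (ubar : X) (delta : R) (f : Y)
    (u : R -> X) (alpha : Rbar) : Prop :=
  (norm (minus (F ubar) f) <= b * delta -> alpha = p_infty) /\
  (b * delta < norm (minus (F ubar) f) ->
     exists a : R, alpha = Finite a /\ 0 < a /\
       norm (minus (F (u a)) f) <= b * delta /\
       exists gamma, a <= gamma <= c * a /\
         b * delta <= norm (minus (F (u gamma)) f)).

End Regularization.

(* Main.v *)
Require Import Defs.
From Stdlib Require Import Reals ZArith ClassicalEpsilon Lra Lia List.
From Coquelicot Require Import Coquelicot.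
Open Scope R_scope.

(** Why the theorem holds.  For [beta > 0] put [low beta = beta (G + beta)^-1] and
    [high beta = G (G + beta)^-1].  The two add up to the identity and are bounded
    uniformly in [beta] because [G] is of non-negative type.  If [G] were multiplication
    by a function [lambda >= 0], then [low beta] would keep the part of an element that
    lives where [lambda] is at most of order [beta], and [high beta] the rest.

    Let [e = ubar - udag], [n] the integer part of [a], and compare the regularized
    solution [u] with the auxiliary element [uhat = udag + (low beta)^(n+2) e].  All its
    properties are controlled by the single quantity [eta = |low beta e|]: it is at
    distance [O(eta)] from [udag], also [|G^a (uhat - udag)| = O(beta^a eta)], and
    [uhat - ubar = G rho] with [|rho| = O(eta / beta)] ([smooth_bound],
    [smooth_weak_bound], [uhat_penalty]).

    If [beta^a eta <= e0 delta] with [e0] small, then [uhat] fits the data up to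
    [b' delta] for some [b' < b].  The discrepancy principle makes the residual at a
    parameter comparable with [alpha] at least [b delta]; comparing Tikhonov functionals
    there and at [alpha] gives [|u - ubar|_1 = O(|uhat - ubar|_1)]
    ([discrepancy_penalty_bound]).  So [v = u - uhat] is [G w] with
    [beta |w| = O(eta)], while [|G^a v| = O(delta)].

    The norm of [v] is estimated by splitting it as [(high beta)^(n+1) v] plus a
    remainder.  The remainder is [O(beta |w|)], hence [O(eta)].  The first part is at most
    [C beta^(-a) |G^a v|]: on the range of [high beta] the operator [G^a] can be inverted
    at cost [beta^(-a)] ([iter_high_inverse_estimate]).  The outcome is [error_bound]:
    the error is at most [K (eta + beta^(-a) delta)] for every [beta] such that
    [beta^a eta <= e0 delta].

    The three claims follow by choosing [beta] as a function of [delta], once the size of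
    [eta] is known.  It tends to zero for [udag] in the closure of the range of [G]
    ([low_vanishes_on_closure]); it is [O(beta^p)] for [udag] in the range of [G^p]
    ([low_frac_pow_bound]); and it is [O(1 / log (1/beta))] on the domain of [log G]
    ([low_dom_log_bound]).  The last bound comes from
    [low beta u = low beta (G^p u) + low beta (u - G^p u)] with [p = K / log (1/beta)]:
    for [K] large the first term is at most half of [|low beta u|] plus [O(p)], the
    second is [O(p)] by definition of the domain.

    The inverse estimate for a fractional exponent [q] is the hardest step.  It amounts to
    [G^(1-q) G^q = const G] with some positive constant.  Writing
    both powers as integrals over resolvents and substituting [s = t sigma] turns the
    product into a double integral of [sigma^(q-1) (G + t)^-1 (G + t sigma)^-1 G y].  The
    integral over [t] of the product of resolvents is [ln sigma / (sigma - 1) y] in the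
    limit.  All this is carried out on squares [1/N <= t, sigma <= N] with explicit error
    terms, so that only an exchange of integrals over rectangles is used, and [N] tends
    to infinity in the final inequality. *)

(** * Linear identities in a module *)

Section LinearCombinations.

Context {V : NormedModule R_AbsRing}.

(** Both sides of an identity between linear combinations are read as expressions over
    a list of atoms and compared coefficient by coefficient in [R]. *)
Inductive lin_expr : Type :=
  | LVar (n : nat)
  | LZero
  | LPlus (e f : lin_expr)
  | LMinus (e f : lin_expr)
  | LOpp (e : lin_expr)
  | LScal (k : R) (e : lin_expr).

Fixpoint lin_eval (l : list V) (e : lin_expr) : V :=
  match e with
  | LVar n => nth n l zero
  | LZero => zero
  | LPlus e f => plus (lin_eval l e) (lin_eval l f)
  | LMinus e f => minus (lin_eval l e) (lin_eval l f)
  | LOpp e => opp (lin_eval l e)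
  | LScal k e => scal k (lin_eval l e)
  end.

Fixpoint lin_coef (e : lin_expr) (i : nat) : R :=
  match e with
  | LVar n => if Nat.eqb n i then 1 else 0
  | LZero => 0
  | LPlus e f => lin_coef e i + lin_coef f i
  | LMinus e f => lin_coef e i - lin_coef f i
  | LOpp e => - lin_coef e i
  | LScal k e => k * lin_coef e i
  end.

Fixpoint lin_comb (c : nat -> R) (l : list V) : V :=
  match l with
  | nil => zero
  | x :: l => plus (scal (c 0%nat) x) (lin_comb (fun i => c (S i)) l)
  end.

Fixpoint same_coefs (c d : nat -> R) (l : list V) : Prop :=
  match l with
  | nil => True
  | _ :: l => c 0%nat = d 0%nat /\ same_coefs (fun i => c (S i)) (fun i => d (S i)) l
  end.

Lemma lin_comb_ext (l : list V) : forall c d : nat -> R,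
  same_coefs c d l -> lin_comb c l = lin_comb d l.
Proof.
induction l as [|x l IH]; intros c d; simpl; [easy|].
intros [-> H]. now rewrite (IH _ _ H).
Qed.

Lemma lin_comb_zero (l : list V) : lin_comb (fun _ => 0) l = zero.
Proof.
induction l as [|x l IH]; simpl; [easy|].
rewrite IH, plus_zero_r. exact (scal_zero_l x).
Qed.

Lemma lin_comb_var (l : list V) : forall n : nat,
  nth n l zero = lin_comb (fun i => if Nat.eqb n i then 1 else 0) l.
Proof.
induction l as [|x l IH]; intros [|n]; simpl; try easy.
- rewrite lin_comb_zero, plus_zero_r. symmetry. exact (scal_one x).
- rewrite <- IH, (scal_zero_l x : scal 0 x = zero). symmetry. apply plus_zero_l.
Qed.

Lemma lin_comb_plus (l : list V) : forall c d : nat -> R,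
  lin_comb (fun i => c i + d i) l = plus (lin_comb c l) (lin_comb d l).
Proof.
induction l as [|x l IH]; intros c d; simpl.
- now rewrite plus_zero_l.
- rewrite (IH (fun i => c (S i)) (fun i => d (S i))).
  rewrite (scal_distr_r (c 0%nat) (d 0%nat) x
           : scal (c 0%nat + d 0%nat) x = plus (scal (c 0%nat) x) (scal (d 0%nat) x)).
  rewrite <- !plus_assoc. f_equal.
  rewrite !plus_assoc. f_equal. apply plus_comm.
Qed.

Lemma lin_comb_scal (l : list V) : forall (k : R) (c : nat -> R),
  lin_comb (fun i => k * c i) l = scal k (lin_comb c l).
Proof.
induction l as [|x l IH]; intros k c; simpl.
- symmetry. exact (@scal_zero_r R_AbsRing V k).
- rewrite (IH k (fun i => c (S i))), scal_distr_l, scal_assoc. reflexivity.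
Qed.

Lemma lin_comb_opp (l : list V) (c : nat -> R) :
  lin_comb (fun i => - c i) l = opp (lin_comb c l).
Proof.
transitivity (lin_comb (fun i => -1 * c i) l).
- apply lin_comb_ext. revert c; induction l as [|x l IH]; intros c; simpl; split.
  + ring.
  + apply (IH (fun i => c (S i))).
- rewrite lin_comb_scal. exact (scal_opp_one (lin_comb c l)).
Qed.

Lemma lin_eval_comb (l : list V) (e : lin_expr) :
  lin_eval l e = lin_comb (lin_coef e) l.
Proof.
induction e; simpl.
- apply lin_comb_var.
- now rewrite lin_comb_zero.
- now rewrite IHe1, IHe2, <- lin_comb_plus.
- unfold minus. now rewrite IHe1, IHe2, <- lin_comb_opp, <- lin_comb_plus.
- now rewrite IHe, <- lin_comb_opp.
- now rewrite IHe, <- lin_comb_scal.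
Qed.

Lemma lin_eval_eq (l : list V) (e f : lin_expr) :
  same_coefs (lin_coef e) (lin_coef f) l -> lin_eval l e = lin_eval l f.
Proof. intros H. rewrite !lin_eval_comb. now apply lin_comb_ext. Qed.

End LinearCombinations.

Ltac lin_index x l :=
  lazymatch l with
  | x :: _ => constr:(0%nat)
  | _ :: ?l => let n := lin_index x l in constr:(S n)
  end.

Ltac lin_mem x l :=
  lazymatch l with
  | nil => constr:(false)
  | x :: _ => constr:(true)
  | _ :: ?l => lin_mem x l
  end.

Ltac lin_atoms t l :=
  lazymatch t with
  | zero => l
  | plus ?a ?b => let l := lin_atoms a l in lin_atoms b l
  | minus ?a ?b => let l := lin_atoms a l in lin_atoms b l
  | opp ?a => lin_atoms a l
  | scal _ ?a => lin_atoms a l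
  | _ => lazymatch lin_mem t l with
         | true => l
         | false => constr:(t :: l)
         end
  end.

Ltac lin_reify t l :=
  lazymatch t with
  | zero => constr:(LZero)
  | plus ?a ?b => let e := lin_reify a l in let f := lin_reify b l in constr:(LPlus e f)
  | minus ?a ?b => let e := lin_reify a l in let f := lin_reify b l in constr:(LMinus e f)
  | opp ?a => let e := lin_reify a l in constr:(LOpp e)
  | scal ?k ?a => let e := lin_reify a l in constr:(LScal k e)
  | _ => let n := lin_index t l in constr:(LVar n)
  end.

Ltac lin_coefs :=
  lazymatch goal with
  | |- @eq ?T ?a ?b =>
    let l := lin_atoms a (@nil T) in
    let l := lin_atoms b l in
    let e := lin_reify a l in
    let f := lin_reify b l in
    change (lin_eval l e = lin_eval l f);
    apply lin_eval_eq; cbn [same_coefs lin_coef Nat.eqb];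
    repeat split
  end.

Ltac vring := lin_coefs; ring.
Ltac vfield := lin_coefs; field.

(** * Norms and continuity *)

Section Norms.

Context {V : Banach}.

Lemma norm_scal_le (k : R) (x : V) : norm (scal k x) <= Rabs k * norm x.
Proof. exact (@norm_scal R_AbsRing V k x). Qed.

Lemma norm_scal_pos_le (k : R) (x : V) : 0 <= k -> norm (scal k x) <= k * norm x.
Proof. intros Hk. rewrite <- (Rabs_pos_eq k Hk) at 2. apply norm_scal_le. Qed.

Lemma norm_minus_le (x y : V) : norm (minus x y) <= norm x + norm y.
Proof. rewrite <- (norm_opp y). exact (norm_triangle x (opp y)). Qed.

Lemma norm_plus_le (x y : V) : norm (plus x y) <= norm x + norm y.
Proof. exact (norm_triangle x y). Qed.

Lemma norm_nonneg (x : V) : 0 <= norm x.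
Proof. apply norm_ge_0. Qed.

Lemma norm_0 : norm (zero : V) = 0.
Proof. exact (@norm_zero R_AbsRing V). Qed.

Lemma norm_minus_sym (x y : V) : norm (minus x y) = norm (minus y x).
Proof. rewrite <- norm_opp. f_equal. vring. Qed.

Lemma norm_minus_triangle (x y z : V) :
  norm (minus x z) <= norm (minus x y) + norm (minus y z).
Proof.
replace (minus x z) with (plus (minus x y) (minus y z)) by vring. apply norm_plus_le.
Qed.

Lemma norm_le_norm_minus (x y : V) : norm x <= norm y + norm (minus y x).
Proof. replace x with (minus y (minus y x)) at 1 by vring. apply norm_minus_le. Qed.

Lemma locally_lipschitz_continuous (f : R -> V) (s d L : R) : 0 < d ->
  (forall t, Rabs (t - s) < d -> norm (minus (f t) (f s)) <= L * Rabs (t - s)) ->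
  continuous f s.
Proof.
intros Hd HL.
refine (proj2 (@filterlim_locally_ball_norm R_AbsRing R V (locally s) _ f (f s)) _).
intros eps. assert (He := cond_pos eps).
assert (HM : 0 < Rabs L + 1) by (pose proof (Rabs_pos L); lra).
assert (Hd' : 0 < Rmin d (eps / (Rabs L + 1))).
{ apply Rmin_pos; [easy|now apply Rdiv_lt_0_compat]. }
exists (mkposreal _ Hd'). intros t Ht. unfold ball_norm.
change (Rabs (t - s) < Rmin d (eps / (Rabs L + 1))) in Ht.
assert (H1 := Rmin_l d (eps / (Rabs L + 1))).
assert (H2 := Rmin_r d (eps / (Rabs L + 1))).
eapply Rle_lt_trans; [apply HL; lra|].
apply Rle_lt_trans with (Rabs (t - s) * (Rabs L + 1)).
- rewrite Rmult_comm. apply Rmult_le_compat_l; [apply Rabs_pos|].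
  pose proof (Rle_abs L). lra.
- apply (Rmult_lt_reg_r (/ (Rabs L + 1))); [now apply Rinv_0_lt_compat|].
  rewrite Rmult_assoc, Rinv_r by lra. unfold Rdiv in *. lra.
Qed.

End Norms.

Ltac norm_as e :=
  lazymatch goal with |- norm ?x <= _ => replace x with e end.

(** * Resolvents of an operator of non-negative type *)

(** The constant is kept explicit, so that later bounds can be written in terms of it. *)
Definition nonneg_type_with {X : Banach} (G : X -> X) (kappa : R) : Prop :=
  forall beta, 0 < beta ->
    (forall w, exists! u, shifted G beta u = w) /\
    (forall w, norm (inv_op (shifted G beta) w) <= kappa / beta * norm w).

Definition resolvent {X : Banach} (G : X -> X) (s : R) : X -> X :=
  inv_op (shifted G s).

(** The part of [x] living at small spectral values: the multiplier is
    [lambda |-> s / (lambda + s)]. *)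
Definition low {X : Banach} (G : X -> X) (s : R) (x : X) : X :=
  scal s (resolvent G s x).

(** The part of [x] living at large spectral values: the multiplier is
    [lambda |-> lambda / (lambda + s)]. *)
Definition high {X : Banach} (G : X -> X) (s : R) (x : X) : X :=
  G (resolvent G s x).

Section Resolvent.

Context {X : Banach} (G : X -> X) (kappa : R).
Context (HG : is_linear G) (Hkappa : 0 < kappa).
Context (Hres : nonneg_type_with G kappa).

Local Notation R_ := (resolvent G).

Lemma shifted_resolvent (s : R) (w : X) : 0 < s ->
  plus (G (R_ s w)) (scal s (R_ s w)) = w.
Proof.
intros Hs. exact (iota_correct _ (proj1 (Hres s Hs) w)).
Qed.

Lemma shifted_inj (s : R) (x y : X) : 0 < s ->
  plus (G x) (scal s x) = plus (G y) (scal s y) -> x = y.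
Proof.
intros Hs H. destruct (proj1 (Hres s Hs) (shifted G s y)) as [z [_ Hz]].
rewrite <- (Hz x), <- (Hz y); easy.
Qed.

Lemma resolvent_bound (s : R) (x : X) : 0 < s ->
  norm (R_ s x) <= kappa / s * norm x.
Proof. intros Hs. apply (proj2 (Hres s Hs)). Qed.

Lemma resolvent_linear (s : R) : 0 < s -> is_linear (R_ s).
Proof.
intros Hs. split.
- intros x y. apply (shifted_inj s); [easy|].
  rewrite shifted_resolvent, (linear_plus G HG) by easy.
  rewrite <- (shifted_resolvent s x) at 1 by easy.
  rewrite <- (shifted_resolvent s y) at 1 by easy. vring.
- intros k x. apply (shifted_inj s); [easy|].
  rewrite shifted_resolvent, (linear_scal G HG) by easy.
  rewrite <- (shifted_resolvent s x) at 1 by easy. vring.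
- exists (kappa / s). split.
  + now apply Rdiv_lt_0_compat.
  + intros x. now apply resolvent_bound.
Qed.

(** Only commutation with [G] is asked of [T]: it passes to the resolvents because
    [G + s] is injective. *)
Lemma resolvent_comm_op (T : X -> X) (s : R) (x : X) : 0 < s -> is_linear T ->
  (forall y, T (G y) = G (T y)) -> R_ s (T x) = T (R_ s x).
Proof.
intros Hs HT Hc. apply (shifted_inj s); [easy|].
rewrite shifted_resolvent by easy.
rewrite <- (shifted_resolvent s x) at 1 by easy.
now rewrite (linear_plus T HT), (linear_scal T HT), Hc.
Qed.

Lemma resolvent_comm_G (s : R) (x : X) : 0 < s -> R_ s (G x) = G (R_ s x).
Proof. intros Hs. now apply resolvent_comm_op. Qed.

Lemma resolvent_identity (s t : R) (x : X) : 0 < s -> 0 < t ->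
  minus (R_ s x) (R_ t x) = scal (t - s) (R_ s (R_ t x)).
Proof.
intros Hs Ht.
rewrite <- (shifted_resolvent t x) at 1 by easy.
rewrite (linear_plus _ (resolvent_linear s Hs)), (linear_scal _ (resolvent_linear s Hs)).
rewrite <- (shifted_resolvent s (R_ t x)) at 3 by easy.
rewrite resolvent_comm_G by easy. vring.
Qed.

Lemma low_plus_high (s : R) (x : X) : 0 < s -> plus (low G s x) (high G s x) = x.
Proof.
intros Hs. rewrite <- (shifted_resolvent s x) at 3 by easy. unfold low, high. vring.
Qed.

Lemma low_linear (s : R) : 0 < s -> is_linear (low G s).
Proof.
intros Hs. unfold low. apply (is_linear_comp (resolvent G s) (fun y => scal s y)).
- now apply resolvent_linear.
- exact (@is_linear_scal_r R_AbsRing X s Rmult_comm).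
Qed.

Lemma high_linear (s : R) : 0 < s -> is_linear (high G s).
Proof. intros Hs. exact (is_linear_comp _ G (resolvent_linear s Hs) HG). Qed.

Lemma low_bound (s : R) (x : X) : 0 < s -> norm (low G s x) <= kappa * norm x.
Proof.
intros Hs. unfold low. eapply Rle_trans; [apply norm_scal_pos_le; lra|].
eapply Rle_trans; [apply Rmult_le_compat_l; [lra|now apply resolvent_bound]|].
right. field. lra.
Qed.

Lemma high_bound (s : R) (x : X) : 0 < s -> norm (high G s x) <= (1 + kappa) * norm x.
Proof.
intros Hs. replace (high G s x) with (minus x (low G s x)).
- eapply Rle_trans; [apply norm_minus_le|]. pose proof (low_bound s x Hs). lra.
- rewrite <- (low_plus_high s x) at 1 by easy. vring.
Qed.

Lemma low_comm_G (s : R) (x : X) : 0 < s -> low G s (G x) = G (low G s x).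
Proof.
intros Hs. unfold low. now rewrite resolvent_comm_G, (linear_scal G HG).
Qed.

Lemma high_comm_G (s : R) (x : X) : 0 < s -> high G s (G x) = G (high G s x).
Proof. intros Hs. unfold high. now rewrite resolvent_comm_G. Qed.

(** A factor [G] in front of [low s] is worth a factor [s]. *)
Lemma G_low (s : R) (x : X) : G (low G s x) = scal s (high G s x).
Proof. unfold low, high. now rewrite (linear_scal G HG). Qed.

Lemma resolvent_lipschitz (s t : R) (x : X) : 0 < s -> 0 < t ->
  norm (minus (R_ s x) (R_ t x)) <= Rabs (s - t) * (kappa / s * (kappa / t) * norm x).
Proof.
intros Hs Ht. rewrite resolvent_identity by easy.
eapply Rle_trans; [apply norm_scal_le|]. rewrite Rabs_minus_sym.
apply Rmult_le_compat_l; [apply Rabs_pos|].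
eapply Rle_trans; [now apply resolvent_bound|]. rewrite Rmult_assoc.
apply Rmult_le_compat_l; [|now apply resolvent_bound].
left. now apply Rdiv_lt_0_compat.
Qed.

Lemma resolvent_continuous (x : X) (s : R) : 0 < s ->
  continuous (fun s => R_ s x) s.
Proof.
intros Hs.
apply (locally_lipschitz_continuous _ s (s / 2)
         (kappa / s * (kappa / (s / 2)) * norm x)); [lra|].
intros t Ht.
assert (Ht2 : s / 2 < t) by (unfold Rabs in Ht; destruct Rcase_abs in Ht; lra).
eapply Rle_trans; [apply resolvent_lipschitz; lra|].
rewrite Rmult_comm. apply Rmult_le_compat_r; [apply Rabs_pos|].
apply Rmult_le_compat_r; [apply norm_nonneg|]. rewrite Rmult_comm.
apply Rmult_le_compat_l; [left; apply Rdiv_lt_0_compat; lra|].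
apply Rmult_le_compat_l; [lra|]. apply Rinv_le_contravar; lra.
Qed.

End Resolvent.

(** * Power functions *)

Lemma Rpower_pos (x e : R) : 0 < Rpower x e.
Proof. apply exp_pos. Qed.

Lemma is_derive_Rpower (e x : R) : 0 < x ->
  is_derive (fun s => Rpower s e) x (e * Rpower x (e - 1)).
Proof. intros Hx. apply is_derive_Reals. now apply derivable_pt_lim_power. Qed.

Lemma continuous_Rpower (e x : R) : 0 < x -> continuous (fun s => Rpower s e) x.
Proof.
intros Hx. apply (ex_derive_continuous (fun s => Rpower s e)).
eexists. now apply is_derive_Rpower.
Qed.

Lemma is_RInt_Rpower (e a b : R) : e <> 0 -> 0 < a -> 0 < b ->
  is_RInt (fun s => Rpower s (e - 1)) a b ((Rpower b e - Rpower a e) / e).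
Proof.
intros He Ha Hb.
assert (Hpos : forall x, Rmin a b <= x -> 0 < x).
{ intros x Hx. pose proof (Rmin_glb_lt a b 0 Ha Hb). lra. }
replace ((Rpower b e - Rpower a e) / e)
  with (minus (/ e * Rpower b e) (/ e * Rpower a e)).
2: { unfold minus, plus, opp; simpl. field. easy. }
apply (is_RInt_derive (fun s => / e * Rpower s e)).
- intros x [Hx _]. apply Hpos in Hx.
  replace (Rpower x (e - 1)) with (/ e * (e * Rpower x (e - 1))) by (field; easy).
  apply (is_derive_scal (fun s => Rpower s e)). now apply is_derive_Rpower.
- intros x [Hx _]. apply continuous_Rpower. now apply Hpos.
Qed.

Lemma Rpower_small (e eta : R) : 0 < e -> 0 < eta ->
  exists a, 0 < a <= 1 /\ forall x, 0 < x <= a -> Rpower x e < eta.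
Proof.
intros He Heta.
set (a0 := Rpower (eta / 2) (/ e)).
assert (H0 : 0 < a0) by apply Rpower_pos.
exists (Rmin a0 1). split.
- split; [apply Rmin_pos; lra|apply Rmin_r].
- intros x [Hx Hxa]. pose proof (Rmin_l a0 1).
  apply Rle_lt_trans with (Rpower a0 e).
  + apply Rle_Rpower_l; lra.
  + unfold a0. rewrite Rpower_mult, Rinv_l, Rpower_1; lra.
Qed.

Lemma Rpower_inv_base (x e : R) : 0 < x -> Rpower (/ x) e = Rpower x (- e).
Proof. intros Hx. unfold Rpower. rewrite ln_Rinv by easy. f_equal. ring. Qed.

(** * Integrals and bounded linear maps *)

Section LinearIntegral.

Context {V W : Banach} (T : V -> W) (HT : is_linear T).

Lemma Riemann_sum_linear (f : R -> V) (ptd : SF_seq) :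
  Riemann_sum (fun s => T (f s)) ptd = T (Riemann_sum f ptd).
Proof.
apply SF_cons_ind with (s := ptd).
- intros x. symmetry. exact (linear_zero T HT).
- intros h s IH. rewrite !Riemann_sum_cons, (linear_plus T HT), (linear_scal T HT).
  now rewrite IH.
Qed.

Lemma is_RInt_linear (f : R -> V) (a b : R) (l : V) :
  is_RInt f a b l -> is_RInt (fun s => T (f s)) a b (T l).
Proof.
intros H. unfold is_RInt.
apply filterlim_ext with (fun ptd => T (scal (sign (b - a)) (Riemann_sum f ptd))).
- intros ptd. now rewrite (linear_scal T HT), Riemann_sum_linear.
- apply filterlim_comp with (1 := H). exact (linear_cont T l HT).
Qed.

Lemma is_RInt_gen_linear (Fa Fb : (R -> Prop) -> Prop) (f : R -> V) (l : V) :
  Filter Fa -> Filter Fb -> is_RInt_gen f Fa Fb l ->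
  is_RInt_gen (fun s => T (f s)) Fa Fb (T l).
Proof.
intros HFa HFb H P HP.
generalize (H _ (linear_cont T l HT P HP)). unfold filtermapi.
apply filter_imp. intros ab [y [Hy HPy]]. exists (T y). split; [|easy].
now apply is_RInt_linear.
Qed.

End LinearIntegral.

(** * Integrals over the half-line with power bounds *)

(** The bounds on integration limits that hold eventually for the two ends of the
    improper integral. *)
Lemma mellin_domain (a b : R) : 0 < a ->
  filter_prod (at_right 0) (Rbar_locally p_infty)
    (fun ab => (0 < fst ab /\ fst ab <= a) /\ (0 < snd ab /\ b <= snd ab)).
Proof.
intros Ha. exists (fun x => 0 < x /\ x <= a) (fun y => 0 < y /\ b <= y).
- exists (mkposreal _ Ha). intros y Hy H0. split; [easy|].
  change (Rabs (y - 0) < a) in Hy. rewrite Rminus_0_r in Hy.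
  pose proof (Rle_abs y). lra.
- exists (Rmax 0 b). intros y Hy. pose proof (Rmax_l 0 b). pose proof (Rmax_r 0 b). lra.
- easy.
Qed.

Section Mellin.

Context {V : Banach} (f : R -> V) (q m1 m2 : R).
Context (Hq : 0 < q < 1).
Context (Hf : forall s, 0 < s -> continuous f s).
Context (Hm1 : forall s, 0 < s -> norm (f s) <= m1 * Rpower s (q - 1)).
Context (Hm2 : forall s, 0 < s -> norm (f s) <= m2 * Rpower s (q - 1 - 1)).

Lemma ex_RInt_pos (a b : R) : 0 < a -> 0 < b -> ex_RInt f a b.
Proof.
intros Ha Hb. apply (@ex_RInt_continuous V). intros z [Hz _]. apply Hf.
pose proof (Rmin_glb_lt a b 0 Ha Hb). lra.
Qed.

(** Near zero the bound [m1 s^(q-1)] is integrable, near infinity [m2 s^(q-2)] is. *)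
Lemma mellin_near_zero (a b : R) : 0 < a <= b ->
  norm (RInt f a b) <= m1 * (Rpower b q / q).
Proof.
intros Hab.
assert (Hm1' : 0 <= m1).
{ pose proof (Hm1 1 Rlt_0_1). pose proof (norm_nonneg (f 1)).
  pose proof (Rpower_pos 1 (q - 1)). nra. }
apply Rle_trans with (m1 * ((Rpower b q - Rpower a q) / q)).
- apply (norm_RInt_le f (fun s => m1 * Rpower s (q - 1)) a b); [lra| | |].
  + intros x Hx. apply Hm1. lra.
  + apply (@RInt_correct V), ex_RInt_pos; lra.
  + apply (is_RInt_scal (fun s => Rpower s (q - 1))), is_RInt_Rpower; lra.
- apply Rmult_le_compat_l; [easy|]. apply Rmult_le_compat_r.
  + left; apply Rinv_0_lt_compat; lra.
  + pose proof (Rpower_pos a q). lra.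
Qed.

Lemma mellin_near_infinity (a b : R) : 0 < a <= b ->
  norm (RInt f a b) <= m2 * (Rpower a (q - 1) / (1 - q)).
Proof.
intros Hab.
assert (Hm2' : 0 <= m2).
{ pose proof (Hm2 1 Rlt_0_1). pose proof (norm_nonneg (f 1)).
  pose proof (Rpower_pos 1 (q - 1 - 1)). nra. }
apply Rle_trans with (m2 * ((Rpower b (q - 1) - Rpower a (q - 1)) / (q - 1))).
- apply (norm_RInt_le f (fun s => m2 * Rpower s (q - 1 - 1)) a b); [lra| | |].
  + intros x Hx. apply Hm2. lra.
  + apply (@RInt_correct V), ex_RInt_pos; lra.
  + apply (is_RInt_scal (fun s => Rpower s (q - 1 - 1))), is_RInt_Rpower; lra.
- apply Rmult_le_compat_l; [easy|].
  replace ((Rpower b (q - 1) - Rpower a (q - 1)) / (q - 1))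
    with ((Rpower a (q - 1) - Rpower b (q - 1)) / (1 - q)) by (field; lra).
  apply Rmult_le_compat_r.
  + left; apply Rinv_0_lt_compat; lra.
  + pose proof (Rpower_pos b (q - 1)). lra.
Qed.

Let tail (a b : R) : R := m1 * (Rpower a q / q) + m2 * (Rpower b (q - 1) / (1 - q)).

Lemma mellin_truncation (a' a b b' : R) : 0 < a' -> a' <= a -> 0 < b -> b <= b' ->
  norm (minus (RInt f a' b') (RInt f a b)) <= tail a b.
Proof.
intros Ha' Ha Hb Hb'.
rewrite <- (RInt_Chasles f a' a b'), <- (RInt_Chasles f a b b') by (apply ex_RInt_pos; lra).
replace (minus (plus (RInt f a' a) (plus (RInt f a b) (RInt f b b'))) (RInt f a b))
  with (plus (RInt f a' a) (RInt f b b')) by vring.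
eapply Rle_trans; [apply norm_plus_le|]. apply Rplus_le_compat.
- apply mellin_near_zero; lra.
- apply mellin_near_infinity; lra.
Qed.

Lemma mellin_tail_small (eps : R) : 0 < eps ->
  exists a b, 0 < a /\ 0 < b /\ tail a b < eps.
Proof.
intros Heps.
destruct (Rpower_small q (eps / 2 / (Rabs m1 + 1) * q)) as [a [Ha Ha']]; [lra| |].
{ apply Rmult_lt_0_compat; [|lra]. apply Rdiv_lt_0_compat; [lra|].
  pose proof (Rabs_pos m1); lra. }
destruct (Rpower_small (1 - q) (eps / 2 / (Rabs m2 + 1) * (1 - q))) as [b [Hb Hb']]; [lra| |].
{ apply Rmult_lt_0_compat; [|lra]. apply Rdiv_lt_0_compat; [lra|].
  pose proof (Rabs_pos m2); lra. }
assert (HH : forall m y c, 0 < c -> 0 < y -> y < eps / 2 / (Rabs m + 1) * c ->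
  m * (y / c) < eps / 2).
{ intros m y c Hc Hy H. pose proof (Rabs_pos m).
  assert (H1 : y / c < eps / 2 / (Rabs m + 1)).
  { apply (Rmult_lt_reg_r c); [easy|]. unfold Rdiv at 1. rewrite Rmult_assoc, Rinv_l; lra. }
  assert (H2 : 0 < y / c) by now apply Rdiv_lt_0_compat.
  apply Rle_lt_trans with (Rabs m * (y / c)).
  - apply Rmult_le_compat_r; [lra|apply Rle_abs].
  - apply Rle_lt_trans with ((Rabs m + 1) * (y / c)); [nra|].
    apply (Rmult_lt_compat_l (Rabs m + 1)) in H1; [|lra].
    replace ((Rabs m + 1) * (eps / 2 / (Rabs m + 1))) with (eps / 2) in H1 by (field; lra).
    easy. }
exists a, (/ b). split; [lra|]. split; [apply Rinv_0_lt_compat; lra|].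
unfold tail. rewrite Rpower_inv_base by lra. replace (- (q - 1)) with (1 - q) by ring.
assert (m1 * (Rpower a q / q) < eps / 2).
{ apply HH; [lra|apply Rpower_pos|apply Ha'; lra]. }
assert (m2 * (Rpower b (1 - q) / (1 - q)) < eps / 2).
{ apply HH; [lra|apply Rpower_pos|apply Hb'; lra]. }
lra.
Qed.

Lemma ex_RInt_gen_mellin : ex_RInt_gen f (at_right 0) (Rbar_locally p_infty).
Proof.
apply (proj1 (@filterlimi_locally_cauchy (R * R) V _ _ (fun ab => is_RInt f (fst ab) (snd ab))
  (filter_imp _ _ (fun ab H => conj
     (ex_RInt_pos _ _ (proj1 (proj1 H)) (proj1 (proj2 H)))
     (fun y1 y2 H1 H2 => eq_trans (eq_sym (is_RInt_unique f _ _ y1 H1)) (is_RInt_unique f _ _ y2 H2)))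
     (mellin_domain 1 1 Rlt_0_1)))).
intros eps. destruct (mellin_tail_small (eps / 2)) as [a [b [Ha [Hb Ht]]]].
{ apply is_pos_div_2. }
exists (fun ab => (0 < fst ab /\ fst ab <= a) /\ (0 < snd ab /\ b <= snd ab)).
split; [now apply mellin_domain|].
intros u v [[Hu1 Hu2] [Hu3 Hu4]] [[Hv1 Hv2] [Hv3 Hv4]] u' v' Hu Hv.
apply is_RInt_unique in Hu. apply is_RInt_unique in Hv. subst u' v'.
apply (@norm_compat1 R_AbsRing V).
eapply Rle_lt_trans; [apply (norm_minus_triangle _ (RInt f a b))|].
rewrite (norm_minus_sym (RInt f a b)).
pose proof (mellin_truncation (fst u) a b (snd u) Hu1 Hu2 Hb Hu4).
pose proof (mellin_truncation (fst v) a b (snd v) Hv1 Hv2 Hb Hv4).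
lra.
Qed.

Lemma RInt_gen_mellin_correct :
  is_RInt_gen f (at_right 0) (Rbar_locally p_infty)
    (RInt_gen f (at_right 0) (Rbar_locally p_infty)).
Proof. apply RInt_gen_correct, ex_RInt_gen_mellin. Qed.

(** Passing to the limit in [mellin_truncation].  The bound is quantitative because the
    truncation will depend on an outer integration variable. *)
Lemma RInt_gen_mellin_truncation (a b : R) : 0 < a -> 0 < b ->
  norm (minus (RInt_gen f (at_right 0) (Rbar_locally p_infty)) (RInt f a b)) <= tail a b.
Proof.
intros Ha Hb. set (I := RInt_gen _ _ _).
apply le_epsilon. intros eps Heps.
set (nf := @norm_factor R_AbsRing V).
assert (Hnf : 0 < nf) by apply norm_factor_gt_0.
assert (Hd : 0 < eps / nf) by now apply Rdiv_lt_0_compat.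
generalize (filter_and _ _ (mellin_domain a b Ha)
  (RInt_gen_mellin_correct _ (locally_ball I (mkposreal _ Hd)))).
intros H. apply filter_ex in H. destruct H as [[a' b'] [[[H1 H2] [H3 H4]] [z [Hz Hball]]]].
simpl in *. apply is_RInt_unique in Hz. subst z.
apply (@norm_compat2 R_AbsRing V I (RInt f a' b') (mkposreal _ Hd)) in Hball.
simpl in Hball. fold nf in Hball.
replace (nf * (eps / nf)) with eps in Hball by (field; lra).
eapply Rle_trans; [apply (norm_minus_triangle _ (RInt f a' b'))|].
rewrite (norm_minus_sym I).
pose proof (mellin_truncation a' a b b' H1 H2 Hb H4).
apply Rlt_le in Hball. rewrite Rplus_comm. now apply Rplus_le_compat.
Qed.

(** The bound splits the half-line at a point [b] of choice: the case of an empty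
    truncation interval. *)
Lemma RInt_gen_mellin_bound (b : R) : 0 < b ->
  norm (RInt_gen f (at_right 0) (Rbar_locally p_infty)) <= tail b b.
Proof.
intros Hb. eapply Rle_trans; [|now apply RInt_gen_mellin_truncation].
right. f_equal. rewrite (is_RInt_unique f b b zero (@is_RInt_point V f b)). vring.
Qed.

End Mellin.

(** * Fractional powers *)

(** The upper bound [p] is what makes constants uniform as [p] tends to zero, as the
    logarithmic case requires. *)
Lemma sin_coef_bounds (p : R) : 0 < p < 1 -> 0 < sin (PI * p) / PI <= p.
Proof.
intros Hp. assert (HPI := PI_RGT_0). split.
- apply Rdiv_lt_0_compat; [|easy]. apply sin_gt_0; nra.
- apply (Rmult_le_reg_r PI); [easy|]. unfold Rdiv. rewrite Rmult_assoc, Rinv_l by lra.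
  assert (sin (PI * p) < PI * p) by (apply sin_lt_x; nra). lra.
Qed.

Lemma floor_decomposition (a : R) : 0 <= a ->
  a = INR (Z.to_nat (Int_part a)) + frac_part a /\ 0 <= frac_part a < 1.
Proof.
intros Ha. destruct (base_fp a) as [H1 H2]. split; [|lra].
assert (0 <= Int_part a)%Z.
{ destruct (base_Int_part a) as [H3 H4].
  assert (-1 < Int_part a)%Z by (apply lt_IZR; lra). lia. }
rewrite INR_IZR_INZ, Z2Nat.id by easy. apply Rplus_Int_part_frac_part.
Qed.

Lemma iter_linear {X : Banach} (T : X -> X) (n : nat) : is_linear T -> is_linear (Nat.iter n T).
Proof.
intros HT. induction n as [|n IH]; simpl.
- apply is_linear_id.
- exact (is_linear_comp _ T IH HT).
Qed.

Lemma iter_comm {X : Type} (S T : X -> X) (n : nat) (x : X) :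
  (forall y, S (T y) = T (S y)) -> Nat.iter n S (T x) = T (Nat.iter n S x).
Proof. intros H. induction n as [|n IH]; simpl; [easy|]. now rewrite IH, H. Qed.

Lemma frac_pow_between_0_1 {X : Banach} (G : X -> X) (p : R) (u : X) : 0 < p < 1 -> frac_pow G p u = frac_pow01 G p u.
Proof.
intros Hp. destruct (Int_part_frac_part_spec p 0 p) as [H1 H2]; [lra|simpl; lra|].
unfold frac_pow. rewrite <- H1, <- H2. simpl.
destruct (Req_EM_T p 0); [lra|easy].
Qed.

Lemma frac_pow_1 {X : Banach} (G : X -> X) (u : X) : frac_pow G 1 u = G u.
Proof.
destruct (Int_part_frac_part_spec 1 1 0) as [H1 H2]; [lra|simpl; lra|].
unfold frac_pow. rewrite <- H1, <- H2.
destruct (Req_EM_T 0 0); [reflexivity|lra].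
Qed.

Section FractionalPowers.

Context {X : Banach} (G : X -> X) (kappa : R).
Context (HG : is_linear G) (Hkappa : 0 < kappa).
Context (Hres : nonneg_type_with G kappa).

Local Notation R_ := (resolvent G).

(** The integrand of Balakrishnan's formula for [G^p u]. *)
Definition balakrishnan (p : R) (u : X) (s : R) : X :=
  scal (Rpower s (p - 1)) (R_ s (G u)).

Lemma frac_pow01_balakrishnan (p : R) (u : X) :
  frac_pow01 G p u =
  scal (sin (PI * p) / PI)
    (RInt_gen (balakrishnan p u) (at_right 0) (Rbar_locally p_infty)).
Proof. reflexivity. Qed.

Lemma balakrishnan_continuous (p : R) (u : X) (s : R) : 0 < s ->
  continuous (balakrishnan p u) s.
Proof.
intros Hs. unfold balakrishnan.
apply (@continuous_scal R_UniformSpace R_AbsRing X (fun s => Rpower s (p - 1))).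
- now apply continuous_Rpower.
- now apply (resolvent_continuous G kappa).
Qed.

Lemma balakrishnan_bound1 (p : R) (u : X) (m1 : R) :
  (forall s, 0 < s -> norm (high G s u) <= m1) ->
  forall s, 0 < s -> norm (balakrishnan p u s) <= m1 * Rpower s (p - 1).
Proof.
intros Hm s Hs. unfold balakrishnan.
eapply Rle_trans; [apply norm_scal_pos_le; left; apply Rpower_pos|].
rewrite Rmult_comm. apply Rmult_le_compat_r; [left; apply Rpower_pos|].
rewrite (resolvent_comm_G G kappa HG Hres) by easy. now apply Hm.
Qed.

Lemma balakrishnan_bound2 (p : R) (u : X) (m2 : R) :
  (forall s, 0 < s -> norm (high G s u) <= m2 / s) ->
  forall s, 0 < s -> norm (balakrishnan p u s) <= m2 * Rpower s (p - 1 - 1).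
Proof.
intros Hm s Hs. unfold balakrishnan.
eapply Rle_trans; [apply norm_scal_pos_le; left; apply Rpower_pos|].
rewrite (resolvent_comm_G G kappa HG Hres) by easy.
apply Rle_trans with (Rpower s (p - 1) * (m2 / s)).
- apply Rmult_le_compat_l; [left; apply Rpower_pos|]. now apply Hm.
- right. unfold Rminus at 2. rewrite Rpower_plus, Rpower_Ropp, Rpower_1 by easy. field. lra.
Qed.

Lemma high_bound_inv (s : R) (u : X) : 0 < s -> norm (high G s u) <= kappa * norm (G u) / s.
Proof.
intros Hs. unfold high. rewrite <- (resolvent_comm_G G kappa HG Hres) by easy.
eapply Rle_trans; [now apply (resolvent_bound G kappa)|]. right; field; lra.
Qed.

Lemma balakrishnan_correct (p : R) (u : X) : 0 < p < 1 ->
  is_RInt_gen (balakrishnan p u) (at_right 0) (Rbar_locally p_infty)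
    (RInt_gen (balakrishnan p u) (at_right 0) (Rbar_locally p_infty)).
Proof.
intros Hp. apply (RInt_gen_mellin_correct _ p ((1 + kappa) * norm u) (kappa * norm (G u))).
- easy.
- intros s Hs. now apply balakrishnan_continuous.
- apply balakrishnan_bound1. intros s Hs. now apply (high_bound G kappa).
- apply balakrishnan_bound2. intros s Hs. now apply high_bound_inv.
Qed.

(** The splitting point [beta] is free; it will be the parameter of [low beta]. *)
Lemma frac_pow01_bound (p beta m1 m2 : R) (u : X) : 0 < p < 1 -> 0 < beta ->
  (forall s, 0 < s -> norm (high G s u) <= m1) ->
  (forall s, 0 < s -> norm (high G s u) <= m2 / s) ->
  norm (frac_pow01 G p u) <=
  m1 * Rpower beta p + m2 * (p / (1 - p) * Rpower beta (p - 1)).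
Proof.
intros Hp Hb H1 H2. rewrite frac_pow01_balakrishnan.
destruct (sin_coef_bounds p Hp) as [Hs0 Hs1].
assert (Hm1 : 0 <= m1) by (eapply Rle_trans; [apply (norm_nonneg (high G 1 u))|apply (H1 1); lra]).
assert (Hm2 : 0 <= m2).
{ pose proof (H2 1 Rlt_0_1). pose proof (norm_nonneg (high G 1 u)). lra. }
eapply Rle_trans; [apply norm_scal_pos_le; lra|].
assert (HI : norm (RInt_gen (balakrishnan p u) (at_right 0) (Rbar_locally p_infty)) <=
   m1 * (Rpower beta p / p) + m2 * (Rpower beta (p - 1) / (1 - p))).
{ apply RInt_gen_mellin_bound; try easy.
  - intros s Hs. now apply balakrishnan_continuous.
  - now apply balakrishnan_bound1.
  - now apply balakrishnan_bound2. }
eapply Rle_trans.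
{ apply Rmult_le_compat; [lra|apply norm_nonneg|exact Hs1|exact HI]. }
right. field. lra.
Qed.

Lemma frac_pow01_linear (p : R) : 0 < p < 1 -> is_linear (frac_pow01 G p).
Proof.
intros Hp. destruct (linear_norm G HG) as [M [HM HGM]]. split.
- intros x y. rewrite !frac_pow01_balakrishnan.
  rewrite (is_RInt_gen_unique (balakrishnan p (plus x y))
    (plus (RInt_gen (balakrishnan p x) (at_right 0) (Rbar_locally p_infty))
          (RInt_gen (balakrishnan p y) (at_right 0) (Rbar_locally p_infty)))); [vring|].
  eapply (@is_RInt_gen_ext X (at_right 0) (Rbar_locally p_infty) _ _);
    [|apply (@is_RInt_gen_plus X (at_right 0) (Rbar_locally p_infty) _ _); apply balakrishnan_correct; easy].
  generalize (mellin_domain 1 1 Rlt_0_1). apply filter_imp.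
  intros ab [[Ha _] [Hb _]] s [Hs _].
  pose proof (Rmin_glb_lt _ _ 0 Ha Hb). assert (Hs0 : 0 < s) by lra.
  unfold balakrishnan.
  rewrite (linear_plus G HG), (linear_plus _ (resolvent_linear G kappa HG Hkappa Hres s Hs0)).
  vring.
- intros k x. rewrite !frac_pow01_balakrishnan.
  rewrite (is_RInt_gen_unique (balakrishnan p (scal k x))
    (scal k (RInt_gen (balakrishnan p x) (at_right 0) (Rbar_locally p_infty)))); [vring|].
  eapply (@is_RInt_gen_ext X (at_right 0) (Rbar_locally p_infty) _ _);
    [|apply (@is_RInt_gen_scal X (at_right 0) (Rbar_locally p_infty) _ _); apply balakrishnan_correct; easy].
  generalize (mellin_domain 1 1 Rlt_0_1). apply filter_imp.
  intros ab [[Ha _] [Hb _]] s [Hs _].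
  pose proof (Rmin_glb_lt _ _ 0 Ha Hb). assert (Hs0 : 0 < s) by lra.
  unfold balakrishnan.
  rewrite (linear_scal G HG), (linear_scal _ (resolvent_linear G kappa HG Hkappa Hres s Hs0)).
  vring.
- exists ((1 + kappa) * Rpower 1 p + kappa * M * (p / (1 - p) * Rpower 1 (p - 1))).
  pose proof (Rpower_pos 1 p). pose proof (Rpower_pos 1 (p - 1)).
  assert (0 < p / (1 - p)) by (apply Rdiv_lt_0_compat; lra).
  split.
  { generalize dependent (p / (1 - p)). intros t Ht.
    apply Rplus_lt_0_compat; repeat apply Rmult_lt_0_compat; lra. }
  intros x. eapply Rle_trans; [apply (frac_pow01_bound p 1 ((1 + kappa) * norm x) (kappa * M * norm x))|].
  + easy.
  + lra.
  + intros s Hs. now apply (high_bound G kappa).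
  + intros s Hs. eapply Rle_trans; [now apply high_bound_inv|].
    apply Rmult_le_compat_r; [left; now apply Rinv_0_lt_compat|].
    rewrite Rmult_assoc. apply Rmult_le_compat_l; [lra|apply HGM].
  + right. ring.
Qed.

(** A bounded operator passes through the integral and, commuting with [G], through
    every resolvent under it. *)
Lemma frac_pow01_comm (T : X -> X) (p : R) (u : X) : 0 < p < 1 -> is_linear T ->
  (forall y, T (G y) = G (T y)) ->
  T (frac_pow01 G p u) = frac_pow01 G p (T u).
Proof.
intros Hp HT Hc. rewrite !frac_pow01_balakrishnan, (linear_scal T HT). f_equal.
symmetry. apply is_RInt_gen_unique.
eapply (@is_RInt_gen_ext X (at_right 0) (Rbar_locally p_infty) _ _);
  [|apply (is_RInt_gen_linear T HT); try typeclasses eauto; now apply balakrishnan_correct].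
generalize (mellin_domain 1 1 Rlt_0_1). apply filter_imp.
intros ab [[Ha _] [Hb _]] s [Hs _].
pose proof (Rmin_glb_lt _ _ 0 Ha Hb). assert (Hs0 : 0 < s) by lra.
unfold balakrishnan.
rewrite (linear_scal T HT), <- Hc.
now rewrite (resolvent_comm_op G kappa Hres T).
Qed.

(** Below [beta] the factor [high s] is merely bounded, which leaves [|low beta u|]
    in front; above [beta] it gains [beta / s].  The second term carries a factor [p],
    which the logarithmic case exploits. *)
Lemma frac_pow01_low_bound (p beta : R) (u : X) : 0 < p < 1 -> 0 < beta ->
  norm (frac_pow01 G p (low G beta u)) <=
  (1 + kappa) * (norm (low G beta u) + kappa * (p / (1 - p)) * norm u) * Rpower beta p.
Proof.
intros Hp Hb.
eapply Rle_trans;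
  [apply (frac_pow01_bound p beta ((1 + kappa) * norm (low G beta u))
            (kappa * (beta * ((1 + kappa) * norm u))))|].
- easy.
- easy.
- intros s Hs. now apply (high_bound G kappa).
- intros s Hs. eapply Rle_trans; [now apply high_bound_inv|].
  apply Rmult_le_compat_r; [left; now apply Rinv_0_lt_compat|].
  apply Rmult_le_compat_l; [lra|]. rewrite (G_low G HG).
  eapply Rle_trans; [apply norm_scal_pos_le; lra|].
  apply Rmult_le_compat_l; [lra|]. now apply (high_bound G kappa).
- right. unfold Rminus at 2. rewrite Rpower_plus, Rpower_Ropp, Rpower_1 by easy.
  field. lra.
Qed.

Lemma low_frac_pow01_bound (p : R) : 0 < p < 1 ->
  exists C, 0 < C /\ forall beta u, 0 < beta ->
    norm (low G beta (frac_pow01 G p u)) <= C * Rpower beta p * norm u.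
Proof.
intros Hp. assert (Hpp : 0 < p / (1 - p)) by (apply Rdiv_lt_0_compat; lra).
exists ((1 + kappa) * (kappa + kappa * (p / (1 - p)))). split.
- apply Rmult_lt_0_compat; [lra|]. apply Rplus_lt_0_compat; [lra|].
  now apply Rmult_lt_0_compat.
- intros beta u Hb. rewrite frac_pow01_comm; try easy.
  + eapply Rle_trans; [now apply frac_pow01_low_bound|].
    pose proof (Rpower_pos beta p). pose proof (low_bound G kappa Hres beta u Hb).
    apply Rle_trans with ((1 + kappa) * (kappa * norm u + kappa * (p / (1 - p)) * norm u) * Rpower beta p).
    * apply Rmult_le_compat_r; [lra|]. apply Rmult_le_compat_l; lra.
    * right. ring.
  + now apply (low_linear G kappa).
  + intros y. now apply (low_comm_G G kappa).
Qed.

Lemma low_frac_pow_bound (p : R) : 0 < p <= 1 ->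
  exists C, 0 < C /\ forall beta u, 0 < beta ->
    norm (low G beta (frac_pow G p u)) <= C * Rpower beta p * norm u.
Proof.
intros Hp. destruct (Rle_lt_or_eq_dec p 1 (proj2 Hp)) as [H|H].
- destruct (low_frac_pow01_bound p) as [C [HC HC']]; [lra|].
  exists C. split; [easy|]. intros beta u Hb. rewrite frac_pow_between_0_1 by lra. now apply HC'.
- subst p. exists (1 + kappa). split; [lra|]. intros beta u Hb.
  rewrite frac_pow_1, (low_comm_G G kappa), (G_low G HG), Rpower_1 by easy.
  eapply Rle_trans; [apply norm_scal_pos_le; lra|].
  pose proof (high_bound G kappa Hres beta u Hb). nra.
Qed.

(** With [p = K / log (1/beta)], the term [low beta (G^p u)] is at most half of
    [|low beta u|] plus [O(p)] and can be absorbed, while [low beta (u - G^p u)] is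
    [O(p)] since the difference quotients of [p |-> G^p u] at zero converge. *)
Lemma low_dom_log_bound (u : X) : in_dom_log G u ->
  exists C b0, 0 < C /\ 0 < b0 < 1 /\ forall beta, 0 < beta < b0 ->
    norm (low G beta u) <= C / ln (/ beta).
Proof.
intros [l Hl].
assert (Hdiff : exists L p0, 0 < L /\ 0 < p0 <= / 2 /\ forall p, 0 < p < p0 ->
   norm (minus (frac_pow G p u) u) <= L * p).
{ pose proof (proj1 (@filterlim_locally_ball_norm R_AbsRing R X _ _ _ l) Hl (mkposreal 1 Rlt_0_1)) as [d Hd].
  exists (norm l + 1), (Rmin d (/ 2)).
  assert (Hd0 := cond_pos d). pose proof (norm_nonneg l). split; [lra|].
  split; [split; [apply Rmin_pos; lra|apply Rmin_r]|].
  intros p Hp. pose proof (Rmin_l d (/ 2)).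
  assert (Hn : norm (minus (scal (/ p) (minus (frac_pow G p u) u)) l) < 1).
  { apply Hd; [|lra]. change (Rabs (p - 0) < d). rewrite Rminus_0_r, Rabs_pos_eq; lra. }
  replace (minus (frac_pow G p u) u)
    with (scal p (plus (minus (scal (/ p) (minus (frac_pow G p u) u)) l) l))
    by (vfield; lra).
  eapply Rle_trans; [apply norm_scal_pos_le; lra|]. rewrite Rmult_comm.
  apply Rmult_le_compat_r; [lra|].
  eapply Rle_trans; [apply norm_plus_le|]. rewrite Rplus_comm.
  apply Rplus_le_compat_l. now left. }
destruct Hdiff as [L [p0 [HL [Hp0 HLp]]]].
(* chosen so that the factor in front of the low part of u becomes 1/2 *)
set (K := ln (2 * (1 + kappa))).
assert (HK : 0 < K) by (rewrite <- ln_1; apply ln_increasing; lra).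
set (c := 2 * kappa * norm u + 2 * kappa * L + 1).
assert (Hnu := norm_nonneg u).
assert (Hc : 0 < c).
{ unfold c. assert (0 <= kappa * norm u) by (apply Rmult_le_pos; lra).
  assert (0 < kappa * L) by (apply Rmult_lt_0_compat; lra). lra. }
exists (c * K), (exp (- (K / p0))). split; [now apply Rmult_lt_0_compat|].
assert (HKp : 0 < K / p0) by (apply Rdiv_lt_0_compat; lra).
split.
{ split; [apply exp_pos|]. rewrite <- exp_0. apply exp_increasing. lra. }
intros beta [Hb Hb'].
assert (Hlnb : ln beta < - (K / p0)).
{ rewrite <- (ln_exp (- (K / p0))). now apply ln_increasing. }
rewrite ln_Rinv by easy.
set (lam := - ln beta) in *. assert (Hlam : K / p0 < lam) by (unfold lam; lra).
(* with this p the factor beta ^ p equals exp (-K) = 1 / (2 (1 + kappa)) *)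
set (p := K / lam).
assert (Hp : 0 < p < p0).
{ split; [apply Rdiv_lt_0_compat; lra|]. unfold p.
  apply (Rmult_lt_reg_r lam); [lra|]. unfold Rdiv. rewrite Rmult_assoc, Rinv_l by lra.
  apply (Rmult_lt_compat_l p0) in Hlam; [|lra].
  replace (p0 * (K / p0)) with K in Hlam by (field; lra). lra. }
assert (Hbp : (1 + kappa) * Rpower beta p = / 2).
{ unfold Rpower. replace (p * ln beta) with (- K) by (unfold p, lam; field; unfold lam in *; lra).
  rewrite exp_Ropp. unfold K. rewrite exp_ln by lra. field. lra. }
assert (H1 : norm (low G beta (frac_pow G p u)) <= / 2 * (norm (low G beta u) + kappa * (2 * p) * norm u)).
{ rewrite frac_pow_between_0_1, frac_pow01_comm; try lra.
  - eapply Rle_trans; [apply frac_pow01_low_bound; lra|].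
    replace ((1 + kappa) * (norm (low G beta u) + kappa * (p / (1 - p)) * norm u) * Rpower beta p)
      with (((1 + kappa) * Rpower beta p) * (norm (low G beta u) + kappa * (p / (1 - p)) * norm u)) by ring.
    rewrite Hbp. apply Rmult_le_compat_l; [lra|]. apply Rplus_le_compat_l.
    apply Rmult_le_compat_r; [easy|]. apply Rmult_le_compat_l; [lra|].
    unfold Rdiv. rewrite (Rmult_comm 2). apply Rmult_le_compat_l; [lra|].
    rewrite <- (Rinv_inv 2). apply Rinv_le_contravar; lra.
  - now apply (low_linear G kappa).
  - intros y. now apply (low_comm_G G kappa). }
assert (H2 : norm (minus (low G beta (frac_pow G p u)) (low G beta u)) <= kappa * (L * p)).
{ replace (minus (low G beta (frac_pow G p u)) (low G beta u))
    with (low G beta (minus (frac_pow G p u) u))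
    by exact (linear_minus _ _ _ (low_linear G kappa HG Hkappa Hres beta Hb)).
  eapply Rle_trans; [now apply (low_bound G kappa)|]. apply Rmult_le_compat_l; [lra|].
  now apply HLp. }
assert (H3 := norm_le_norm_minus (low G beta u) (low G beta (frac_pow G p u))).
apply Rle_trans with (c * p); [|right; unfold p; field; lra].
apply Rle_trans with ((2 * kappa * norm u + 2 * kappa * L) * p); [lra|].
apply Rmult_le_compat_r; unfold c; lra.
Qed.

Lemma iter_low_bound (n : nat) (beta : R) (x : X) : 0 < beta ->
  norm (Nat.iter n (low G beta) x) <= kappa ^ n * norm x.
Proof.
intros Hb. induction n as [|n IH]; simpl; [lra|].
eapply Rle_trans; [now apply (low_bound G kappa)|]. rewrite Rmult_assoc.
apply Rmult_le_compat_l; lra.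
Qed.

Lemma iter_high_bound (n : nat) (beta : R) (x : X) : 0 < beta ->
  norm (Nat.iter n (high G beta) x) <= (1 + kappa) ^ n * norm x.
Proof.
intros Hb. induction n as [|n IH]; simpl; [lra|].
eapply Rle_trans; [now apply (high_bound G kappa)|]. rewrite Rmult_assoc.
apply Rmult_le_compat_l; lra.
Qed.

Lemma frac_pow_linear (a : R) : 0 <= a -> is_linear (frac_pow G a).
Proof.
intros Ha. destruct (floor_decomposition a Ha) as [_ Hf]. unfold frac_pow.
assert (Hit := iter_linear G (Z.to_nat (Int_part a)) HG).
destruct (Req_EM_T (frac_part a) 0) as [H|H]; [exact Hit|].
apply (is_linear_comp _ (frac_pow01 G (frac_part a)) Hit).
apply frac_pow01_linear. lra.
Qed.

(** Each integer power of [G] is paid for by one factor [low beta], and the fractional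
    part of [a] by the last one. *)
Lemma frac_pow_iter_low_bound (a : R) : 0 <= a ->
  exists C, 0 < C /\ forall beta x, 0 < beta ->
    norm (frac_pow G a (Nat.iter (S (Z.to_nat (Int_part a))) (low G beta) x))
    <= C * Rpower beta a * norm x.
Proof.
intros Ha. destruct (floor_decomposition a Ha) as [Hdec Hf].
set (n := Z.to_nat (Int_part a)) in *. set (q := frac_part a) in *.
assert (Hn : forall beta x, 0 < beta ->
  norm (Nat.iter n G (Nat.iter n (low G beta) x)) <= (beta * (1 + kappa)) ^ n * norm x).
{ intros beta x Hb. clear - HG Hkappa Hres Hb. induction n as [|n IH]; simpl; [lra|].
  rewrite (iter_comm G (low G beta)) by (intros y; symmetry; now apply (low_comm_G G kappa)).
  rewrite (G_low G HG).
  eapply Rle_trans; [apply norm_scal_pos_le; lra|]. rewrite !Rmult_assoc.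
  apply Rmult_le_compat_l; [lra|].
  eapply Rle_trans; [now apply (high_bound G kappa)|].
  apply Rmult_le_compat_l; lra. }
assert (Hv : forall beta x, 0 < beta ->
  Nat.iter n G (Nat.iter (S n) (low G beta) x)
  = low G beta (Nat.iter n G (Nat.iter n (low G beta) x))).
{ intros beta x Hb. simpl. apply iter_comm. intros y. symmetry. now apply (low_comm_G G kappa). }
assert (Hpow : forall beta, 0 < beta ->
  (beta * (1 + kappa)) ^ n * Rpower beta q = (1 + kappa) ^ n * Rpower beta a).
{ intros beta Hb. rewrite Hdec, Rpower_plus, Rpower_pow, Rpow_mult_distr by easy. ring. }
assert (Hk : 0 < (1 + kappa) ^ n) by (apply pow_lt; lra).
unfold frac_pow. fold n q. destruct (Req_EM_T q 0) as [Hq|Hq].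
- exists (kappa * (1 + kappa) ^ n). split; [now apply Rmult_lt_0_compat|].
  intros beta x Hb. rewrite Hv by easy.
  eapply Rle_trans; [now apply (low_bound G kappa)|].
  specialize (Hn beta x Hb). specialize (Hpow beta Hb).
  rewrite Hq, Rpower_O, Rmult_1_r in Hpow by easy. rewrite Hpow in Hn.
  rewrite !Rmult_assoc in *. apply Rmult_le_compat_l; [lra|easy].
- destruct (low_frac_pow01_bound q) as [C [HC HC']]; [lra|].
  exists (C * (1 + kappa) ^ n). split; [now apply Rmult_lt_0_compat|].
  intros beta x Hb. rewrite Hv by easy.
  rewrite <- frac_pow01_comm.
  + eapply Rle_trans; [now apply HC'|].
    specialize (Hn beta x Hb). specialize (Hpow beta Hb).
    rewrite (Rmult_assoc C ((1 + kappa) ^ n)), <- Hpow.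
    apply Rle_trans with (C * Rpower beta q * ((beta * (1 + kappa)) ^ n * norm x)).
    * apply Rmult_le_compat_l; [|easy]. left; apply Rmult_lt_0_compat; [easy|apply Rpower_pos].
    * right; ring.
  + lra.
  + now apply (low_linear G kappa).
  + intros y. now apply (low_comm_G G kappa).
Qed.

End FractionalPowers.

(** * Exchange of integrals over a rectangle *)

Section Fubini.

Context {X : Banach} (w : R -> R) (k : R -> R -> X) (a0 c0 c d L W : R).
Context (Hc0 : c0 < c) (Hcd : c <= d) (HL : 0 <= L) (HW : 0 <= W).
Context (Hw : forall sigma, c0 < sigma -> continuous w sigma).
Context (HwW : forall sigma, c <= sigma <= d -> Rabs (w sigma) <= W).
Context (Hk1 : forall t t' sigma, a0 < t -> a0 < t' -> c0 < sigma ->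
  norm (minus (k t sigma) (k t' sigma)) <= L * Rabs (t - t')).
Context (Hk2 : forall t sigma sigma', a0 < t -> c0 < sigma -> c0 < sigma' ->
  norm (minus (k t sigma) (k t sigma')) <= L * Rabs (sigma - sigma')).

Let inner (t1 t2 sigma : R) : X := RInt (fun t => k t sigma) t1 t2.
Let outer (t : R) : X := RInt (fun sigma => scal (w sigma) (k t sigma)) c d.

Lemma kernel_ex_RInt_left (t1 t2 sigma : R) : a0 < t1 -> a0 < t2 -> c0 < sigma ->
  ex_RInt (fun t => k t sigma) t1 t2.
Proof.
intros H1 H2 Hs. apply (@ex_RInt_continuous X). intros t [Ht _].
pose proof (Rmin_glb_lt t1 t2 a0 H1 H2).
apply (locally_lipschitz_continuous _ t (t - a0) L); [lra|].
intros t' Ht'. apply Hk1; try lra.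
unfold Rabs in Ht'; destruct Rcase_abs in Ht'; lra.
Qed.

Lemma inner_continuous (t1 t2 sigma : R) : a0 < t1 -> t1 <= t2 -> c0 < sigma ->
  continuous (inner t1 t2) sigma.
Proof.
intros H1 H2 Hs.
apply (locally_lipschitz_continuous _ sigma (sigma - c0) ((t2 - t1) * L)); [lra|].
intros s' Hs'.
assert (c0 < s') by (unfold Rabs in Hs'; destruct Rcase_abs in Hs'; lra).
unfold inner. rewrite <- RInt_minus by (apply kernel_ex_RInt_left; lra).
rewrite Rmult_assoc.
apply (norm_RInt_le_const (fun t => minus (k t s') (k t sigma))); [lra| |].
- intros t Ht. apply Hk2; lra.
- apply (@RInt_correct X), (@ex_RInt_minus X); apply kernel_ex_RInt_left; lra.
Qed.

Lemma inner_ex_RInt (t1 t2 : R) : a0 < t1 -> t1 <= t2 ->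
  ex_RInt (fun sigma => scal (w sigma) (inner t1 t2 sigma)) c d.
Proof.
intros H1 H2. apply (@ex_RInt_continuous X). intros s Hs.
rewrite Rmin_left, Rmax_right in Hs by lra.
apply (@continuous_scal R_UniformSpace R_AbsRing X w).
- apply Hw; lra.
- apply inner_continuous; lra.
Qed.

Lemma kernel_ex_RInt_right (t : R) : a0 < t ->
  ex_RInt (fun sigma => scal (w sigma) (k t sigma)) c d.
Proof.
intros Ht. apply (@ex_RInt_continuous X). intros s Hs.
rewrite Rmin_left, Rmax_right in Hs by lra.
apply (@continuous_scal R_UniformSpace R_AbsRing X w).
- apply Hw; lra.
- apply (locally_lipschitz_continuous _ s (s - c0) L); [lra|].
  intros s' Hs'. apply Hk2; try lra.
  unfold Rabs in Hs'; destruct Rcase_abs in Hs'; lra.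
Qed.

Lemma outer_lipschitz (t t' : R) : a0 < t -> a0 < t' ->
  norm (minus (outer t) (outer t')) <= (d - c) * (W * L) * Rabs (t - t').
Proof.
intros Ht Ht'. unfold outer.
rewrite <- RInt_minus by (apply kernel_ex_RInt_right; lra).
rewrite Rmult_assoc.
apply (norm_RInt_le_const (fun s => minus (scal (w s) (k t s)) (scal (w s) (k t' s)))); [lra| |].
- intros s Hs.
  replace (minus (scal (w s) (k t s)) (scal (w s) (k t' s)))
    with (scal (w s) (minus (k t s) (k t' s))) by vring.
  eapply Rle_trans; [apply norm_scal_le|]. rewrite (Rmult_assoc W).
  apply Rmult_le_compat; [apply Rabs_pos|apply norm_nonneg|now apply HwW|].
  apply Hk1; lra.
- apply (@RInt_correct X), (@ex_RInt_minus X); apply kernel_ex_RInt_right; lra.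
Qed.

Lemma outer_ex_RInt (t1 t2 : R) : a0 < t1 -> a0 < t2 -> ex_RInt outer t1 t2.
Proof.
intros H1 H2. apply (@ex_RInt_continuous X). intros t [Ht _].
pose proof (Rmin_glb_lt t1 t2 a0 H1 H2).
apply (locally_lipschitz_continuous _ t (t - a0) ((d - c) * (W * L))); [lra|].
intros t' Ht'. apply outer_lipschitz; try lra.
unfold Rabs in Ht'; destruct Rcase_abs in Ht'; lra.
Qed.

Let defect (t1 t2 : R) : X :=
  minus (RInt outer t1 t2) (RInt (fun sigma => scal (w sigma) (inner t1 t2 sigma)) c d).

(** On a short interval both iterated integrals agree with their common value for a
    kernel frozen at [t1], up to the square of the length. *)
Lemma defect_quadratic (t1 t2 : R) : a0 < t1 -> t1 <= t2 ->
  norm (defect t1 t2) <= 2 * ((d - c) * (W * L)) * (t2 - t1) ^ 2.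
Proof.
intros H1 H2. unfold defect.
(* compare both with (t2 - t1) times the outer integrand at t1 *)
set (C := (d - c) * (W * L)).
assert (HC : 0 <= C) by (unfold C; repeat apply Rmult_le_pos; lra).
eapply Rle_trans; [apply (norm_minus_triangle _ (scal (t2 - t1) (outer t1)))|].
replace (2 * C * (t2 - t1) ^ 2) with
  ((t2 - t1) * (C * (t2 - t1)) + (d - c) * (W * ((t2 - t1) * (L * (t2 - t1))))) by (unfold C; ring).
apply Rplus_le_compat.
- rewrite <- (RInt_const t1 t2 (outer t1)).
  rewrite <- RInt_minus; [|apply outer_ex_RInt; lra|apply ex_RInt_const].
  apply (norm_RInt_le_const (fun t => minus (outer t) (outer t1))); [lra| |].
  + intros t Ht. eapply Rle_trans; [apply outer_lipschitz; lra|].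
    fold C. apply Rmult_le_compat_l; [easy|]. rewrite Rabs_pos_eq; lra.
  + apply (@RInt_correct X), (@ex_RInt_minus X); [apply outer_ex_RInt; lra|apply ex_RInt_const].
- unfold outer. rewrite <- RInt_scal by (apply kernel_ex_RInt_right; lra).
  rewrite <- RInt_minus;
    [|apply (@ex_RInt_scal X), kernel_ex_RInt_right; lra|apply inner_ex_RInt; lra].
  apply (norm_RInt_le_const (fun s => minus (scal (t2 - t1) (scal (w s) (k t1 s)))
                                            (scal (w s) (inner t1 t2 s)))); [lra| |].
  + intros s Hs.
    replace (minus (scal (t2 - t1) (scal (w s) (k t1 s))) (scal (w s) (inner t1 t2 s)))
      with (scal (- w s) (minus (inner t1 t2 s) (scal (t2 - t1) (k t1 s)))) by vring.
    eapply Rle_trans; [apply norm_scal_le|]. rewrite Rabs_Ropp.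
    apply Rmult_le_compat; [apply Rabs_pos|apply norm_nonneg|now apply HwW|].
    unfold inner. rewrite <- (RInt_const t1 t2 (k t1 s)).
    rewrite <- RInt_minus; [|apply kernel_ex_RInt_left; lra|apply ex_RInt_const].
    apply (norm_RInt_le_const (fun t => minus (k t s) (k t1 s))); [lra| |].
    * intros t Ht. eapply Rle_trans; [apply Hk1; lra|].
      apply Rmult_le_compat_l; [easy|]. rewrite Rabs_pos_eq; lra.
    * apply (@RInt_correct X), (@ex_RInt_minus X); [apply kernel_ex_RInt_left; lra|apply ex_RInt_const].
  + apply (@RInt_correct X), (@ex_RInt_minus X);
      [apply (@ex_RInt_scal X), kernel_ex_RInt_right; lra|apply inner_ex_RInt; lra].
Qed.

Lemma defect_additive (t1 t2 t3 : R) : a0 < t1 -> t1 <= t2 -> t2 <= t3 ->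
  defect t1 t3 = plus (defect t1 t2) (defect t2 t3).
Proof.
intros H1 H2 H3. unfold defect.
rewrite <- (RInt_Chasles outer t1 t2 t3) by (apply outer_ex_RInt; lra).
rewrite (RInt_ext (fun s => scal (w s) (inner t1 t3 s)) (fun s => plus (scal (w s) (inner t1 t2 s)) (scal (w s) (inner t2 t3 s)))).
- rewrite (@RInt_plus X (fun s => scal (w s) (inner t1 t2 s)) (fun s => scal (w s) (inner t2 t3 s)))
    by (apply inner_ex_RInt; lra). vring.
- intros s Hs. rewrite Rmin_left in Hs by lra. unfold inner.
  rewrite <- (RInt_Chasles (fun t => k t s) t1 t2 t3) by (apply kernel_ex_RInt_left; lra).
  vring.
Qed.

(** The defect is additive and quadratically small, so halving the interval halves the
    bound; iterating shows that it vanishes. *)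
Lemma defect_halving (n : nat) : forall t1 t2 : R, a0 < t1 -> t1 <= t2 ->
  norm (defect t1 t2) <= 2 * ((d - c) * (W * L)) * (t2 - t1) ^ 2 * (/ 2) ^ n.
Proof.
induction n as [|n IH]; intros t1 t2 H1 H2.
- simpl pow at 2. rewrite Rmult_1_r. now apply defect_quadratic.
- rewrite (defect_additive t1 ((t1 + t2) / 2) t2) by lra.
  eapply Rle_trans; [apply norm_plus_le|].
  pose proof (IH t1 ((t1 + t2) / 2)) as Ha. pose proof (IH ((t1 + t2) / 2) t2) as Hb.
  eapply Rle_trans; [apply Rplus_le_compat; [apply Ha|apply Hb]; lra|].
  right. simpl. field.
Qed.

(** The weight is kept apart because it is continuous only, whereas the kernel is
    Lipschitz in both variables.  The conditions live on open half-lines so that the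
    integrands are continuous at the end points of the rectangle as well. *)
Lemma RInt_swap_lipschitz (a b : R) : a0 < a -> a <= b ->
  RInt (fun t => RInt (fun sigma => scal (w sigma) (k t sigma)) c d) a b =
  RInt (fun sigma => scal (w sigma) (RInt (fun t => k t sigma) a b)) c d.
Proof.
intros Ha Hab. fold outer.
change (RInt outer a b = RInt (fun s => scal (w s) (inner a b s)) c d).
assert (H0 : norm (defect a b) = 0).
{ apply Rle_antisym; [|apply norm_nonneg].
  set (M := 2 * ((d - c) * (W * L)) * (b - a) ^ 2).
  assert (HM : 0 <= M).
  { unfold M. repeat apply Rmult_le_pos; lra. }
  apply le_epsilon. intros eps Heps. rewrite Rplus_0_l.
  destruct (pow_lt_1_zero (/ 2)) with (y := eps / (M + 1)) as [n Hn].
  - rewrite Rabs_pos_eq; lra.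
  - apply Rdiv_lt_0_compat; lra.
  - specialize (Hn n (Nat.le_refl n)).
    eapply Rle_trans; [apply (defect_halving n); lra|]. fold M.
    rewrite Rabs_pos_eq in Hn by (apply pow_le; lra).
    apply Rle_trans with (M * (eps / (M + 1))); [apply Rmult_le_compat_l; lra|].
    apply (Rmult_le_reg_r (M + 1)); [lra|]. field_simplify; [|lra]. nra. }
apply norm_eq_zero in H0. unfold defect in H0.
set (u := RInt outer a b) in *. set (v := RInt _ c d) in *.
transitivity (plus (minus u v) v); [vring|]. rewrite H0. vring.
Qed.

End Fubini.

(** * The logarithmic quotient *)

(** The value of the integral of [1 / ((1 + t) (1 + t sigma))] over [t > 0], extended
    continuously to [sigma = 1]. *)
Definition log_quotient (sigma : R) : R :=
  if Req_EM_T sigma 1 then 1 else ln sigma / (sigma - 1).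

Lemma ln_lower (x : R) : 0 < x -> 1 - / x <= ln x.
Proof.
intros Hx. pose proof (exp_ineq1_le (- ln x)) as H.
rewrite exp_Ropp, exp_ln in H by easy. lra.
Qed.

Lemma ln_upper (x : R) : 0 < x -> ln x <= x - 1.
Proof. intros Hx. pose proof (exp_ineq1_le (ln x)) as H. rewrite exp_ln in H; lra. Qed.

Lemma log_quotient_bounds (sigma : R) : 0 < sigma ->
  Rmin 1 (/ sigma) <= log_quotient sigma <= Rmax 1 (/ sigma).
Proof.
intros Hs. unfold log_quotient. destruct (Req_EM_T sigma 1) as [->|Hne].
- rewrite Rinv_1, Rmin_left, Rmax_left; lra.
- pose proof (ln_lower sigma Hs) as Hl. pose proof (ln_upper sigma Hs) as Hu.
  assert (Hi : / sigma * sigma = 1) by (field; lra).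
  assert (Hi0 : 0 < / sigma) by now apply Rinv_0_lt_compat.
  assert (HQ : ln sigma / (sigma - 1) * (sigma - 1) = ln sigma) by (field; lra).
  set (Q := ln sigma / (sigma - 1)) in *. set (v := / sigma) in *.
  destruct (Rle_dec sigma 1) as [H|H].
  + rewrite Rmin_left, Rmax_right by nra. split; nra.
  + rewrite Rmin_right, Rmax_left by nra. split; nra.
Qed.

Lemma log_quotient_continuous (sigma : R) : 0 < sigma -> continuous log_quotient sigma.
Proof.
intros Hs. destruct (Req_EM_T sigma 1) as [->|Hne].
- apply (@locally_lipschitz_continuous R_CompleteNormedModule _ 1 (/ 2) 2); [lra|].
  intros t Ht. change (Rabs (log_quotient t - log_quotient 1) <= 2 * Rabs (t - 1)).
  assert (Ht2 : / 2 < t) by (unfold Rabs in Ht; destruct Rcase_abs in Ht; lra).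
  replace (log_quotient 1) with 1 by (unfold log_quotient; destruct (Req_EM_T 1 1); lra).
  pose proof (log_quotient_bounds t ltac:(lra)) as Hb.
  assert (Hi : / t * t = 1) by (field; lra).
  assert (Hi0 : 0 < / t < 2).
  { split; [apply Rinv_0_lt_compat; lra|]. rewrite <- (Rinv_inv 2).
    apply Rinv_lt_contravar; lra. }
  set (v := / t) in *. set (l := log_quotient t) in *.
  destruct (Rle_dec t 1) as [H|H].
  + rewrite Rmin_left, Rmax_right in Hb by nra.
    rewrite (Rabs_left1 (t - 1)), Rabs_pos_eq by lra. nra.
  + rewrite Rmin_right, Rmax_left in Hb by nra.
    rewrite (Rabs_pos_eq (t - 1)), Rabs_left1 by lra. nra.
- apply (continuous_ext_loc _ (fun t => ln t / (t - 1))).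
  + exists (mkposreal (Rabs (sigma - 1)) (Rabs_pos_lt _ (Rminus_eq_contra _ _ Hne))).
    intros t Ht. unfold log_quotient.
    destruct (Req_EM_T t 1) as [->|]; [|easy].
    change (Rabs (1 - sigma) < Rabs (sigma - 1)) in Ht. rewrite Rabs_minus_sym in Ht. lra.
  + apply (ex_derive_continuous (fun t => ln t / (t - 1))). auto_derive. lra.
Qed.

(** Both factors are at least [1 / (1 + sigma)], and the square of this has an explicit
    integral.  The bound must not depend on [N]. *)
Lemma log_quotient_integral (q N I : R) : 0 < q < 1 -> 2 <= N ->
  is_RInt (fun sigma => Rpower sigma (q - 1) * log_quotient sigma) (/ N) N I ->
  / 3 <= I.
Proof.
intros Hq HN HI.
assert (HN0 : 0 < / N) by (apply Rinv_0_lt_compat; lra).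
assert (HN1 : / N <= / 2) by (apply Rinv_le_contravar; lra).
assert (HD : is_RInt (fun sigma => / (1 + sigma) ^ 2) (/ N) N
               (minus (- / (1 + N)) (- / (1 + / N)))).
{ apply (@is_RInt_derive R_CompleteNormedModule (fun s => - / (1 + s)) (fun s => / (1 + s) ^ 2)).
  - intros s Hs. rewrite Rmin_left in Hs by lra. auto_derive; [lra|]. field. lra.
  - intros s Hs. rewrite Rmin_left in Hs by lra.
    apply (ex_derive_continuous (fun s => / (1 + s) ^ 2)). auto_derive.
    assert (0 < (1 + s) ^ 2) by (apply pow_lt; lra). simpl in *. lra. }
apply Rle_trans with (minus (- / (1 + N)) (- / (1 + / N))).
- unfold minus, plus, opp; simpl.
  replace (- / (1 + N) + - - / (1 + / N)) with (1 - 2 * / (N + 1)) by (field; lra).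
  assert (/ (N + 1) <= / 3) by (apply Rinv_le_contravar; lra). lra.
- refine (is_RInt_le _ _ _ _ _ _ _ HD HI _); [lra|].
  intros s Hs. assert (Hs0 : 0 < s) by lra.
  pose proof (log_quotient_bounds s Hs0) as [Hl _].
  assert (Hp : / (1 + s) <= Rpower s (q - 1)).
  { destruct (Rle_dec s 1) as [H|H].
    - apply Rle_trans with 1.
      + rewrite <- Rinv_1. apply Rinv_le_contravar; lra.
      + replace (q - 1) with (- (1 - q)) by ring. rewrite <- Rpower_inv_base by easy.
        apply Rle_trans with (Rpower (/ s) 0).
        { right. symmetry. apply Rpower_O. now apply Rinv_0_lt_compat. }
        apply Rle_Rpower; [|lra]. rewrite <- Rinv_1. apply Rinv_le_contravar; lra.
    - apply Rle_trans with (Rpower s (Ropp 1)).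
      + rewrite Rpower_Ropp, Rpower_1 by easy. apply Rinv_le_contravar; lra.
      + apply Rle_Rpower; lra. }
  assert (Hq' : / (1 + s) <= log_quotient s).
  { eapply Rle_trans; [|exact Hl]. apply Rmin_glb.
    - rewrite <- Rinv_1. apply Rinv_le_contravar; lra.
    - apply Rinv_le_contravar; lra. }
  assert (0 < / (1 + s)) by (apply Rinv_0_lt_compat; lra).
  replace (/ (1 + s) ^ 2) with (/ (1 + s) * / (1 + s)) by (field; lra).
  apply Rmult_le_compat; lra.
Qed.

(** * Integrals of a product of two resolvents *)

(** An inequality between continuous functions extends to an isolated point. *)
Lemma norm_le_punctured {V : Banach} (f : R -> V) (g : R -> R) (x0 d : R) : 0 < d ->
  continuous f x0 -> continuous g x0 ->
  (forall x, Rabs (x - x0) < d -> x <> x0 -> norm (f x) <= g x) ->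
  norm (f x0) <= g x0.
Proof.
intros Hd Hf Hg H.
assert (Hle : filter_le (at_right x0) (locally x0)).
{ intros P [e He]. exists e. intros y Hy _. now apply He. }
change (Rbar_le (norm (f x0)) (g x0)).
refine (@filterlim_le R (at_right x0) _ (fun x => norm (f x)) g (norm (f x0)) (g x0) _ _ _).
- exists (mkposreal _ Hd). intros y Hy Hne. apply H; [exact Hy|lra].
- refine (filterlim_filter_le_1 _ Hle _).
  apply (filterlim_comp _ _ _ f norm _ (locally (f x0)) _ Hf).
  exact (@filterlim_norm R_AbsRing V (f x0)).
- exact (filterlim_filter_le_1 _ Hle Hg).
Qed.

Lemma norm_RInt_inv_square {V : Banach} (f : R -> V) (a b m : R) (l : V) :
  0 < a -> 0 < b -> is_RInt f a b l ->
  (forall s, 0 < s -> norm (f s) <= m * / s ^ 2) ->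
  norm l <= m * Rabs (/ a - / b).
Proof.
assert (Haux : forall a b l, 0 < a -> a <= b -> is_RInt f a b l ->
  (forall s, 0 < s -> norm (f s) <= m * / s ^ 2) -> norm l <= m * Rabs (/ a - / b)).
{ clear a b l. intros a b l Ha Hab Hl Hf.
  assert (/ b <= / a) by (apply Rinv_le_contravar; lra).
  rewrite Rabs_pos_eq by lra.
  apply (norm_RInt_le f (fun s => m * / s ^ 2) a b); [easy| |easy|].
  - intros s Hs. apply Hf. lra.
  - replace (m * (/ a - / b)) with (minus (- m * / b) (- m * / a))
      by (unfold minus, plus, opp; simpl; ring).
    apply (@is_RInt_derive R_CompleteNormedModule (fun s => - m * / s) (fun s => m * / s ^ 2)).
    + intros s Hs. rewrite Rmin_left in Hs by lra. auto_derive; [lra|]. field. lra.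
    + intros s Hs. rewrite Rmin_left in Hs by lra.
      apply (ex_derive_continuous (fun s => m * / s ^ 2)). auto_derive.
      assert (0 < s ^ 2) by (apply pow_lt; lra). simpl in *. lra. }
intros Ha Hb Hl Hf. destruct (Rle_dec a b) as [H|H].
- now apply Haux.
- rewrite Rabs_minus_sym, <- (norm_opp l). apply Haux; try lra; try easy.
  now apply is_RInt_swap.
Qed.

Section DoubleResolvent.

Context {X : Banach} (G : X -> X) (kappa : R).
Context (HG : is_linear G) (Hkappa : 0 < kappa).
Context (Hres : nonneg_type_with G kappa).

Local Notation R_ := (resolvent G).

(** The kernel left after substituting [s = t sigma] in the product of two Balakrishnan
    integrals. *)
Definition double_resolvent (y : X) (t sigma : R) : X := R_ t (R_ (t * sigma) (G y)).

(** Partial fractions, by the resolvent identity. *)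
Lemma double_resolvent_split (y : X) (t sigma : R) : 0 < t -> 0 < sigma -> sigma <> 1 ->
  double_resolvent y t sigma =
  scal (/ (1 - sigma)) (minus (R_ t y) (scal sigma (R_ (t * sigma) y))).
Proof.
intros Ht Hs Hne. assert (Hts : 0 < t * sigma) by now apply Rmult_lt_0_compat.
unfold double_resolvent.
pose proof (resolvent_identity G kappa HG Hkappa Hres t (t * sigma) y Ht Hts) as HI.
replace (R_ (t * sigma) (G y)) with (minus y (scal (t * sigma) (R_ (t * sigma) y))).
- rewrite (linear_minus _ _ _ (resolvent_linear G kappa HG Hkappa Hres t Ht)).
  rewrite (linear_scal _ (resolvent_linear G kappa HG Hkappa Hres t Ht)).
  replace (R_ t (R_ (t * sigma) y))
    with (scal (/ (t * sigma - t)) (minus (R_ t y) (R_ (t * sigma) y))).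
  + vfield; split; try lra; replace (t * sigma - t) with (t * (sigma - 1)) by ring;
    apply Rmult_integral_contrapositive; lra.
  + rewrite HI. vfield.
    replace (t * sigma - t) with (t * (sigma - 1)) by ring.
    apply Rmult_integral_contrapositive; lra.
- rewrite (resolvent_comm_G G kappa HG Hres) by easy.
  rewrite <- (shifted_resolvent G kappa Hres (t * sigma) y Hts) at 1. vring.
Qed.

Lemma double_resolvent_lipschitz (y : X) (a0 c0 : R) : 0 < a0 -> 0 < c0 ->
  exists L, 0 <= L /\
  (forall t t' sigma, a0 < t -> a0 < t' -> c0 < sigma ->
     norm (minus (double_resolvent y t sigma) (double_resolvent y t' sigma))
     <= L * Rabs (t - t')) /\
  (forall t sigma sigma', a0 < t -> c0 < sigma -> c0 < sigma' ->
     norm (minus (double_resolvent y t sigma) (double_resolvent y t sigma'))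
     <= L * Rabs (sigma - sigma')).
Proof.
intros Ha Hc. set (M := kappa ^ 3 * norm (G y)).
assert (Hn := norm_nonneg (G y)).
assert (HM : 0 <= M).
{ apply Rmult_le_pos; [apply pow_le; lra|easy]. }
exists (2 * M * / a0 ^ 3 * / c0 + M * / a0 ^ 2 * / c0 ^ 2).
assert (Hi1 : 0 < / a0) by now apply Rinv_0_lt_compat.
assert (Hi2 : 0 < / c0) by now apply Rinv_0_lt_compat.
assert (HA : 0 <= 2 * M * / a0 ^ 3 * / c0).
{ rewrite <- pow_inv. repeat apply Rmult_le_pos; lra. }
assert (HB : 0 <= M * / a0 ^ 2 * / c0 ^ 2).
{ rewrite <- !pow_inv. repeat apply Rmult_le_pos; lra. }
split; [lra|]. split.
- intros t t' s Ht Ht' Hs. unfold double_resolvent.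
  assert (Hts : 0 < t * s) by (apply Rmult_lt_0_compat; lra).
  assert (Hts' : 0 < t' * s) by (apply Rmult_lt_0_compat; lra).
  assert (I1 : 0 < / t <= / a0).
  { split; [apply Rinv_0_lt_compat; lra|apply Rinv_le_contravar; lra]. }
  assert (I2 : 0 < / t' <= / a0).
  { split; [apply Rinv_0_lt_compat; lra|apply Rinv_le_contravar; lra]. }
  assert (I3 : 0 < / s <= / c0).
  { split; [apply Rinv_0_lt_compat; lra|apply Rinv_le_contravar; lra]. }
  assert (Hprod : forall u v : R, 0 < u <= / a0 -> 0 < v <= / a0 ->
     M * (/ t * (u * v)) * / s <= M * / a0 ^ 3 * / c0).
  { intros u v Hu Hv. rewrite <- pow_inv, !Rmult_assoc. apply Rmult_le_compat_l; [easy|].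
    rewrite <- !Rmult_assoc. replace (/ a0 ^ 3) with (/ a0 * / a0 * / a0) by (field; lra).
    replace ((/ a0) ^ 3) with (/ a0 * / a0 * / a0) by (simpl; ring).
    repeat apply Rmult_le_compat; try lra; repeat apply Rmult_le_pos; lra. }
  eapply Rle_trans; [apply (norm_minus_triangle _ (R_ t' (R_ (t * s) (G y))))|].
  rewrite (Rmult_comm _ (Rabs (t - t'))).
  apply Rle_trans with (Rabs (t - t') * (M * / a0 ^ 3 * / c0) + Rabs (t - t') * (M * / a0 ^ 3 * / c0)).
  2: { pose proof (Rabs_pos (t - t')).
       rewrite <- Rmult_plus_distr_l. apply Rmult_le_compat_l; lra. }
  apply Rplus_le_compat.
  + eapply Rle_trans; [apply (resolvent_lipschitz G kappa HG Hkappa Hres); lra|].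
    apply Rmult_le_compat_l; [apply Rabs_pos|].
    eapply Rle_trans; [|apply (Hprod (/ t) (/ t') I1 I2)].
    apply Rle_trans with (kappa / t * (kappa / t') * (kappa / (t * s) * norm (G y))).
    * apply Rmult_le_compat_l; [|now apply (resolvent_bound G kappa)].
      apply Rmult_le_pos; left; apply Rdiv_lt_0_compat; lra.
    * right. unfold M. field. lra.
  + rewrite <- (linear_minus _ _ _ (resolvent_linear G kappa HG Hkappa Hres t' ltac:(lra))).
    eapply Rle_trans; [apply (resolvent_bound G kappa Hres); lra|].
    eapply Rle_trans.
    { apply Rmult_le_compat_l; [left; apply Rdiv_lt_0_compat; lra|].
      apply (resolvent_lipschitz G kappa HG Hkappa Hres); lra. }
    replace (t * s - t' * s) with ((t - t') * s) by ring. rewrite Rabs_mult, (Rabs_pos_eq s) by lra.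
    apply Rle_trans with (Rabs (t - t') * (M * (/ t * (/ t' * / t')) * / s)).
    * right. unfold M. field. lra.
    * apply Rmult_le_compat_l; [apply Rabs_pos|]. now apply Hprod.
- intros t s s' Ht Hs Hs'. unfold double_resolvent.
  assert (Hts : 0 < t * s) by (apply Rmult_lt_0_compat; lra).
  assert (Hts' : 0 < t * s') by (apply Rmult_lt_0_compat; lra).
  rewrite <- (linear_minus _ _ _ (resolvent_linear G kappa HG Hkappa Hres t ltac:(lra))).
  eapply Rle_trans; [apply (resolvent_bound G kappa Hres); lra|].
  eapply Rle_trans.
  { apply Rmult_le_compat_l; [left; apply Rdiv_lt_0_compat; lra|].
    apply (resolvent_lipschitz G kappa HG Hkappa Hres); lra. }
  replace (t * s - t * s') with ((s - s') * t) by ring. rewrite Rabs_mult, (Rabs_pos_eq t) by lra.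
  apply Rle_trans with ((M * / t ^ 2 * (/ s * / s')) * Rabs (s - s')).
  + right. unfold M. field. lra.
  + apply Rmult_le_compat_r; [apply Rabs_pos|].
    apply Rle_trans with (M * / a0 ^ 2 * / c0 ^ 2); [|lra].
    rewrite !Rmult_assoc. apply Rmult_le_compat_l; [easy|].
    assert (0 < / t <= / a0).
    { split; [apply Rinv_0_lt_compat; lra|apply Rinv_le_contravar; lra]. }
    assert (0 < / s <= / c0).
    { split; [apply Rinv_0_lt_compat; lra|apply Rinv_le_contravar; lra]. }
    assert (0 < / s' <= / c0).
    { split; [apply Rinv_0_lt_compat; lra|apply Rinv_le_contravar; lra]. }
    rewrite <- !pow_inv. apply Rmult_le_compat.
    * apply pow_le; lra.
    * apply Rmult_le_pos; lra.
    * apply pow_incr; lra.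
    * simpl. rewrite Rmult_1_r. apply Rmult_le_compat; lra.
Qed.

Lemma resolvent_ex_RInt (y : X) (a b : R) : 0 < a -> 0 < b ->
  ex_RInt (fun t => R_ t y) a b.
Proof.
intros Ha Hb. apply ex_RInt_pos; [|easy|easy].
intros s Hs. now apply (resolvent_continuous G kappa).
Qed.

(** After partial fractions and the substitution [t |-> sigma t] the integrals over the
    bulk cancel, and two integrals over intervals next to the end points remain. *)
Lemma double_resolvent_RInt_split (y : X) (e T sigma : R) :
  0 < e -> e <= T -> 0 < sigma -> sigma <> 1 ->
  RInt (fun t => double_resolvent y t sigma) e T =
  scal (/ (1 - sigma)) (plus (RInt (fun t => R_ t y) e (sigma * e))
                             (RInt (fun t => R_ t y) (sigma * T) T)).
Proof.
intros He HT Hs Hne.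
assert (Hse : 0 < sigma * e) by now apply Rmult_lt_0_compat.
assert (HsT : 0 < sigma * T) by (apply Rmult_lt_0_compat; lra).
assert (Hex := resolvent_ex_RInt y).
rewrite (RInt_ext _ (fun t => scal (/ (1 - sigma))
           (minus (R_ t y) (scal sigma (R_ (sigma * t + 0) y))))).
2: { intros t [Ht _]. rewrite Rmin_left in Ht by easy.
     rewrite double_resolvent_split by lra. now rewrite (Rmult_comm sigma), Rplus_0_r. }
apply is_RInt_unique. apply (@is_RInt_scal X).
replace (plus (RInt (fun t => R_ t y) e (sigma * e)) (RInt (fun t => R_ t y) (sigma * T) T))
  with (minus (RInt (fun t => R_ t y) e T) (RInt (fun t => R_ t y) (sigma * e) (sigma * T))).
- apply (@is_RInt_minus X).
  + apply (@RInt_correct X), Hex; lra.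
  + apply (@is_RInt_comp_lin X (fun t => R_ t y) sigma 0). rewrite !Rplus_0_r.
    apply (@RInt_correct X), Hex; lra.
- rewrite <- (RInt_Chasles (fun t => R_ t y) e (sigma * e) T) by (apply Hex; lra).
  rewrite <- (RInt_Chasles (fun t => R_ t y) (sigma * e) (sigma * T) T) by (apply Hex; lra).
  vring.
Qed.

(** For large [t] the resolvent is close to [1 / t], with an error of order [1 / t^2]. *)
Lemma resolvent_RInt_log (y : X) (a b : R) : 0 < a -> 0 < b ->
  norm (minus (RInt (fun t => R_ t y) a b) (scal (ln b - ln a) y))
  <= kappa * norm (G y) * Rabs (/ a - / b).
Proof.
intros Ha Hb.
assert (Hpos : forall x, Rmin a b <= x -> 0 < x).
{ intros x Hx. pose proof (Rmin_glb_lt a b 0 Ha Hb). lra. }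
assert (Hlog : is_RInt (fun t => scal (/ t) y) a b (scal (ln b - ln a) y)).
{ apply (@is_RInt_linear R_CompleteNormedModule X (fun k => scal k y)).
  - exact (@is_linear_scal_l R_AbsRing X y).
  - apply (@is_RInt_derive R_CompleteNormedModule ln Rinv).
    + intros x [Hx _]. apply Hpos in Hx. apply is_derive_Reals. now apply derivable_pt_lim_ln.
    + intros x [Hx _]. apply Hpos in Hx. apply (ex_derive_continuous Rinv). auto_derive. lra. }
assert (Hrem := @is_RInt_minus X _ _ _ _ _ _
  (@RInt_correct X _ _ _ (resolvent_ex_RInt y a b Ha Hb)) Hlog).
apply (norm_RInt_inv_square (fun s => minus (R_ s y) (scal (/ s) y)) a b _ _ Ha Hb Hrem).
intros s Hs.
replace (minus (R_ s y) (scal (/ s) y)) with (scal (- / s) (R_ s (G y))).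
- eapply Rle_trans; [apply norm_scal_le|]. rewrite Rabs_Ropp, Rabs_pos_eq.
  + eapply Rle_trans.
    * apply Rmult_le_compat_l; [left; now apply Rinv_0_lt_compat|].
      now apply (resolvent_bound G kappa Hres).
    * right. field. lra.
  + left; now apply Rinv_0_lt_compat.
- rewrite (resolvent_comm_G G kappa HG Hres) by easy.
  rewrite <- (shifted_resolvent G kappa Hres s y Hs) at 3. vfield; lra.
Qed.

(** Of the two remaining integrals, the one near [e] is small because the resolvent is
    bounded at [y], and the one near [T] is a logarithm up to [O(1 / (sigma T))]. *)
Lemma double_resolvent_RInt_approx (y : X) (e T M sigma : R) :
  0 < e -> e <= T -> 0 < sigma ->
  (forall t, 0 < t -> norm (R_ t y) <= M) ->
  norm (minus (RInt (fun t => double_resolvent y t sigma) e T)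
              (scal (log_quotient sigma) y))
  <= e * M + kappa * norm (G y) * / (sigma * T).
Proof.
intros He HT Hs HM.
assert (Hgen : forall s, 0 < s -> s <> 1 ->
  norm (minus (RInt (fun t => double_resolvent y t s) e T) (scal (log_quotient s) y))
  <= e * M + kappa * norm (G y) * / (s * T)).
{ clear sigma Hs. intros s Hs Hne.
  assert (Hse : 0 < s * e) by now apply Rmult_lt_0_compat.
  assert (HsT : 0 < s * T) by (apply Rmult_lt_0_compat; lra).
  rewrite double_resolvent_RInt_split by easy.
  set (I1 := RInt _ e (s * e)). set (I2 := RInt _ (s * T) T).
  norm_as (scal (/ (1 - s)) (plus I1 (minus I2 (scal (ln T - ln (s * T)) y)))).
  2: { unfold log_quotient. destruct (Req_EM_T s 1); [easy|].
       rewrite ln_mult by lra. vfield; lra. }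
  assert (H1 : norm I1 <= Rabs (1 - s) * (e * M)).
  { replace (Rabs (1 - s) * (e * M)) with (Rabs (s * e - e) * M).
    - apply (norm_RInt_le_const_abs (fun t => R_ t y) e (s * e)).
      + intros t [Ht _]. apply HM. pose proof (Rmin_glb_lt e (s * e) 0). lra.
      + apply (@RInt_correct X), resolvent_ex_RInt; easy.
    - replace (s * e - e) with (- ((1 - s) * e)) by ring.
      rewrite Rabs_Ropp, Rabs_mult, (Rabs_pos_eq e) by lra. ring. }
  assert (H2 : norm (minus I2 (scal (ln T - ln (s * T)) y))
               <= Rabs (1 - s) * (kappa * norm (G y) * / (s * T))).
  { eapply Rle_trans; [apply resolvent_RInt_log; lra|]. right.
    replace (/ (s * T) - / T) with ((1 - s) * / (s * T)) by (field; lra).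
    rewrite Rabs_mult, (Rabs_pos_eq (/ (s * T))); [ring|].
    left; now apply Rinv_0_lt_compat. }
  assert (H0 : 0 < Rabs (1 - s)) by (apply Rabs_pos_lt; lra).
  eapply Rle_trans; [apply norm_scal_le|]. rewrite Rabs_inv.
  apply (Rmult_le_reg_l (Rabs (1 - s))); [easy|].
  rewrite <- Rmult_assoc, Rinv_r, Rmult_1_l, Rmult_plus_distr_l by lra.
  eapply Rle_trans; [apply norm_plus_le|]. now apply Rplus_le_compat. }
(* both sides are continuous in sigma, which covers sigma = 1 *)
destruct (Req_EM_T sigma 1) as [->|Hne]; [|now apply Hgen].
destruct (double_resolvent_lipschitz y (e / 2) (/ 2)) as [L [HL [HL1 HL2]]]; [lra|lra|].
apply (norm_le_punctured
  (fun s => minus (RInt (fun t => double_resolvent y t s) e T) (scal (log_quotient s) y))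
  (fun s => e * M + kappa * norm (G y) * / (s * T)) 1 (/ 2)); [lra| | |].
- apply (@continuous_minus R_UniformSpace R_AbsRing X).
  + apply (inner_continuous (double_resolvent y) (e / 2) (/ 2) L); try easy; lra.
  + apply (@continuous_scal R_UniformSpace R_AbsRing X log_quotient (fun _ => y)).
    * apply log_quotient_continuous; lra.
    * apply continuous_const.
- apply (ex_derive_continuous (fun s => e * M + kappa * norm (G y) * / (s * T))).
  auto_derive. lra.
- intros s Hs' Hne. apply Hgen; [|easy].
  unfold Rabs in Hs'; destruct Rcase_abs in Hs'; lra.
Qed.

End DoubleResolvent.

(** * The inverse estimate for a fractional exponent *)

(** Both powers are at most [N^(-2 th)], and [ln N] grows slower than [N^th]. *)
Lemma Rpower_log_vanishes (q E eps N0 : R) : 0 < q < 1 -> 0 <= E -> 0 < eps ->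
  exists N, N0 <= N /\ 1 <= N /\
    E * ((Rpower N (- q) + Rpower N (q - 1)) * (1 + ln N)) <= eps.
Proof.
intros Hq HE Heps.
set (th := Rmin q (1 - q) / 2).
assert (Hth : 0 < th /\ 2 * th <= q /\ 2 * th <= 1 - q).
{ unfold th. pose proof (Rmin_l q (1 - q)). pose proof (Rmin_r q (1 - q)).
  assert (0 < Rmin q (1 - q)) by (apply Rmin_pos; lra). lra. }
set (E' := E * (2 * (1 + / th)) + 1).
assert (Hith : 0 < / th) by (apply Rinv_0_lt_compat; lra).
assert (HE' : 0 <= E * (2 * (1 + / th))) by (apply Rmult_le_pos; lra).
destruct (Rpower_small th (eps / E')) as [a [Ha Hsmall]]; [lra| |].
{ apply Rdiv_lt_0_compat; unfold E'; lra. }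
(* powers of 1/N are small once 1/N is at most a *)
set (N := Rmax (/ a) N0).
assert (HNa : / a <= N) by apply Rmax_l.
assert (H1a : 1 <= / a) by (rewrite <- Rinv_1; apply Rinv_le_contravar; lra).
exists N. split; [apply Rmax_r|]. split; [lra|].
assert (HNi : 0 < / N <= a).
{ split; [apply Rinv_0_lt_compat; lra|]. rewrite <- (Rinv_inv a). apply Rinv_le_contravar; lra. }
specialize (Hsmall (/ N) HNi). rewrite Rpower_inv_base in Hsmall by lra.
assert (P1 : Rpower N (- q) <= Rpower N (- th) * Rpower N (- th)).
{ rewrite <- Rpower_plus. apply Rle_Rpower; lra. }
assert (P2 : Rpower N (q - 1) <= Rpower N (- th) * Rpower N (- th)).
{ rewrite <- Rpower_plus. apply Rle_Rpower; lra. }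
assert (P3 : Rpower N (- th) * Rpower N th = 1).
{ rewrite <- Rpower_plus, Rplus_opp_l. apply Rpower_O. lra. }
assert (P4 : 1 <= Rpower N th).
{ rewrite <- (Rpower_O N) by lra. apply Rle_Rpower; lra. }
assert (P5 : ln N <= / th * Rpower N th).
{ apply (Rmult_le_reg_l th); [lra|]. rewrite <- Rmult_assoc, Rinv_r, Rmult_1_l by lra.
  replace (th * ln N) with (ln (Rpower N th)) by (unfold Rpower; apply ln_exp).
  pose proof (ln_upper (Rpower N th) (Rpower_pos _ _)). lra. }
assert (P0 := Rpower_pos N (- th)).
assert (HlnN : 0 <= ln N) by (rewrite <- ln_1; apply ln_le; lra).
set (v := Rpower N (- th)) in *. set (u := Rpower N th) in *.
apply Rle_trans with (E * ((2 * (v * v)) * ((1 + / th) * u))).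
- apply Rmult_le_compat_l; [easy|]. apply Rmult_le_compat; try lra.
  pose proof (Rpower_pos N (- q)). pose proof (Rpower_pos N (q - 1)). lra.
- replace (E * (2 * (v * v) * ((1 + / th) * u))) with (E * (2 * (1 + / th)) * v * (v * u)) by ring.
  rewrite P3, Rmult_1_r.
  apply Rle_trans with (E' * (eps / E')); [|right; field; unfold E'; lra].
  apply Rmult_le_compat; [easy|lra|unfold E'; lra|lra].
Qed.

Section InverseEstimate.

Context {X : Banach} (G : X -> X) (kappa : R).
Context (HG : is_linear G) (Hkappa : 0 < kappa).
Context (Hres : nonneg_type_with G kappa).

Local Notation R_ := (resolvent G).

Context (q beta : R) (x : X) (Hq : 0 < q < 1) (Hbeta : 0 < beta).

Let y : X := high G beta x.
Let z : X := frac_pow01 G q x.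
Let cq : R := sin (PI * q) / PI.
Let D : R := kappa * (1 + kappa).

Let kernel_slice (N t : R) : X :=
  RInt (fun sigma => scal (Rpower sigma (q - 1)) (double_resolvent G y t sigma)) (/ N) N.

(** Decay in [t] from the outer resolvent; the companion bound is uniform in [t] and uses
    the factor [G] in [high beta] against the outer resolvent instead. *)
Lemma resolvent_high_bound1 (t : R) (v : X) : 0 < t ->
  norm (R_ t (high G beta v)) <= D / t * norm v.
Proof.
intros Ht. eapply Rle_trans; [now apply (resolvent_bound G kappa Hres)|].
unfold D. replace (kappa * (1 + kappa) / t * norm v) with (kappa / t * ((1 + kappa) * norm v)) by (field; lra).
apply Rmult_le_compat_l; [left; now apply Rdiv_lt_0_compat|].
now apply (high_bound G kappa Hres).
Qed.

Lemma resolvent_high_bound2 (t : R) (v : X) : 0 < t ->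
  norm (R_ t (high G beta v)) <= D / beta * norm v.
Proof.
intros Ht. unfold high. rewrite (resolvent_comm_G G kappa HG Hres) by easy.
eapply Rle_trans; [now apply (high_bound G kappa Hres)|].
unfold D. replace (kappa * (1 + kappa) / beta * norm v) with ((1 + kappa) * (kappa / beta * norm v)) by (field; lra).
apply Rmult_le_compat_l; [lra|]. now apply (resolvent_bound G kappa Hres).
Qed.

(** The substitution [s = t sigma] in a truncated Balakrishnan integral. *)
Lemma kernel_slice_eq (N t : R) : 0 < N -> 0 < t ->
  kernel_slice N t =
  scal (Rpower t (- q)) (R_ t (high G beta (RInt (balakrishnan G q x) (t * / N) (t * N)))).
Proof.
intros HN Ht. assert (HN' : 0 < / N) by now apply Rinv_0_lt_compat.
unfold kernel_slice. apply is_RInt_unique.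
assert (HT : is_linear (fun v => R_ t (high G beta v))).
{ exact (is_linear_comp _ _ (high_linear G kappa HG Hkappa Hres beta Hbeta)
           (resolvent_linear G kappa HG Hkappa Hres t Ht)). }
assert (HI : is_RInt (balakrishnan G q x) (t * / N + 0) (t * N + 0)
               (RInt (balakrishnan G q x) (t * / N) (t * N))).
{ rewrite !Rplus_0_r. apply (@RInt_correct X), ex_RInt_pos.
  - intros s Hs. now apply (balakrishnan_continuous G kappa).
  - now apply Rmult_lt_0_compat.
  - now apply Rmult_lt_0_compat. }
apply (@is_RInt_linear X X _ HT) in HI.
apply (@is_RInt_comp_lin X) in HI.
apply (@is_RInt_scal X _ _ _ (Rpower t (- q))) in HI.
refine (@is_RInt_ext X _ _ _ _ _ _ HI). intros s [Hs _].
pose proof (Rmin_glb_lt (/ N) N 0 HN' HN). assert (Hs0 : 0 < s) by lra.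
assert (Hts : 0 < t * s) by now apply Rmult_lt_0_compat.
rewrite Rplus_0_r. unfold balakrishnan, double_resolvent, y.
rewrite (linear_scal _ HT).
rewrite <- (resolvent_comm_op G kappa Hres (high G beta) (t * s) (G x) Hts
             (high_linear G kappa HG Hkappa Hres beta Hbeta))
  by (intros v; now apply (high_comm_G G kappa HG Hres)).
rewrite (high_comm_G G kappa HG Hres) by easy.
replace (Rpower s (q - 1)) with (Rpower t (- q) * (t * Rpower (t * s) (q - 1))).
- vring.
- rewrite <- Rpower_mult_distr by easy.
  replace (Rpower t (- q) * (t * (Rpower t (q - 1) * Rpower s (q - 1))))
    with ((Rpower t (- q) * (Rpower t 1 * Rpower t (q - 1))) * Rpower s (q - 1))
    by (rewrite Rpower_1 by easy; ring).
  rewrite <- !Rpower_plus. replace (- q + (1 + (q - 1))) with 0 by ring.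
  rewrite Rpower_O by easy. ring.
Qed.

(** Truncating the inner integral at [t / N] and [t N] costs a fixed power of [1 / N]
    times [1 / t], which integrates to a logarithm over the interval from [1/N] to [N]. *)
Lemma kernel_slice_approx (N t : R) : 0 < N -> 0 < t ->
  norm (minus (balakrishnan G (1 - q) (R_ beta z) t) (scal cq (kernel_slice N t))) <=
  D * ((1 + kappa) * norm x * (Rpower N (- q) / q)
       + kappa * norm (G x) * (Rpower N (q - 1) / (1 - q)) / beta) * / t.
Proof.
intros HN Ht. rewrite kernel_slice_eq by easy.
assert (HN' : 0 < / N) by now apply Rinv_0_lt_compat.
destruct (sin_coef_bounds q Hq) as [Hc0 Hc1]. fold cq in Hc0, Hc1.
set (I := RInt_gen (balakrishnan G q x) (at_right 0) (Rbar_locally p_infty)).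
set (J := RInt (balakrishnan G q x) (t * / N) (t * N)).
assert (HIJ : norm (minus I J) <=
  (1 + kappa) * norm x * (Rpower (t * / N) q / q)
  + kappa * norm (G x) * (Rpower (t * N) (q - 1) / (1 - q))).
{ apply RInt_gen_mellin_truncation; try easy.
  - intros s Hs. now apply (balakrishnan_continuous G kappa).
  - apply (balakrishnan_bound1 G kappa HG Hres). intros s Hs. now apply (high_bound G kappa).
  - apply (balakrishnan_bound2 G kappa HG Hres). intros s Hs. now apply (high_bound_inv G kappa).
  - now apply Rmult_lt_0_compat.
  - now apply Rmult_lt_0_compat. }
assert (HT : is_linear (fun v => R_ t (high G beta v))).
{ exact (is_linear_comp _ _ (high_linear G kappa HG Hkappa Hres beta Hbeta)
           (resolvent_linear G kappa HG Hkappa Hres t Ht)). }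
norm_as (scal (cq * Rpower t (- q)) (R_ t (high G beta (minus I J)))).
2: { refine (eq_trans (f_equal (scal (cq * Rpower t (- q)))
               (linear_minus (fun v => R_ t (high G beta v)) I J HT)) _).
     unfold balakrishnan.
     change (G (R_ beta z)) with (high G beta z). unfold z. rewrite frac_pow01_balakrishnan.
     fold I. rewrite (linear_scal (fun v => R_ t (high G beta v)) HT). fold cq.
     replace (1 - q - 1) with (- q) by ring. vring. }
assert (Htq := Rpower_pos t (- q)).
eapply Rle_trans; [apply norm_scal_pos_le; nra|].
set (d1 := (1 + kappa) * norm x) in *. set (d2 := kappa * norm (G x)) in *.
assert (Hd1 : 0 <= d1) by (apply Rmult_le_pos; [lra|apply norm_nonneg]).
assert (Hd2 : 0 <= d2) by (apply Rmult_le_pos; [lra|apply norm_nonneg]).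
set (e1 := d1 * (Rpower (t * / N) q / q)) in *.
set (e2 := d2 * (Rpower (t * N) (q - 1) / (1 - q))) in *.
assert (He1 : 0 <= e1).
{ apply Rmult_le_pos; [easy|]. left; apply Rdiv_lt_0_compat; [apply Rpower_pos|lra]. }
assert (He2 : 0 <= e2).
{ apply Rmult_le_pos; [easy|]. left; apply Rdiv_lt_0_compat; [apply Rpower_pos|lra]. }
assert (HD : 0 < D) by (unfold D; apply Rmult_lt_0_compat; lra).
assert (HDt : 0 < D / t) by now apply Rdiv_lt_0_compat.
assert (HDb : 0 < D / beta) by now apply Rdiv_lt_0_compat.
(* the decay in t is used on the tail near zero, the uniform bound on the other tail *)
assert (Hboth : norm (R_ t (high G beta (minus I J))) <= D / t * e1 + D / beta * e2).
{ set (n := norm (minus I J)) in *.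
  assert (B1 : norm (R_ t (high G beta (minus I J))) <= D / t * n) by now apply resolvent_high_bound1.
  assert (B2 : norm (R_ t (high G beta (minus I J))) <= D / beta * n) by now apply resolvent_high_bound2.
  destruct (Rle_dec (D / t) (D / beta)); nra. }
apply Rle_trans with (1 * Rpower t (- q) * (D / t * e1 + D / beta * e2)).
- apply Rmult_le_compat; [nra|apply norm_nonneg|nra|easy].
- right. unfold e1, e2.
  rewrite <- !Rpower_mult_distr by easy. rewrite Rpower_inv_base by easy.
  assert (Q1 : Rpower t (- q) * Rpower t q = 1).
  { rewrite <- Rpower_plus, Rplus_opp_l. now apply Rpower_O. }
  assert (Q2 : Rpower t (- q) * Rpower t (q - 1) = / t).
  { rewrite <- Rpower_plus. replace (- q + (q - 1)) with (Ropp 1) by ring.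
    now rewrite Rpower_Ropp, Rpower_1. }
  transitivity (D / t * (d1 * (Rpower N (- q) / q)) * (Rpower t (- q) * Rpower t q)
     + D / beta * (d2 * (Rpower N (q - 1) / (1 - q))) * (Rpower t (- q) * Rpower t (q - 1))).
  + field. lra.
  + rewrite Q1, Q2. field. lra.
Qed.

(** This truncates [G^(1-q) (G + beta)^-1 z]; splitting at [beta] gives the sharp power of
    [beta], uniformly in the truncation. *)
Lemma truncated_composition_bound (N : R) : / N <= beta <= N -> 0 < N ->
  norm (RInt (balakrishnan G (1 - q) (R_ beta z)) (/ N) N) <=
  D * (/ q + / (1 - q)) * Rpower beta (- q) * norm z.
Proof.
intros HNb HN. assert (HN' : 0 < / N) by now apply Rinv_0_lt_compat.
assert (Hcont : forall s, 0 < s -> continuous (balakrishnan G (1 - q) (R_ beta z)) s).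
{ intros s Hs. now apply (balakrishnan_continuous G kappa). }
assert (Hex := ex_RInt_pos _ Hcont).
assert (B1 : forall s, 0 < s -> norm (balakrishnan G (1 - q) (R_ beta z) s)
   <= D / beta * norm z * Rpower s (1 - q - 1)).
{ apply (balakrishnan_bound1 G kappa HG Hres). intros s Hs.
  unfold high. rewrite <- (resolvent_comm_G G kappa HG Hres) by easy.
  change (G (R_ beta z)) with (high G beta z). now apply resolvent_high_bound2. }
assert (B2 : forall s, 0 < s -> norm (balakrishnan G (1 - q) (R_ beta z) s)
   <= D * norm z * Rpower s (1 - q - 1 - 1)).
{ apply (balakrishnan_bound2 G kappa HG Hres). intros s Hs.
  unfold high. rewrite <- (resolvent_comm_G G kappa HG Hres) by easy.
  change (G (R_ beta z)) with (high G beta z).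
  eapply Rle_trans; [now apply resolvent_high_bound1|]. right. field. lra. }
rewrite <- (RInt_Chasles _ (/ N) beta N) by (apply Hex; lra).
eapply Rle_trans; [apply norm_plus_le|].
eapply Rle_trans.
{ apply Rplus_le_compat.
  - apply (mellin_near_zero _ (1 - q) (D / beta * norm z)); try easy; lra.
  - apply (mellin_near_infinity _ (1 - q) (D * norm z)); try easy; lra. }
right. replace (1 - q - 1) with (- q) by ring.
replace (Rpower beta (1 - q)) with (beta * Rpower beta (- q)).
- field. lra.
- rewrite <- (Rpower_1 beta) at 1 by easy. rewrite <- Rpower_plus. now f_equal.
Qed.

Let w (sigma : R) : R := Rpower sigma (q - 1).

(** Integrating over [t] first turns the double integral into a multiple [C] of [y], with
    [C] at least [1/3], up to terms that vanish as [N] grows. *)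
Lemma truncated_kernel_bound (N L : R) : 2 <= N -> 0 <= L ->
  (forall t t' sigma, / N / 2 < t -> / N / 2 < t' -> / N / 2 < sigma ->
     norm (minus (double_resolvent G y t sigma) (double_resolvent G y t' sigma))
     <= L * Rabs (t - t')) ->
  (forall t sigma sigma', / N / 2 < t -> / N / 2 < sigma -> / N / 2 < sigma' ->
     norm (minus (double_resolvent G y t sigma) (double_resolvent G y t sigma'))
     <= L * Rabs (sigma - sigma')) ->
  / 3 * norm y <= norm (RInt (kernel_slice N) (/ N) N)
    + (D / beta * norm x * (Rpower N (q - 1) / q)
       + kappa * norm (G y) * (Rpower N (- q) / (1 - q))).
Proof.
intros HN HL HL1 HL2.
assert (HN' : 0 < / N) by (apply Rinv_0_lt_compat; lra).
assert (HNN : / N <= / 2) by (apply Rinv_le_contravar; lra).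
assert (Hw : forall s, / N / 2 < s -> continuous w s).
{ intros s Hs. apply continuous_Rpower. lra. }
assert (HwW : forall s, / N <= s <= N -> Rabs (w s) <= Rpower N (1 - q)).
{ intros s Hs. rewrite Rabs_pos_eq by (left; apply Rpower_pos). unfold w.
  replace (q - 1) with (- (1 - q)) by ring. rewrite <- Rpower_inv_base by lra.
  apply Rle_Rpower_l; [lra|]. split; [apply Rinv_0_lt_compat; lra|].
  rewrite <- (Rinv_inv N). apply Rinv_le_contravar; lra. }
assert (HW0 : 0 <= Rpower N (1 - q)) by (left; apply Rpower_pos).
unfold kernel_slice.
rewrite (RInt_swap_lipschitz w (double_resolvent G y) (/ N / 2) (/ N / 2) (/ N) N L (Rpower N (1 - q)))
  by (assumption || lra).
set (inner := fun s => RInt (fun t => double_resolvent G y t s) (/ N) N).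
assert (Hinner : ex_RInt (fun s => scal (w s) (inner s)) (/ N) N).
{ apply (inner_ex_RInt w (double_resolvent G y) (/ N / 2) (/ N / 2) (/ N) N L);
  assumption || lra. }
assert (Hl : ex_RInt (fun s => w s * log_quotient s) (/ N) N).
{ apply (@ex_RInt_continuous R_CompleteNormedModule). intros s Hs. rewrite Rmin_left in Hs by lra.
  apply (@continuous_mult R_UniformSpace R_AbsRing w log_quotient).
  - apply Hw. lra.
  - apply log_quotient_continuous. lra. }
destruct Hl as [C HC].
assert (HC3 := log_quotient_integral q N C Hq HN HC).
assert (HCy : is_RInt (fun s => scal (w s * log_quotient s) y) (/ N) N (scal C y)).
{ apply (@is_RInt_linear R_CompleteNormedModule X (fun k => scal k y));
  [exact (@is_linear_scal_l R_AbsRing X y)|exact HC]. }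
assert (HM : forall t, 0 < t -> norm (R_ t y) <= D / beta * norm x).
{ intros t Ht. now apply resolvent_high_bound2. }
set (M := D / beta * norm x) in *. set (Gy := kappa * norm (G y)) in *.
assert (HM0 : 0 <= M) by (eapply Rle_trans; [apply (norm_nonneg (R_ 1 y))|apply HM; lra]).
assert (HGy : 0 <= Gy) by (apply Rmult_le_pos; [lra|apply norm_nonneg]).
assert (Hdiff : norm (minus (RInt (fun s => scal (w s) (inner s)) (/ N) N) (scal C y))
   <= M * (Rpower N (q - 1) / q) + Gy * (Rpower N (- q) / (1 - q))).
{ set (bnd := / N * M * ((Rpower N q - Rpower (/ N) q) / q)
     + Gy * / N * ((Rpower N (q - 1) - Rpower (/ N) (q - 1)) / (q - 1))).
  apply Rle_trans with bnd.
  - apply (norm_RInt_le (fun s => minus (scal (w s) (inner s)) (scal (w s * log_quotient s) y))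
      (fun s => / N * M * Rpower s (q - 1) + Gy * / N * Rpower s (q - 1 - 1)) (/ N) N); [lra| | |].
    + intros s Hs.
      norm_as (scal (w s) (minus (inner s) (scal (log_quotient s) y))); [|vring].
      eapply Rle_trans; [apply norm_scal_pos_le; left; apply Rpower_pos|].
      eapply Rle_trans.
      { apply Rmult_le_compat_l; [left; apply Rpower_pos|].
        apply (double_resolvent_RInt_approx G kappa HG Hkappa Hres y (/ N) N M s); try easy; lra. }
      right. fold Gy. unfold w.
      replace (Rpower s (q - 1 - 1)) with (Rpower s (q - 1) * / s).
      * field. lra.
      * unfold Rminus at 2. rewrite (Rpower_plus (q - 1)), Rpower_Ropp, Rpower_1 by lra. easy.
    + apply (@is_RInt_minus X); [now apply (@RInt_correct X)|exact HCy].
    + apply (@is_RInt_plus R_CompleteNormedModule);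
      apply (@is_RInt_scal R_CompleteNormedModule); apply is_RInt_Rpower; lra.
  - unfold bnd. rewrite !Rpower_inv_base by lra. replace (- (q - 1)) with (1 - q) by ring.
    pose proof (Rpower_pos N (- q)) as P1. pose proof (Rpower_pos N (q - 1)) as P2.
    assert (Q1 : Rpower N q = N * Rpower N (q - 1)).
    { rewrite <- (Rpower_1 N) at 2 by lra. rewrite <- Rpower_plus. f_equal; ring. }
    assert (Q2 : Rpower N (1 - q) = N * Rpower N (- q)).
    { rewrite <- (Rpower_1 N) at 2 by lra. rewrite <- Rpower_plus. f_equal; ring. }
    rewrite Q1, Q2. apply Rplus_le_compat.
    + replace (/ N * M * ((N * Rpower N (q - 1) - Rpower N (- q)) / q))
        with (M * ((Rpower N (q - 1) - / N * Rpower N (- q)) / q)) by (field; lra).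
      apply Rmult_le_compat_l; [easy|].
      apply Rmult_le_compat_r; [left; apply Rinv_0_lt_compat; lra|]. nra.
    + replace (Gy * / N * ((Rpower N (q - 1) - N * Rpower N (- q)) / (q - 1)))
        with (Gy * ((Rpower N (- q) - / N * Rpower N (q - 1)) / (1 - q))) by (field; lra).
      apply Rmult_le_compat_l; [easy|].
      apply Rmult_le_compat_r; [left; apply Rinv_0_lt_compat; lra|]. nra. }
assert (Hy : / 3 * norm y <= norm (scal C y)).
{ replace y with (scal (/ C) (scal C y)) at 1 by (vfield; lra).
  apply Rle_trans with (/ 3 * (/ C * norm (scal C y))).
  - apply Rmult_le_compat_l; [lra|]. apply norm_scal_pos_le. left; apply Rinv_0_lt_compat; lra.
  - assert (/ C <= 3) by (rewrite <- (Rinv_inv 3); apply Rinv_le_contravar; lra).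
    pose proof (norm_nonneg (scal C y)). nra. }
pose proof (norm_le_norm_minus (scal C y) (RInt (fun s => scal (w s) (inner s)) (/ N) N)).
eapply Rle_trans; [exact Hy|]. eapply Rle_trans; [exact H|]. now apply Rplus_le_compat_l.
Qed.

(** The truncated composition of powers differs from [cq] times the double integral by
    the integral of [kernel_slice_approx]; all error terms are collected in one. *)
Lemma truncated_inverse_estimate (N : R) : 2 <= N -> / N <= beta <= N ->
  cq * (/ 3 * norm y) <=
  D * (/ q + / (1 - q)) * Rpower beta (- q) * norm z +
  (2 * (D * ((1 + kappa) * norm x / q + kappa * norm (G x) / (1 - q) / beta))
    + (D / beta * norm x / q + kappa * norm (G y) / (1 - q)))
  * ((Rpower N (- q) + Rpower N (q - 1)) * (1 + ln N)).
Proof.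
intros HN HNb.
assert (HN' : 0 < / N) by (apply Rinv_0_lt_compat; lra).
assert (HNN : / N <= / 2) by (apply Rinv_le_contravar; lra).
destruct (sin_coef_bounds q Hq) as [Hc0 Hc1]. fold cq in Hc0, Hc1.
destruct (double_resolvent_lipschitz G kappa HG Hkappa Hres y (/ N / 2) (/ N / 2))
  as [L [HL [HL1 HL2]]]; [lra|lra|].
assert (B1 := truncated_kernel_bound N L HN HL HL1 HL2).
assert (B2 := truncated_composition_bound N HNb ltac:(lra)).
assert (Hslice : ex_RInt (kernel_slice N) (/ N) N).
{ unfold kernel_slice.
  apply (outer_ex_RInt w (double_resolvent G y) (/ N / 2) (/ N / 2) (/ N) N L (Rpower N (1 - q)));
  try assumption; try lra.
  - intros s Hs. apply continuous_Rpower. lra.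
  - intros s Hs. rewrite Rabs_pos_eq by (left; apply Rpower_pos). unfold w.
    replace (q - 1) with (- (1 - q)) by ring. rewrite <- Rpower_inv_base by lra.
    apply Rle_Rpower_l; [lra|]. split; [apply Rinv_0_lt_compat; lra|].
    rewrite <- (Rinv_inv N). apply Rinv_le_contravar; lra. }
set (I := RInt (balakrishnan G (1 - q) (R_ beta z)) (/ N) N) in *.
set (S := RInt (kernel_slice N) (/ N) N) in *.
set (E1 := D * ((1 + kappa) * norm x * (Rpower N (- q) / q)
       + kappa * norm (G x) * (Rpower N (q - 1) / (1 - q)) / beta)).
assert (B3 : norm (minus I (scal cq S)) <= E1 * (2 * ln N)).
{ apply (norm_RInt_le
    (fun t => minus (balakrishnan G (1 - q) (R_ beta z) t) (scal cq (kernel_slice N t)))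
    (fun t => E1 * / t) (/ N) N); [lra| | |].
  - intros t Ht. apply kernel_slice_approx; lra.
  - apply (@is_RInt_minus X).
    + apply (@RInt_correct X), ex_RInt_pos; [|lra|lra].
      intros s Hs. now apply (balakrishnan_continuous G kappa).
    + apply (@is_RInt_scal X), (@RInt_correct X), Hslice.
  - apply (@is_RInt_scal R_CompleteNormedModule).
    replace (2 * ln N) with (minus (ln N) (ln (/ N)))
      by (rewrite ln_Rinv by lra; unfold minus, plus, opp; simpl; ring).
    apply (@is_RInt_derive R_CompleteNormedModule ln Rinv).
    + intros t Ht. rewrite Rmin_left in Ht by lra. apply is_derive_Reals.
      apply derivable_pt_lim_ln. lra.
    + intros t Ht. rewrite Rmin_left in Ht by lra.
      apply (ex_derive_continuous Rinv). auto_derive. lra. }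
assert (B4 : cq * norm S <= norm I + E1 * (2 * ln N)).
{ apply Rle_trans with (norm (scal cq S)).
  - replace S with (scal (/ cq) (scal cq S)) at 1 by (vfield; lra).
    apply Rle_trans with (cq * (/ cq * norm (scal cq S))); [|right; field; lra].
    apply Rmult_le_compat_l; [lra|]. apply norm_scal_pos_le. left; now apply Rinv_0_lt_compat.
  - pose proof (norm_le_norm_minus (scal cq S) I). lra. }
set (E2 := D / beta * norm x * (Rpower N (q - 1) / q)
       + kappa * norm (G y) * (Rpower N (- q) / (1 - q))) in *.
assert (HE2 : 0 <= E2).
{ unfold E2, D. pose proof (norm_nonneg x). pose proof (norm_nonneg (G y)).
  apply Rplus_le_le_0_compat; repeat apply Rmult_le_pos; try lra;
  try (left; apply Rinv_0_lt_compat; lra); left; apply Rpower_pos. }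
apply Rle_trans with (norm I + (E1 * (2 * ln N) + E2)).
- apply (Rmult_le_compat_l cq) in B1; [|lra]. nra.
- apply Rplus_le_compat; [exact B2|].
  set (p1 := Rpower N (- q)). set (p2 := Rpower N (q - 1)).
  assert (P1 : 0 < p1) by apply Rpower_pos. assert (P2 : 0 < p2) by apply Rpower_pos.
  assert (Hln : 0 <= ln N) by (rewrite <- ln_1; apply ln_le; lra).
  set (A1 := D * ((1 + kappa) * norm x / q)). set (A2 := D * (kappa * norm (G x) / (1 - q) / beta)).
  set (A3 := D / beta * norm x / q). set (A4 := kappa * norm (G y) / (1 - q)).
  assert (HD : 0 < D) by (unfold D; apply Rmult_lt_0_compat; lra).
  assert (HA : 0 <= A1 /\ 0 <= A2 /\ 0 <= A3 /\ 0 <= A4).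
  { pose proof (norm_nonneg x). pose proof (norm_nonneg (G y)). pose proof (norm_nonneg (G x)).
    assert (0 < / beta) by now apply Rinv_0_lt_compat.
    assert (0 < / q) by (apply Rinv_0_lt_compat; lra).
    assert (0 < / (1 - q)) by (apply Rinv_0_lt_compat; lra).
    unfold A1, A2, A3, A4, Rdiv. repeat split; repeat apply Rmult_le_pos; lra. }
  replace E1 with (A1 * p1 + A2 * p2) by (unfold E1, A1, A2, p1, p2; field; lra).
  replace E2 with (A3 * p2 + A4 * p1) by (unfold E2, A3, A4, p1, p2; field; lra).
  replace (D * ((1 + kappa) * norm x / q + kappa * norm (G x) / (1 - q) / beta))
    with (A1 + A2) by (unfold A1, A2; ring).
  set (l := ln N) in *. clearbody p1 p2 l A1 A2 A3 A4. clear - P1 P2 Hln HA.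
  destruct HA as [H1 [H2 [H3 H4]]].
  assert (0 <= A1 * p1) by (apply Rmult_le_pos; lra).
  assert (0 <= A1 * p2) by (apply Rmult_le_pos; lra).
  assert (0 <= A2 * p1) by (apply Rmult_le_pos; lra).
  assert (0 <= A2 * p2) by (apply Rmult_le_pos; lra).
  assert (0 <= A3 * p1) by (apply Rmult_le_pos; lra).
  assert (0 <= A3 * p2) by (apply Rmult_le_pos; lra).
  assert (0 <= A4 * p1) by (apply Rmult_le_pos; lra).
  assert (0 <= A4 * p2) by (apply Rmult_le_pos; lra).
  apply Rle_trans with (2 * (A1 * p1 + A2 * p2) * (1 + l) + (A3 * p2 + A4 * p1) * (1 + l)); [nra|].
  assert (Hs : 2 * (A1 * p1 + A2 * p2) + (A3 * p2 + A4 * p1)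
               <= (2 * (A1 + A2) + (A3 + A4)) * (p1 + p2)) by lra.
  apply (Rmult_le_compat_r (1 + l)) in Hs; lra.
Qed.

(** Letting [N] tend to infinity in [truncated_inverse_estimate]. *)
Lemma high_inverse_estimate_at :
  norm (high G beta x) <=
  3 / cq * (D * (/ q + / (1 - q))) * Rpower beta (- q) * norm (frac_pow01 G q x).
Proof.
fold y z. destruct (sin_coef_bounds q Hq) as [Hc0 Hc1]. fold cq in Hc0, Hc1.
assert (HD : 0 < D) by (unfold D; apply Rmult_lt_0_compat; lra).
set (A := D * (/ q + / (1 - q)) * Rpower beta (- q) * norm z).
assert (H : cq * (/ 3 * norm y) <= A).
{ apply le_epsilon. intros eps Heps.
  set (E := 2 * (D * ((1 + kappa) * norm x / q + kappa * norm (G x) / (1 - q) / beta))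
    + (D / beta * norm x / q + kappa * norm (G y) / (1 - q))).
  assert (HE : 0 <= E).
  { pose proof (norm_nonneg x). pose proof (norm_nonneg (G y)). pose proof (norm_nonneg (G x)).
    assert (0 < / beta) by now apply Rinv_0_lt_compat.
    assert (0 < / q) by (apply Rinv_0_lt_compat; lra).
    assert (0 < / (1 - q)) by (apply Rinv_0_lt_compat; lra).
    unfold E, Rdiv. repeat first [apply Rplus_le_le_0_compat | apply Rmult_le_pos]; lra. }
  destruct (Rpower_log_vanishes q E eps (Rmax 2 (Rmax beta (/ beta))) Hq HE Heps)
    as [N [HN0 [HN1 HN2]]].
  pose proof (Rmax_l 2 (Rmax beta (/ beta))). pose proof (Rmax_r 2 (Rmax beta (/ beta))).
  pose proof (Rmax_l beta (/ beta)). pose proof (Rmax_r beta (/ beta)).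
  assert (HNb : / N <= beta).
  { rewrite <- (Rinv_inv beta). apply Rinv_le_contravar; [now apply Rinv_0_lt_compat|lra]. }
  eapply Rle_trans; [apply (truncated_inverse_estimate N); lra|].
  apply Rplus_le_compat_l. exact HN2. }
apply (Rmult_le_compat_l (3 / cq)) in H; [|left; apply Rdiv_lt_0_compat; lra].
replace (3 / cq * (cq * (/ 3 * norm y))) with (norm y) in H by (field; lra).
eapply Rle_trans; [exact H|]. right. unfold A. ring.
Qed.

End InverseEstimate.

(** * Low and high parts of an element *)

Section Decomposition.

Context {X : Banach} (G : X -> X) (kappa : R).
Context (HG : is_linear G) (Hkappa : 0 < kappa).
Context (Hres : nonneg_type_with G kappa).

Local Notation R_ := (resolvent G).

Lemma high_inverse_estimate (q : R) : 0 < q < 1 ->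
  exists C, 0 < C /\ forall beta x, 0 < beta ->
    norm (high G beta x) <= C * Rpower beta (- q) * norm (frac_pow01 G q x).
Proof.
intros Hq. destruct (sin_coef_bounds q Hq) as [Hc0 _].
exists (3 / (sin (PI * q) / PI) * (kappa * (1 + kappa) * (/ q + / (1 - q)))). split.
- assert (0 < / q) by (apply Rinv_0_lt_compat; lra).
  assert (0 < / (1 - q)) by (apply Rinv_0_lt_compat; lra).
  apply Rmult_lt_0_compat; [apply Rdiv_lt_0_compat; lra|].
  repeat apply Rmult_lt_0_compat; lra.
- intros beta x Hb. now apply high_inverse_estimate_at.
Qed.

Lemma iter_high_resolvent (n : nat) (beta : R) (x : X) : 0 < beta ->
  Nat.iter n (high G beta) x = Nat.iter n (R_ beta) (Nat.iter n G x).
Proof.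
intros Hb. induction n as [|n IH]; simpl; [easy|]. rewrite IH.
unfold high. rewrite <- (resolvent_comm_G G kappa HG Hres) by easy. f_equal.
symmetry. apply iter_comm. intros y. now apply (resolvent_comm_G G kappa HG Hres).
Qed.

Lemma iter_resolvent_bound (n : nat) (beta : R) (x : X) : 0 < beta ->
  norm (Nat.iter n (R_ beta) x) <= (kappa / beta) ^ n * norm x.
Proof.
intros Hb. induction n as [|n IH]; simpl; [lra|].
eapply Rle_trans; [now apply (resolvent_bound G kappa Hres)|]. rewrite Rmult_assoc.
apply Rmult_le_compat_l; [left; now apply Rdiv_lt_0_compat|easy].
Qed.

(** Each integer power of [G] in [(high beta)^(n+1)] is traded for [kappa / beta]; the
    last factor [high beta] absorbs the fractional part of [a]. *)
Lemma iter_high_inverse_estimate (a : R) : 0 <= a ->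
  exists C, 0 < C /\ forall beta x, 0 < beta ->
    norm (Nat.iter (S (Z.to_nat (Int_part a))) (high G beta) x)
    <= C * Rpower beta (- a) * norm (frac_pow G a x).
Proof.
intros Ha. destruct (floor_decomposition a Ha) as [Hdec Hf].
set (n := Z.to_nat (Int_part a)) in *. set (q := frac_part a) in *.
assert (Hn : forall beta x, 0 < beta -> norm (Nat.iter (S n) (high G beta) x)
   <= (kappa / beta) ^ n * norm (high G beta (Nat.iter n G x))).
{ intros beta x Hb. simpl. rewrite iter_high_resolvent by easy.
  rewrite <- (iter_comm (R_ beta) (high G beta)).
  - now apply iter_resolvent_bound.
  - intros y. apply (resolvent_comm_op G kappa Hres); [easy|now apply (high_linear G kappa)|].
    intros v. now apply (high_comm_G G kappa HG Hres). }
assert (Hpow : forall beta, 0 < beta ->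
  (kappa / beta) ^ n * Rpower beta (- q) = kappa ^ n * Rpower beta (- a)).
{ intros beta Hb. rewrite Hdec, Ropp_plus_distr, Rpower_plus.
  rewrite (Rpower_Ropp _ (INR n)), Rpower_pow by easy.
  unfold Rdiv. rewrite Rpow_mult_distr, pow_inv. ring. }
assert (Hk : 0 < kappa ^ n) by (apply pow_lt; lra).
assert (Hkb : forall beta, 0 < beta -> 0 < (kappa / beta) ^ n).
{ intros beta Hb. apply pow_lt. now apply Rdiv_lt_0_compat. }
unfold frac_pow. fold n q. destruct (Req_EM_T q 0) as [Hq|Hq].
- exists (kappa ^ n * (1 + kappa)). split; [apply Rmult_lt_0_compat; lra|].
  intros beta x Hb. eapply Rle_trans; [now apply Hn|].
  specialize (Hpow beta Hb). specialize (Hkb beta Hb).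
  rewrite Hq, Ropp_0, Rpower_O, Rmult_1_r in Hpow by easy.
  apply Rle_trans with ((kappa / beta) ^ n * ((1 + kappa) * norm (Nat.iter n G x))).
  + apply Rmult_le_compat_l; [lra|]. now apply (high_bound G kappa Hres).
  + rewrite Hpow. right. ring.
- destruct (high_inverse_estimate q) as [C [HC HC']]; [lra|].
  exists (kappa ^ n * C). split; [now apply Rmult_lt_0_compat|].
  intros beta x Hb. eapply Rle_trans; [now apply Hn|].
  specialize (Hpow beta Hb). specialize (Hkb beta Hb).
  eapply Rle_trans.
  { apply Rmult_le_compat_l; [lra|]. now apply HC'. }
  right. transitivity ((kappa / beta) ^ n * Rpower beta (- q) * C
    * norm (frac_pow01 G q (Nat.iter n G x))); [ring|]. rewrite Hpow. ring.
Qed.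

(** A telescoping sum of terms [(high beta)^j (low beta) (G w)], each of which contains
    [G (low beta) = beta (high beta)]. *)
Lemma high_remainder_bound (n : nat) :
  exists C, 0 <= C /\ forall beta w, 0 < beta ->
    norm (minus (G w) (Nat.iter n (high G beta) (G w))) <= C * (beta * norm w).
Proof.
induction n as [|n [C [HC IH]]].
- exists 0. split; [lra|]. intros beta w Hb. simpl.
  norm_as (@zero X); [|vring]. right. rewrite Rmult_0_l. exact norm_0.
- exists (C + (1 + kappa) ^ n * (1 + kappa)). split.
  { pose proof (pow_lt (1 + kappa) n). nra. }
  intros beta w Hb.
  eapply Rle_trans; [apply (norm_minus_triangle _ (Nat.iter n (high G beta) (G w)))|].
  rewrite Rmult_plus_distr_r. apply Rplus_le_compat; [now apply IH|].
  assert (Hlin : is_linear (Nat.iter n (high G beta))).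
  { apply iter_linear. now apply (high_linear G kappa). }
  assert (Hs : Nat.iter (S n) (high G beta) (G w) = Nat.iter n (high G beta) (high G beta (G w))).
  { simpl. symmetry. now apply iter_comm. }
  rewrite Hs.
  assert (Hd : minus (Nat.iter n (high G beta) (G w)) (Nat.iter n (high G beta) (high G beta (G w)))
    = Nat.iter n (high G beta) (low G beta (G w))).
  { refine (eq_trans (eq_sym (linear_minus _ _ _ Hlin)) _). f_equal.
    rewrite <- (low_plus_high G kappa Hres beta (G w) Hb) at 1. vring. }
  rewrite Hd. eapply Rle_trans; [now apply (iter_high_bound G kappa Hkappa Hres)|].
  rewrite (low_comm_G G kappa HG Hres), (G_low G HG) by easy.
  rewrite Rmult_assoc. apply Rmult_le_compat_l; [apply pow_le; lra|].
  eapply Rle_trans; [apply norm_scal_pos_le; lra|].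
  pose proof (high_bound G kappa Hres beta w Hb). nra.
Qed.

(** A telescoping sum again: [x - low beta x = G (G + beta)^-1 x], and the preimage
    [(G + beta)^-1 x] is [low beta x / beta]. *)
Lemma low_remainder_preimage (n : nat) :
  exists C, 0 <= C /\ forall beta e, 0 < beta ->
    exists rho, G rho = minus e (Nat.iter n (low G beta) e) /\
      beta * norm rho <= C * norm (low G beta e).
Proof.
induction n as [|n [C [HC IH]]].
- exists 0. split; [lra|]. intros beta e Hb. exists zero. split.
  + refine (eq_trans (linear_zero G HG) _). simpl. vring.
  + rewrite norm_0. lra.
- exists (C + kappa ^ n). split; [pose proof (pow_lt kappa n Hkappa); lra|].
  intros beta e Hb. destruct (IH beta e Hb) as [rho [Hrho Hn]].
  set (y := Nat.iter n (low G beta) e) in *.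
  exists (plus rho (R_ beta y)). split.
  + rewrite (linear_plus G HG), Hrho. simpl. fold y.
    change (G (R_ beta y)) with (high G beta y).
    rewrite <- (low_plus_high G kappa Hres beta y Hb) at 1. vring.
  + assert (Hy : beta * norm (R_ beta y) <= kappa ^ n * norm (low G beta e)).
    { replace (R_ beta y) with (scal (/ beta) (low G beta y)) by (unfold low; vfield; lra).
      apply Rle_trans with (norm (low G beta y)).
      - apply Rle_trans with (beta * (/ beta * norm (low G beta y))); [|right; field; lra].
        apply Rmult_le_compat_l; [lra|]. apply norm_scal_pos_le. left; now apply Rinv_0_lt_compat.
      - unfold y. rewrite <- (iter_comm (low G beta) (low G beta)) by easy.
        now apply (iter_low_bound G kappa Hkappa Hres). }
    eapply Rle_trans; [apply Rmult_le_compat_l; [lra|apply norm_plus_le]|]. lra.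
Qed.

End Decomposition.

(** * The Tikhonov functional and the discrepancy principle *)

Lemma rpow_pos (x r : R) : 0 < x -> rpow x r = Rpower x r.
Proof. intros Hx. unfold rpow. destruct (Req_EM_T x 0); [lra|easy]. Qed.

Lemma rpow_nonneg (x r : R) : 0 <= rpow x r.
Proof. unfold rpow. destruct (Req_EM_T x 0); [lra|]. left; apply Rpower_pos. Qed.

Lemma rpow_le (x y r : R) : 0 < r -> 0 <= x <= y -> rpow x r <= rpow y r.
Proof.
intros Hr [Hx Hxy]. unfold rpow at 1. destruct (Req_EM_T x 0) as [->|Hx0].
- apply rpow_nonneg.
- rewrite rpow_pos by lra. apply Rle_Rpower_l; lra.
Qed.

Lemma rpow_le_inv (x y C r : R) : 0 < r -> 0 <= x -> 0 <= y -> 0 < C ->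
  rpow x r <= C * rpow y r -> x <= Rpower C (/ r) * y.
Proof.
intros Hr Hx Hy HC H. assert (HCp := Rpower_pos C (/ r)).
destruct (Req_dec x 0) as [->|Hx0]; [nra|].
rewrite rpow_pos in H by lra. assert (Hxp := Rpower_pos x r).
destruct (Req_dec y 0) as [->|Hy0].
- unfold rpow in H. destruct (Req_EM_T 0 0); lra.
- rewrite rpow_pos in H by lra. apply Rnot_lt_le. intros Hlt.
  assert (Hlt' : Rpower (Rpower C (/ r) * y) r < Rpower x r).
  { apply Rlt_Rpower_l; [easy|]. split; [apply Rmult_lt_0_compat; lra|easy]. }
  rewrite <- Rpower_mult_distr, Rpower_mult, Rinv_l, Rpower_1 in Hlt' by lra. lra.
Qed.

Section Scale.

Context {X : Banach} (G : X -> X) (HG : is_linear G).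
Context (Hinj : forall u v, G u = G v -> u = v).

Lemma gpow_nonneg (a : R) (u : X) : 0 <= a -> gpow G a u = frac_pow G a u.
Proof. intros Ha. unfold gpow. destruct (Rle_dec 0 a); [easy|lra]. Qed.

Lemma in_scale_1 (u : X) : in_scale G 1 u <-> exists w, G w = u.
Proof.
unfold in_scale. split.
- intros H. destruct (H Rlt_0_1) as [w Hw]. exists w.
  rewrite gpow_nonneg, frac_pow_1 in Hw by lra. easy.
- intros [w Hw] _. exists w. rewrite gpow_nonneg, frac_pow_1 by lra. easy.
Qed.

Lemma scale_norm_1 (w : X) : scale_norm G 1 (G w) = norm w.
Proof.
unfold scale_norm, gpow. destruct (Rle_dec 0 (- (1))) as [H|_]; [lra|].
rewrite Ropp_involutive. f_equal. unfold inv_op. apply iota_unique.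
- intros v Hv. rewrite frac_pow_1 in Hv. now apply Hinj.
- apply frac_pow_1.
Qed.

Lemma scale_norm_neg (a : R) (u : X) : 0 < a -> scale_norm G (- a) u = norm (frac_pow G a u).
Proof. intros Ha. unfold scale_norm. now rewrite Ropp_involutive, gpow_nonneg by lra. Qed.

End Scale.

Lemma e_const_ge_1 (r : R) : 0 < r -> 1 <= e_const r.
Proof.
intros Hr. unfold e_const. destruct (Rle_dec 1 r) as [H|H]; [lra|].
apply Rle_trans with (Rpower 2 0); [right; symmetry; apply Rpower_O; lra|].
apply Rle_Rpower; [lra|].
assert (1 < / r) by (rewrite <- Rinv_1; apply Rinv_lt_contravar; lra). unfold Rdiv. lra.
Qed.

Section Discrepancy.

Context {X Y : Banach} (G : X -> X) (DF : X -> Prop) (F : X -> Y).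
Context (HG : is_linear G) (Hinj : forall u v, G u = G v -> u = v).
Context (r b b' c : R) (Hr : 0 < r) (Hb' : 0 < b') (Hbb : b' < b) (Hc : 1 < c).

Lemma tikhonov_in_D (ubar u : X) (f : Y) (al : R) : in_D G DF u ->
  tikhonov G F r ubar f al u =
  Finite (rpow (norm (minus (F u) f)) r + al * rpow (scale_norm G 1 (minus u ubar)) r).
Proof.
intros [_ Hu]. unfold tikhonov. now destruct (excluded_middle_informative (in_scale G 1 u)).
Qed.

(** At the comparison parameter [gam] the residual is at least [b delta], while that of
    [uhat] is at most [b' delta]; minimality therefore forces [delta^r] to be at most a
    multiple of [gam] times the penalty of [uhat].  Inserted into the minimality at
    [al >= gam / c], this bounds the penalty of the regularized solution.  If the initial
    guess is accepted, its penalty is zero. *)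
Lemma discrepancy_penalty_bound :
  exists C, 0 < C /\ forall (ubar : X) (f : Y) (delta : R) (u : R -> X) (alpha : Rbar) (uhat : X),
    0 < delta -> in_D G DF ubar ->
    (forall al, 0 < al -> is_minimizer G DF F r ubar f al (u al)) ->
    discrepancy_principle F b c ubar delta f u alpha ->
    in_D G DF (reg_solution ubar u alpha) /\
    norm (minus (F (reg_solution ubar u alpha)) f) <= b * delta /\
    (in_D G DF uhat -> norm (minus (F uhat) f) <= b' * delta ->
     scale_norm G 1 (minus (reg_solution ubar u alpha) ubar)
     <= C * scale_norm G 1 (minus uhat ubar)).
Proof.
assert (Hgap : 0 < Rpower b r - Rpower b' r).
{ assert (Rpower b' r < Rpower b r) by (apply Rlt_Rpower_l; lra). lra. }
assert (Hb'r := Rpower_pos b' r).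
set (q := Rpower b' r / (Rpower b r - Rpower b' r)).
assert (Hq : 0 < q) by now apply Rdiv_lt_0_compat.
assert (HC : 0 < 1 + q * c) by (pose proof (Rmult_lt_0_compat q c); lra).
exists (Rpower (1 + q * c) (/ r)). split; [apply Rpower_pos|].
intros ubar f delta u alpha uhat Hd Hubar Hmin [Hinf Hfin].
destruct (Rle_dec (norm (minus (F ubar) f)) (b * delta)) as [Hle|Hgt].
- rewrite (Hinf Hle). simpl. split; [easy|]. split; [easy|]. intros _ _.
  replace (minus ubar ubar) with (G zero) by (refine (eq_trans (linear_zero G HG) _); vring).
  rewrite scale_norm_1 by easy. rewrite norm_0.
  apply Rmult_le_pos; [left; apply Rpower_pos|apply norm_nonneg].
- destruct Hfin as [al [-> [Hal [Hdis [gam [Hgam Hgd]]]]]]; [lra|]. simpl.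
  destruct (Hmin al Hal) as [HDal Hmal]. split; [easy|]. split; [easy|].
  intros HDhat Hhat.
  assert (Hg0 : 0 < gam) by lra.
  destruct (Hmin gam Hg0) as [HDg Hmg].
  assert (Hcal := Hmal uhat (proj1 HDhat)). assert (Hcg := Hmg uhat (proj1 HDhat)).
  rewrite !tikhonov_in_D in Hcal by easy. rewrite !tikhonov_in_D in Hcg by easy.
  simpl in Hcal, Hcg.
  assert (Hdr := Rpower_pos delta r).
  assert (Hr1 : rpow (norm (minus (F uhat) f)) r <= Rpower b' r * Rpower delta r).
  { rewrite Rpower_mult_distr by lra. rewrite <- rpow_pos by (apply Rmult_lt_0_compat; lra).
    apply rpow_le; [easy|]. split; [apply norm_nonneg|easy]. }
  assert (Hr2 : Rpower b r * Rpower delta r <= rpow (norm (minus (F (u gam)) f)) r).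
  { rewrite Rpower_mult_distr by lra. rewrite <- rpow_pos by (apply Rmult_lt_0_compat; lra).
    apply rpow_le; [easy|]. split; [apply Rmult_le_pos; lra|easy]. }
  assert (Hn0 : 0 <= rpow (norm (minus (F (u al)) f)) r) by apply rpow_nonneg.
  assert (Hn1 : 0 <= rpow (scale_norm G 1 (minus (u gam) ubar)) r) by apply rpow_nonneg.
  assert (Hn2 : 0 <= rpow (scale_norm G 1 (minus uhat ubar)) r) by apply rpow_nonneg.
  apply rpow_le_inv; [easy|apply norm_nonneg|apply norm_nonneg|easy|].
  set (Nal := rpow (scale_norm G 1 (minus (u al) ubar)) r) in *.
  set (Ng := rpow (scale_norm G 1 (minus (u gam) ubar)) r) in *.
  set (Nh := rpow (scale_norm G 1 (minus uhat ubar)) r) in *.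
  (* minimality at gam, and gam <= c * al *)
  assert (H1 : (Rpower b r - Rpower b' r) * Rpower delta r <= c * al * Nh).
  { apply Rle_trans with (gam * Nh); [nra|]. apply Rmult_le_compat_r; lra. }
  assert (H2 : al * Nal <= Rpower b' r * Rpower delta r + al * Nh) by lra.
  assert (H3 : Rpower b' r * Rpower delta r <= q * (c * al * Nh)).
  { apply Rle_trans with (q * ((Rpower b r - Rpower b' r) * Rpower delta r)).
    - right. unfold q. field. lra.
    - apply Rmult_le_compat_l; lra. }
  apply (Rmult_le_reg_l al); [easy|]. lra.
Qed.

End Discrepancy.

(** * The error bound *)

Section ErrorBound.

Context {X Y : Banach} (G : X -> X) (kappa : R).
Context (HG : is_linear G) (Hinj : forall u v, G u = G v -> u = v) (Hkappa : 0 < kappa).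
Context (Hres : nonneg_type_with G kappa).
Context (DF : X -> Prop) (F : X -> Y) (fdag : Y) (udag ubar : X).
Context (a c_a C_a c0 c1 r b c : R).
Context (fd : R -> Y) (ud : R -> R -> X) (alpha : R -> Rbar).
Context (Hint : locally udag DF).
Context (Hfd : forall delta, 0 < delta -> norm (minus (fd delta) fdag) <= delta).
Context (Hubar : in_D G DF ubar).
Context (Ha : 0 < a) (Hca : 0 < c_a) (HCa : c_a <= C_a) (Hc0 : 0 < c0) (Hc1 : 0 < c1).
Context (Hup : forall u, in_D G DF u -> scale_norm G (- a) (minus u udag) <= c0 ->
     norm (minus (F u) fdag) <= C_a * scale_norm G (- a) (minus u udag)).
Context (Hlo : forall u, in_D G DF u -> norm (minus (F u) fdag) <= c1 ->
     c_a * scale_norm G (- a) (minus u udag) <= norm (minus (F u) fdag)).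
Context (Hr : 0 < r) (Hb : 1 < b) (Hc : 1 < c).
Context (Hmin : forall delta al, 0 < delta -> 0 < al ->
     is_minimizer G DF F r ubar (fd delta) al (ud delta al)).
Context (Hdis : forall delta, 0 < delta ->
     discrepancy_principle F b c ubar delta (fd delta) (ud delta) (alpha delta)).

Let n : nat := Z.to_nat (Int_part a).
Let e : X := minus ubar udag.
Let smooth (beta : R) : X := Nat.iter (S (S n)) (low G beta) e.
Let uhat (beta : R) : X := plus udag (smooth beta).
Let err (delta : R) : R :=
  norm (minus (reg_solution ubar (ud delta) (alpha delta)) udag).

Lemma smooth_bound (beta : R) : 0 < beta ->
  norm (smooth beta) <= kappa ^ S n * norm (low G beta e).
Proof.
intros Hbeta. unfold smooth. simpl Nat.iter.
change (low G beta (Nat.iter n (low G beta) e)) with (Nat.iter (S n) (low G beta) e).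
rewrite <- (iter_comm (low G beta) (low G beta)) by easy.
now apply (iter_low_bound G kappa Hkappa Hres).
Qed.

(** One of the [n + 2] factors [low beta] is kept for [eta], the others pay for [G^a]. *)
Lemma smooth_weak_bound :
  exists C, 0 < C /\ forall beta, 0 < beta ->
    norm (frac_pow G a (smooth beta)) <= C * (Rpower beta a * norm (low G beta e)).
Proof.
destruct (frac_pow_iter_low_bound G kappa HG Hkappa Hres a) as [C [HC H]]; [lra|].
exists C. split; [easy|]. intros beta Hbeta. rewrite <- Rmult_assoc.
unfold smooth. change (Nat.iter (S (S n)) (low G beta) e)
  with (low G beta (Nat.iter (S n) (low G beta) e)).
rewrite <- (iter_comm (low G beta) (low G beta)) by easy. now apply H.
Qed.

Lemma uhat_penalty :
  exists C, 0 <= C /\ forall beta, 0 < beta ->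
    exists rho, G rho = minus (uhat beta) ubar /\ beta * norm rho <= C * norm (low G beta e).
Proof.
destruct (low_remainder_preimage G kappa HG Hkappa Hres (S (S n))) as [C [HC H]].
exists C. split; [easy|]. intros beta Hbeta.
destruct (H beta e Hbeta) as [rho [Hrho Hn]].
exists (opp rho). split.
- refine (eq_trans (linear_opp G rho HG) _). rewrite Hrho.
  unfold uhat, smooth. set (s := Nat.iter _ _ e). unfold e. vring.
- rewrite (@norm_opp R_AbsRing X rho : norm (opp rho) = norm rho). exact Hn.
Qed.

(** The difference to the auxiliary element is estimated twice: in the strong norm through
    the penalty, and in the weak norm through the data.  The decomposition into high and
    low parts with the same [beta] replaces an interpolation inequality. *)
Lemma error_bound :
  exists K e0 h0 d0, 0 < K /\ 0 < e0 /\ 0 < h0 /\ 0 < d0 /\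
  forall delta beta, 0 < delta < d0 -> 0 < beta ->
    norm (low G beta e) <= h0 ->
    Rpower beta a * norm (low G beta e) <= e0 * delta ->
    err delta <= K * (norm (low G beta e) + Rpower beta (- a) * delta).
Proof.
set (b' := (1 + b) / 2).
destruct (discrepancy_penalty_bound G DF F HG Hinj r b b' c) as [Cr [HCr Hpen]];
  [easy|unfold b'; lra|unfold b'; lra|easy|].
destruct smooth_weak_bound as [CA [HCA HA]].
destruct uhat_penalty as [CP [HCP HP]].
destruct (iter_high_inverse_estimate G kappa HG Hkappa Hres a) as [CB [HCB HB]]; [lra|].
destruct (high_remainder_bound G kappa HG Hkappa Hres (S n)) as [CR [HCR HR]].
assert (HCa0 : 0 < C_a) by lra.
destruct Hint as [rad Hrad]. assert (Hrad0 := cond_pos rad).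
assert (Hkn : 0 < kappa ^ S n) by (apply pow_lt; lra).
(* e0 makes the weak distance of uhat small enough for the fit, h0 keeps uhat in the
   domain of F, and d0 brings both weak distances into the range of the conditions on F *)
set (e0 := (b' - 1) / (C_a * CA)).
assert (He0 : 0 < e0).
{ apply Rdiv_lt_0_compat; [unfold b'; lra|]. now apply Rmult_lt_0_compat. }
set (h0 := rad / (kappa ^ S n + 1)).
assert (Hh0 : 0 < h0) by (apply Rdiv_lt_0_compat; lra).
set (d0 := Rmin (c1 / (b + 1)) (c0 / (CA * e0))).
assert (HCAe : 0 < CA * e0) by now apply Rmult_lt_0_compat.
assert (Hd0 : 0 < d0) by (apply Rmin_pos; apply Rdiv_lt_0_compat; lra).
set (K := CB * ((b + 1) / c_a + CA * e0) + CR * ((Cr + 1) * CP) + kappa ^ S n).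
assert (Hbc : 0 < (b + 1) / c_a) by (apply Rdiv_lt_0_compat; lra).
assert (HK1 : 0 < CB * ((b + 1) / c_a + CA * e0)) by (apply Rmult_lt_0_compat; lra).
assert (HK2 : 0 <= CR * ((Cr + 1) * CP)) by (repeat apply Rmult_le_pos; lra).
exists K, e0, h0, d0. split; [unfold K; lra|]. repeat (split; [easy|]).
intros delta beta [Hd Hdd0] Hbeta Heta Hdata.
set (eta := norm (low G beta e)) in *.
assert (Heta0 : 0 <= eta) by apply norm_nonneg.
assert (Hsb := smooth_bound beta Hbeta). fold eta in Hsb.
assert (HAb := HA beta Hbeta). fold eta in HAb.
destruct (HP beta Hbeta) as [rho [Hrho Hrhon]]. fold eta in Hrhon.
assert (Hus : minus (uhat beta) udag = smooth beta) by (unfold uhat; vring).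
destruct (proj1 (in_scale_1 G ubar) (proj2 Hubar)) as [w0 Hw0].
assert (HDhat : in_D G DF (uhat beta)).
{ split.
  - apply Hrad, (@norm_compat1 R_AbsRing X).
    change (norm (minus (uhat beta) udag) < rad). rewrite Hus.
    apply Rle_lt_trans with (kappa ^ S n * h0).
    + eapply Rle_trans; [exact Hsb|]. apply Rmult_le_compat_l; lra.
    + unfold h0. apply (Rmult_lt_reg_r (kappa ^ S n + 1)); [lra|].
      replace (kappa ^ S n * (rad / (kappa ^ S n + 1)) * (kappa ^ S n + 1))
        with (kappa ^ S n * rad) by (field; lra). nra.
  - apply in_scale_1. exists (plus w0 rho). refine (eq_trans (linear_plus G HG _ _) _).
    rewrite Hw0, Hrho. vring. }
assert (Hweak : norm (frac_pow G a (smooth beta)) <= CA * e0 * delta).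
{ eapply Rle_trans; [exact HAb|]. rewrite Rmult_assoc. apply Rmult_le_compat_l; lra. }
assert (Hdc0 : CA * e0 * delta <= c0).
{ assert (delta <= c0 / (CA * e0)) by (pose proof (Rmin_r (c1 / (b + 1)) (c0 / (CA * e0))); unfold d0 in *; lra).
  apply Rle_trans with (CA * e0 * (c0 / (CA * e0))); [|right; field; lra].
  apply Rmult_le_compat_l; lra. }
assert (Hdc1 : (b + 1) * delta <= c1).
{ assert (delta <= c1 / (b + 1)) by (pose proof (Rmin_l (c1 / (b + 1)) (c0 / (CA * e0))); unfold d0 in *; lra).
  apply Rle_trans with ((b + 1) * (c1 / (b + 1))); [|right; field; lra].
  apply Rmult_le_compat_l; lra. }
assert (Hnoise := Hfd delta Hd).
assert (Hfit : norm (minus (F (uhat beta)) (fd delta)) <= b' * delta).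
{ eapply Rle_trans; [apply (norm_minus_triangle _ fdag)|].
  rewrite (norm_minus_sym fdag).
  assert (Hs : scale_norm G (- a) (minus (uhat beta) udag) <= CA * e0 * delta).
  { rewrite scale_norm_neg by easy. now rewrite Hus. }
  assert (H1 := Hup (uhat beta) HDhat (Rle_trans _ _ _ Hs Hdc0)).
  assert (H2 : C_a * scale_norm G (- a) (minus (uhat beta) udag) <= (b' - 1) * delta).
  { apply Rle_trans with (C_a * (CA * e0 * delta)); [apply Rmult_le_compat_l; lra|].
    right. unfold e0. field. lra. }
  lra. }
destruct (Hpen ubar (fd delta) delta (ud delta) (alpha delta) (uhat beta) Hd Hubar
  (fun al Hal => Hmin delta al Hd Hal) (Hdis delta Hd)) as [HDreg [Hregfit Hregpen]].
specialize (Hregpen HDhat Hfit).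
unfold err. set (ureg := reg_solution ubar (ud delta) (alpha delta)) in *.
destruct (proj1 (in_scale_1 G ureg) (proj2 HDreg)) as [w1 Hw1].
assert (Hw : norm (minus w1 w0) <= Cr * norm rho).
{ rewrite <- (scale_norm_1 G Hinj rho), <- (scale_norm_1 G Hinj (minus w1 w0)), Hrho.
  replace (G (minus w1 w0)) with (minus ureg ubar); [exact Hregpen|].
  rewrite <- Hw1, <- Hw0. symmetry. exact (linear_minus G w1 w0 HG). }
assert (Hregweak : norm (frac_pow G a (minus ureg udag)) <= (b + 1) / c_a * delta).
{ assert (H1 : norm (minus (F ureg) fdag) <= (b + 1) * delta).
  { eapply Rle_trans; [apply (norm_minus_triangle _ (fd delta))|]. lra. }
  assert (H2 := Hlo ureg HDreg (Rle_trans _ _ _ H1 Hdc1)).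
  rewrite scale_norm_neg in H2 by easy.
  apply (Rmult_le_reg_l c_a); [easy|].
  replace (c_a * ((b + 1) / c_a * delta)) with ((b + 1) * delta) by (field; lra). lra. }
set (v := minus ureg (uhat beta)).
set (w := minus (minus w1 w0) rho).
assert (HGw : G w = v).
{ unfold w. refine (eq_trans (linear_minus G _ _ HG) _).
  rewrite Hrho. replace (G (minus w1 w0)) with (minus ureg ubar).
  - unfold v. vring.
  - rewrite <- Hw1, <- Hw0. symmetry. exact (linear_minus G w1 w0 HG). }
assert (Hwn : beta * norm w <= (Cr + 1) * CP * eta).
{ apply Rle_trans with ((Cr + 1) * (beta * norm rho)).
  - apply Rle_trans with (beta * ((Cr + 1) * norm rho)); [|right; ring].
    apply Rmult_le_compat_l; [lra|]. unfold w.
    eapply Rle_trans; [apply norm_minus_le|]. lra.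
  - rewrite Rmult_assoc. apply Rmult_le_compat_l; lra. }
assert (Hvweak : norm (frac_pow G a v) <= ((b + 1) / c_a + CA * e0) * delta).
{ assert (Hv : frac_pow G a v = minus (frac_pow G a (minus ureg udag)) (frac_pow G a (smooth beta))).
  { symmetry. refine (eq_trans (eq_sym (linear_minus _ _ _
      (frac_pow_linear G kappa HG Hkappa Hres a (Rlt_le _ _ Ha)))) _).
    f_equal. unfold v, uhat. vring. }
  rewrite Hv, Rmult_plus_distr_r. eapply Rle_trans; [apply norm_minus_le|].
  now apply Rplus_le_compat. }
assert (Hpa := Rpower_pos beta (- a)).
assert (Hv1 : norm (Nat.iter (S n) (high G beta) v)
   <= CB * ((b + 1) / c_a + CA * e0) * (Rpower beta (- a) * delta)).
{ eapply Rle_trans; [now apply HB|].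
  apply Rle_trans with (CB * Rpower beta (- a) * (((b + 1) / c_a + CA * e0) * delta)).
  - apply Rmult_le_compat_l; [left; apply Rmult_lt_0_compat; lra|easy].
  - right; ring. }
assert (Hv2 : norm (minus v (Nat.iter (S n) (high G beta) v)) <= CR * ((Cr + 1) * CP) * eta).
{ rewrite <- HGw. eapply Rle_trans; [now apply HR|].
  rewrite (Rmult_assoc CR). apply Rmult_le_compat_l; lra. }
assert (Hv : norm v <= norm (Nat.iter (S n) (high G beta) v)
                       + norm (minus v (Nat.iter (S n) (high G beta) v))).
{ rewrite norm_minus_sym. apply norm_le_norm_minus. }
assert (Herr : norm (minus ureg udag) <= norm v + norm (smooth beta)).
{ rewrite <- Hus. apply norm_minus_triangle. }
assert (Hbd : 0 <= Rpower beta (- a) * delta) by (apply Rmult_le_pos; lra).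
unfold K. set (t := Rpower beta (- a) * delta) in *.
assert (0 <= CB * ((b + 1) / c_a + CA * e0) * eta) by (apply Rmult_le_pos; lra).
assert (0 <= CR * ((Cr + 1) * CP) * t) by (apply Rmult_le_pos; lra).
assert (0 <= kappa ^ S n * t) by (apply Rmult_le_pos; lra).
lra.
Qed.

End ErrorBound.

(** * From the error bound to rates *)

Lemma at_right_0_intro (P : R -> Prop) (d : R) : 0 < d ->
  (forall x, 0 < x < d -> P x) -> at_right 0 P.
Proof.
intros Hd H. exists (mkposreal d Hd). intros x Hx H0. apply H.
change (Rabs (x - 0) < d) in Hx. rewrite Rminus_0_r, Rabs_pos_eq in Hx; lra.
Qed.

Lemma Rpower_root (t a : R) : a <> 0 -> 0 < t -> Rpower (Rpower t (/ a)) a = t.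
Proof. intros Ha Ht. rewrite Rpower_mult, Rinv_l, Rpower_1; easy. Qed.

Lemma Rpower_root_lt (t a x : R) : 0 < a -> 0 < x -> t < Rpower x a -> 0 < t -> Rpower t (/ a) < x.
Proof.
intros Ha Hx Ht Ht0. assert (H : Rpower t (/ a) < Rpower (Rpower x a) (/ a)).
{ apply Rlt_Rpower_l; [now apply Rinv_0_lt_compat|easy]. }
now rewrite Rpower_mult, Rinv_r, Rpower_1 in H by lra.
Qed.

Section Rates.

Context (err eta : R -> R) (K e0 h0 d0 a : R).
Context (HK : 0 < K) (He0 : 0 < e0) (Hh0 : 0 < h0) (Hd0 : 0 < d0) (Ha : 0 < a).
Context (Herr0 : forall delta, 0 <= err delta).
Context (Herr : forall delta beta, 0 < delta < d0 -> 0 < beta -> eta beta <= h0 ->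
  Rpower beta a * eta beta <= e0 * delta ->
  err delta <= K * (eta beta + Rpower beta (- a) * delta)).

(** With [eta <= zeta], the choice [beta^a = e0 delta / zeta] makes both terms of the
    bound multiples of [zeta]. *)
Lemma convergence_of_vanishing :
  (forall zeta, 0 < zeta -> exists b0, 0 < b0 /\ forall beta, 0 < beta < b0 -> eta beta <= zeta) ->
  filterlim err (at_right 0) (locally 0).
Proof.
intros H. apply filterlim_locally. intros eps. assert (Heps := cond_pos eps).
assert (Hie : 0 < / e0) by now apply Rinv_0_lt_compat.
set (c := K * (1 + / e0)).
assert (Hc : 0 < c) by (apply Rmult_lt_0_compat; lra).
set (zeta := Rmin h0 (eps / 2 / c)).
assert (Hz : 0 < zeta) by (apply Rmin_pos; [easy|apply Rdiv_lt_0_compat; lra]).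
assert (Hz1 : zeta <= h0) by apply Rmin_l.
assert (Hz2 : zeta <= eps / 2 / c) by apply Rmin_r.
destruct (H zeta Hz) as [b0 [Hb0 Hb]].
assert (Hpb := Rpower_pos b0 a).
assert (Hd1 : 0 < zeta / e0 * Rpower b0 a).
{ apply Rmult_lt_0_compat; [now apply Rdiv_lt_0_compat|easy]. }
apply (at_right_0_intro _ (Rmin d0 (zeta / e0 * Rpower b0 a))); [now apply Rmin_pos|].
intros delta [Hd Hdlt].
pose proof (Rmin_l d0 (zeta / e0 * Rpower b0 a)).
pose proof (Rmin_r d0 (zeta / e0 * Rpower b0 a)).
set (t := e0 * delta / zeta).
assert (Ht : 0 < t) by (apply Rdiv_lt_0_compat; [now apply Rmult_lt_0_compat|easy]).
set (beta := Rpower t (/ a)).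
assert (Hbeta : 0 < beta) by apply Rpower_pos.
assert (Hbb : beta < b0).
{ apply Rpower_root_lt; try easy. unfold t.
  apply (Rmult_lt_reg_r (zeta / e0)); [now apply Rdiv_lt_0_compat|].
  replace (e0 * delta / zeta * (zeta / e0)) with delta by (field; lra). lra. }
assert (Hpa : Rpower beta a = t) by (apply Rpower_root; lra).
assert (Heb := Hb beta (conj Hbeta Hbb)).
assert (Hbound : err delta <= K * (eta beta + Rpower beta (- a) * delta)).
{ apply Herr; try lra. rewrite Hpa. apply Rle_trans with (t * zeta).
  - apply Rmult_le_compat_l; lra.
  - right. unfold t. field. lra. }
rewrite Rpower_Ropp, Hpa in Hbound.
replace (/ t * delta) with (zeta * / e0) in Hbound by (unfold t; field; lra).
change (Rabs (err delta - 0) < eps).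
rewrite Rminus_0_r, Rabs_pos_eq by apply Herr0.
apply Rle_lt_trans with (c * zeta).
- eapply Rle_trans; [exact Hbound|]. unfold c. rewrite Rmult_assoc.
  apply Rmult_le_compat_l; lra.
- apply Rle_lt_trans with (c * (eps / 2 / c)); [apply Rmult_le_compat_l; lra|].
  replace (c * (eps / 2 / c)) with (eps / 2) by (field; lra). lra.
Qed.

(** The choice [beta^(p+a) = t delta] balances the two terms of the bound. *)
Lemma rate_of_power (p D b0 : R) : 0 < p -> 0 < D -> 0 < b0 ->
  (forall beta, 0 < beta < b0 -> eta beta <= D * Rpower beta p) ->
  bigO_at_0 err (fun delta => Rpower delta (p / (p + a))).
Proof.
intros Hp HD Hb0 Heta.
destruct (Rpower_small p (h0 / D)) as [b1 [Hb1 Hsmall]]; [easy|now apply Rdiv_lt_0_compat|].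
set (b2 := Rmin b0 b1).
assert (Hb2 : 0 < b2) by (apply Rmin_pos; lra).
assert (Hb20 : b2 <= b0) by apply Rmin_l. assert (Hb21 : b2 <= b1) by apply Rmin_r.
set (t := e0 / D). assert (Ht : 0 < t) by now apply Rdiv_lt_0_compat.
assert (Hpb := Rpower_pos b2 (p + a)).
exists (K * (D + / t) * Rpower t (p / (p + a))).
apply (at_right_0_intro _ (Rmin d0 (Rpower b2 (p + a) / t))).
{ apply Rmin_pos; [easy|now apply Rdiv_lt_0_compat]. }
intros delta [Hd Hdlt].
pose proof (Rmin_l d0 (Rpower b2 (p + a) / t)). pose proof (Rmin_r d0 (Rpower b2 (p + a) / t)).
assert (Htd : 0 < t * delta) by now apply Rmult_lt_0_compat.
set (beta := Rpower (t * delta) (/ (p + a))).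
assert (Hbeta : 0 < beta) by apply Rpower_pos.
assert (Hbb : beta < b2).
{ apply Rpower_root_lt; try easy; [lra|].
  apply (Rmult_lt_reg_r (/ t)); [now apply Rinv_0_lt_compat|].
  replace (t * delta * / t) with delta by (field; lra). unfold Rdiv in *. lra. }
assert (Hpa : Rpower beta (p + a) = t * delta) by (apply Rpower_root; lra).
assert (Hbp := Rpower_pos beta p). assert (Hba := Rpower_pos beta a).
assert (Heb : eta beta <= D * Rpower beta p) by (apply Heta; lra).
assert (Hbound : err delta <= K * (eta beta + Rpower beta (- a) * delta)).
{ apply Herr; try lra.
  - eapply Rle_trans; [exact Heb|].
    apply Rle_trans with (D * (h0 / D)); [|right; field; lra].
    apply Rmult_le_compat_l; [lra|]. left. apply Hsmall. lra.
  - apply Rle_trans with (Rpower beta a * (D * Rpower beta p)); [apply Rmult_le_compat_l; lra|].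
    right. transitivity (D * Rpower beta (p + a)); [rewrite Rpower_plus; ring|].
    rewrite Hpa. unfold t. field. lra. }
assert (Hres : Rpower beta (- a) * delta = / t * Rpower beta p).
{ rewrite Rpower_Ropp. rewrite Rpower_plus in Hpa.
  replace delta with (/ t * (t * delta)) by (field; lra). rewrite <- Hpa. field. lra. }
rewrite Hres in Hbound.
rewrite Rabs_pos_eq by apply Herr0.
rewrite Rabs_pos_eq by (left; apply Rpower_pos).
rewrite Rmult_assoc, Rpower_mult_distr by easy.
replace (Rpower (t * delta) (p / (p + a))) with (Rpower beta p).
- eapply Rle_trans; [exact Hbound|]. rewrite Rmult_assoc. apply Rmult_le_compat_l; lra.
- unfold beta. rewrite Rpower_mult. f_equal. unfold Rdiv. ring.
Qed.

(** The choice [beta^a = t delta log (1/delta)] keeps [log (1/beta)] comparable with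
    [log (1/delta)] and makes both terms of order [1 / log (1/delta)]. *)
Lemma rate_of_log (D b0 : R) : 0 < D -> 0 < b0 < 1 ->
  (forall beta, 0 < beta < b0 -> eta beta <= D / ln (/ beta)) ->
  bigO_at_0 err (fun delta => / ln (1 / delta)).
Proof.
intros HD Hb0 Heta.
set (t := Rmin (/ 4) (e0 / (2 * a * D))).
assert (HaD : 0 < 2 * a * D) by (repeat apply Rmult_lt_0_compat; lra).
assert (Ht : 0 < t) by (apply Rmin_pos; [lra|now apply Rdiv_lt_0_compat]).
assert (Ht1 : t <= / 4) by apply Rmin_l. assert (Ht2 : t <= e0 / (2 * a * D)) by apply Rmin_r.
assert (Hlb : 0 < - ln b0).
{ assert (ln b0 < ln 1) by (apply ln_increasing; lra). rewrite ln_1 in *. lra. }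
set (M := 2 * a * - ln b0 + 2 * a * D / h0).
assert (HM1 : 0 < 2 * a * - ln b0) by (repeat apply Rmult_lt_0_compat; lra).
assert (HM2 : 0 < 2 * a * D / h0) by now apply Rdiv_lt_0_compat.
exists (K * (2 * a * D + / t)).
apply (at_right_0_intro _ (Rmin d0 (exp (- M)))); [apply Rmin_pos; [easy|apply exp_pos]|].
intros delta [Hd Hdlt].
pose proof (Rmin_l d0 (exp (- M))). pose proof (Rmin_r d0 (exp (- M))).
set (L := - ln delta).
assert (HLM : M < L).
{ assert (ln delta < ln (exp (- M))) by (apply ln_increasing; lra).
  rewrite ln_exp in *. unfold L. lra. }
assert (HL : 0 < L) by (unfold M in HLM; lra).
assert (HtL : 0 < t * delta * L) by (repeat apply Rmult_lt_0_compat; lra).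
set (beta := Rpower (t * delta * L) (/ a)).
assert (Hbeta : 0 < beta) by apply Rpower_pos.
assert (Hpa : Rpower beta a = t * delta * L) by (apply Rpower_root; lra).
(* since beta^a is delta times a logarithmic factor *)
assert (Hlnb : L / (2 * a) <= - ln beta).
{ apply (Rmult_le_reg_l (2 * a)); [lra|].
  replace (2 * a * (L / (2 * a))) with L by (field; lra).
  assert (Hln : a * ln beta = ln (t * L) - L).
  { replace (a * ln beta) with (ln (Rpower beta a)) by (unfold Rpower; apply ln_exp).
    rewrite Hpa. replace (t * delta * L) with (t * L * delta) by ring.
    rewrite ln_mult; [unfold L; ring|now apply Rmult_lt_0_compat|easy]. }
  assert (ln (t * L) <= L / 4).
  { pose proof (ln_upper (t * L) ltac:(now apply Rmult_lt_0_compat)). nra. }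
  lra. }
assert (Hbb : beta < b0).
{ apply ln_lt_inv; [easy|lra|].
  assert (- ln b0 < L / (2 * a)); [|lra].
  apply (Rmult_lt_reg_l (2 * a)); [lra|].
  replace (2 * a * (L / (2 * a))) with L by (field; lra). unfold M in HLM. lra. }
assert (HLa : 0 < L / (2 * a)) by (apply Rdiv_lt_0_compat; lra).
assert (Heb : eta beta <= 2 * a * D / L).
{ eapply Rle_trans; [apply Heta; lra|]. rewrite ln_Rinv by easy.
  replace (2 * a * D / L) with (D * / (L / (2 * a))) by (field; lra).
  apply Rmult_le_compat_l; [lra|]. apply Rinv_le_contravar; lra. }
assert (Hbound : err delta <= K * (eta beta + Rpower beta (- a) * delta)).
{ apply Herr; try lra.
  - eapply Rle_trans; [exact Heb|]. apply (Rmult_le_reg_r L); [easy|].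
    replace (2 * a * D / L * L) with (h0 * (2 * a * D / h0)) by (field; lra).
    apply Rmult_le_compat_l; [lra|]. unfold M in HLM. lra.
  - rewrite Hpa. apply Rle_trans with (t * delta * L * (2 * a * D / L)).
    + apply Rmult_le_compat_l; lra.
    + replace (t * delta * L * (2 * a * D / L)) with (t * (2 * a * D) * delta) by (field; lra).
      apply Rmult_le_compat_r; [lra|].
      apply Rle_trans with (e0 / (2 * a * D) * (2 * a * D)); [|right; field; lra].
      apply Rmult_le_compat_r; lra. }
rewrite Rpower_Ropp, Hpa in Hbound.
replace (/ (t * delta * L) * delta) with (/ t * / L) in Hbound by (field; lra).
replace (ln (1 / delta)) with L by (unfold Rdiv; rewrite Rmult_1_l, ln_Rinv; easy).
rewrite Rabs_pos_eq by apply Herr0.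
rewrite Rabs_pos_eq by (left; now apply Rinv_0_lt_compat).
eapply Rle_trans; [exact Hbound|]. rewrite Rmult_assoc. apply Rmult_le_compat_l; [lra|].
unfold Rdiv in Heb. lra.
Qed.

End Rates.

(** * Smoothness of the exact solution *)

Section LowRange.

Context {X : Banach} (G : X -> X) (kappa : R).
Context (HG : is_linear G) (Hkappa : 0 < kappa).
Context (Hres : nonneg_type_with G kappa).

Lemma low_range_bound (beta : R) (w : X) : 0 < beta ->
  norm (low G beta (G w)) <= (1 + kappa) * norm w * beta.
Proof.
intros Hb. rewrite (low_comm_G G kappa HG Hres), (G_low G HG) by easy.
eapply Rle_trans; [apply norm_scal_pos_le; lra|].
pose proof (high_bound G kappa Hres beta w Hb). nra.
Qed.

(** The initial guess lies in the range of [G], so it contributes [O(beta)], which is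
    dominated by every rate in question. *)
Lemma low_minus_range_bound (beta : R) (w u : X) : 0 < beta ->
  norm (low G beta (minus (G w) u)) <= norm (low G beta u) + (1 + kappa) * norm w * beta.
Proof.
intros Hb.
assert (H : low G beta (minus (G w) u) = minus (low G beta (G w)) (low G beta u)).
{ exact (linear_minus _ _ _ (low_linear G kappa HG Hkappa Hres beta Hb)). }
rewrite H. eapply Rle_trans; [apply norm_minus_le|].
pose proof (low_range_bound beta w Hb). lra.
Qed.

(** On the range of [G] the low part is [O(beta)], and the operators [low beta] are
    uniformly bounded. *)
Lemma low_vanishes_on_closure (u : X) (zeta : R) : in_range_closure G u -> 0 < zeta ->
  exists b0, 0 < b0 /\ forall beta, 0 < beta < b0 -> norm (low G beta u) <= zeta.
Proof.
intros Hu Hz. destruct (Hu (zeta / 2 / kappa)) as [w Hw].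
{ apply Rdiv_lt_0_compat; lra. }
assert (Hw0 := norm_nonneg w).
assert (Hc : 0 < (1 + kappa) * (norm w + 1)) by (apply Rmult_lt_0_compat; lra).
exists (zeta / 2 / ((1 + kappa) * (norm w + 1))). split; [apply Rdiv_lt_0_compat; lra|].
intros beta [Hb Hbb].
eapply Rle_trans; [apply (norm_le_norm_minus _ (low G beta (G w)))|].
assert (H : minus (low G beta (G w)) (low G beta u) = low G beta (minus (G w) u)).
{ symmetry. exact (linear_minus _ _ _ (low_linear G kappa HG Hkappa Hres beta Hb)). }
rewrite H. replace zeta with (zeta / 2 + zeta / 2) by field. apply Rplus_le_compat.
- eapply Rle_trans; [now apply low_range_bound|].
  apply Rle_trans with ((1 + kappa) * (norm w + 1) * beta).
  + apply Rmult_le_compat_r; [lra|]. apply Rmult_le_compat_l; lra.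
  + apply Rle_trans with ((1 + kappa) * (norm w + 1) * (zeta / 2 / ((1 + kappa) * (norm w + 1)))).
    * apply Rmult_le_compat_l; lra.
    * right. field. lra.
- eapply Rle_trans; [now apply (low_bound G kappa Hres)|].
  apply Rle_trans with (kappa * (zeta / 2 / kappa)); [|right; field; lra].
  apply Rmult_le_compat_l; lra.
Qed.

End LowRange.

Theorem theorem10 :
  forall (X Y Z : Banach) (G : X -> X) (DF : X -> Prop) (F : X -> Y)
    (J : X -> Z -> R) (Gt : Z -> Z)
    (fdag : Y) (udag ubar : X)
    (a c_a C_a c0 c1 r b c : R)
    (fd : R -> Y) (ud : R -> R -> X) (alpha : R -> Rbar),
  infinite_dimensional X -> infinite_dimensional Y ->
  (* the operator G *)
  is_linear G ->
  (forall u v, G u = G v -> u = v) ->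
  unbounded_inverse G ->
  nonneg_type G ->
  (* the problem *)
  DF udag -> F udag = fdag ->
  locally_ill_posed_at DF F udag ->
  (* (a) *)
  separable Z -> is_dual_pairing J ->
  (* (b) *)
  (forall (u : nat -> X) (u0 : X), (forall n, DF (u n)) -> DF u0 ->
     weak_star_converges J u u0 ->
     weakly_converges (fun n => F (u n)) (F u0)) ->
  (* (c) *)
  (forall (u : nat -> X) (u0 : X), (forall n, DF (u n)) ->
     weak_star_converges J u u0 -> DF u0) ->
  (* (d) *)
  (exists u, in_D G DF u) ->
  (* (e) *)
  locally udag DF ->
  (* (f) *)
  (forall delta, 0 < delta -> norm (minus (fd delta) fdag) <= delta) ->
  in_D G DF ubar ->
  (* (g) *)
  0 < a -> 0 < c_a -> c_a <= C_a -> 0 < c0 -> 0 < c1 ->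
  (forall u, in_D G DF u -> scale_norm G (- a) (minus u udag) <= c0 ->
     norm (minus (F u) fdag) <= C_a * scale_norm G (- a) (minus u udag)) ->
  (forall u, in_D G DF u -> norm (minus (F u) fdag) <= c1 ->
     c_a * scale_norm G (- a) (minus u udag) <= norm (minus (F u) fdag)) ->
  (* (h) *)
  is_linear Gt -> (forall x z, J (G x) z = J x (Gt z)) ->
  (* regularized solutions *)
  0 < r ->
  (forall delta al, 0 < delta -> 0 < al ->
     is_minimizer G DF F r ubar (fd delta) al (ud delta al)) ->
  (* discrepancy principle *)
  e_const r < b -> 1 < c ->
  (forall delta, 0 < delta ->
     discrepancy_principle F b c ubar delta (fd delta) (ud delta) (alpha delta)) ->
  let err := fun delta =>
    norm (minus (reg_solution ubar (ud delta) (alpha delta)) udag) in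
  (in_range_closure G udag -> filterlim err (at_right 0) (locally 0)) /\
  (forall p, 0 < p <= 1 -> in_scale G p udag ->
     bigO_at_0 err (fun delta => Rpower delta (p / (p + a)))) /\
  (in_dom_log G udag -> bigO_at_0 err (fun delta => / ln (1 / delta))).
Proof.
intros X Y Z G DF F J Gt fdag udag ubar a c_a C_a c0 c1 r b c fd ud alpha
  _ _ HG Hinj _ [kappa [Hkappa Hres]] _ _ _ _ _ _ _ _ Hint Hfd Hubar
  Ha Hca HCa Hc0 Hc1 Hup Hlo _ _ Hr Hmin Hb Hc Hdis err.
assert (Hb1 : 1 < b) by (pose proof (e_const_ge_1 r Hr); lra).
destruct (error_bound G kappa HG Hinj Hkappa Hres DF F fdag udag ubar a c_a C_a c0 c1 r b c
  fd ud alpha Hint Hfd Hubar Ha Hca HCa Hc0 Hc1 Hup Hlo Hr Hb1 Hc Hmin Hdis)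
  as [K [e0 [h0 [d0 [HK [He0 [Hh0 [Hd0 Herr]]]]]]]].
fold err in Herr.
set (eta := fun beta => norm (low G beta (minus ubar udag))).
change (forall delta beta, 0 < delta < d0 -> 0 < beta -> eta beta <= h0 ->
  Rpower beta a * eta beta <= e0 * delta ->
  err delta <= K * (eta beta + Rpower beta (- a) * delta)) in Herr.
assert (Herr0 : forall delta, 0 <= err delta) by (intros delta; apply norm_nonneg).
destruct (proj1 (in_scale_1 G ubar) (proj2 Hubar)) as [w0 Hw0].
set (N := (1 + kappa) * norm w0).
assert (HN : 0 <= N) by (apply Rmult_le_pos; [lra|apply norm_nonneg]).
assert (Heta : forall beta, 0 < beta -> eta beta <= norm (low G beta udag) + N * beta).
{ intros beta Hbeta. unfold eta. rewrite <- Hw0.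
  now apply (low_minus_range_bound G kappa HG Hkappa Hres). }
split; [|split].
- intros Hcl. apply (convergence_of_vanishing err eta K e0 h0 d0 a); try easy.
  intros zeta Hz.
  destruct (low_vanishes_on_closure G kappa HG Hkappa Hres udag (zeta / 2) Hcl) as [b0 [Hb0 Hlow]];
    [lra|].
  assert (HzN : 0 < zeta / 2 / (N + 1)) by (apply Rdiv_lt_0_compat; lra).
  exists (Rmin b0 (zeta / 2 / (N + 1))). split; [now apply Rmin_pos|].
  intros beta [Hbeta Hbb].
  pose proof (Rmin_l b0 (zeta / 2 / (N + 1))). pose proof (Rmin_r b0 (zeta / 2 / (N + 1))).
  eapply Rle_trans; [now apply Heta|].
  assert (norm (low G beta udag) <= zeta / 2) by (apply Hlow; lra).
  assert (N * beta <= zeta / 2); [|lra].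
  apply Rle_trans with ((N + 1) * (zeta / 2 / (N + 1))); [|right; field; lra].
  apply Rmult_le_compat; lra.
- intros p Hp Hsc. destruct (Hsc (proj1 Hp)) as [w Hw].
  rewrite gpow_nonneg in Hw by lra.
  destruct (low_frac_pow_bound G kappa HG Hkappa Hres p Hp) as [C [HC Hlow]].
  assert (HCw : 0 <= C * norm w) by (apply Rmult_le_pos; [lra|apply norm_nonneg]).
  apply (rate_of_power err eta K e0 h0 d0 a) with (D := C * norm w + N + 1) (b0 := 1); try easy; try lra.
  intros beta [Hbeta Hb1']. eapply Rle_trans; [now apply Heta|].
  assert (Hl := Hlow beta w Hbeta). rewrite Hw in Hl.
  assert (Hpow : beta <= Rpower beta p).
  { rewrite <- (Rinv_inv beta) at 2. rewrite Rpower_inv_base by now apply Rinv_0_lt_compat.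
    rewrite Rpower_Ropp. rewrite <- (Rinv_inv beta) at 1. apply Rinv_le_contravar.
    - apply Rpower_pos.
    - rewrite <- (Rpower_1 (/ beta)) at 2 by now apply Rinv_0_lt_compat.
      apply Rle_Rpower; [|lra]. rewrite <- Rinv_1. apply Rinv_le_contravar; lra. }
  assert (N * beta <= N * Rpower beta p) by (apply Rmult_le_compat_l; lra).
  pose proof (Rpower_pos beta p). lra.
- intros Hlog.
  destruct (low_dom_log_bound G kappa HG Hkappa Hres udag Hlog) as [C [b0 [HC [Hb0 Hlow]]]].
  apply (rate_of_log err eta K e0 h0 d0 a) with (D := C + N) (b0 := b0); try easy; try lra.
  intros beta [Hbeta Hbb]. eapply Rle_trans; [now apply Heta|].
  assert (Hl := Hlow beta (conj Hbeta Hbb)).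
  assert (Hln : 0 < ln (/ beta)).
  { rewrite <- ln_1. apply ln_increasing; [lra|]. rewrite <- Rinv_1.
    apply Rinv_lt_contravar; lra. }
  assert (Hbl : beta <= / ln (/ beta)).
  { rewrite <- (Rinv_inv beta) at 1. apply Rinv_le_contravar; [easy|].
    pose proof (ln_upper (/ beta) ltac:(now apply Rinv_0_lt_compat)). lra. }
  assert (N * beta <= N * / ln (/ beta)) by (apply Rmult_le_compat_l; lra).
  unfold Rdiv in *. lra.
Qed.
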